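(* Let $N\ge 1$, let $H^\alpha:\mathbb{R}\to\mathbb{R}$, $\alpha=1,\dots,N$, be continuous and coercive ($H^\alpha(s)\to+\infty$ as $|s|\to+\infty$), and let $F_0:\mathbb{R}^N\to\mathbb{R}$ be continuous and nonincreasing in each of its arguments. Let $p\in\mathbb{R}^N$ and let $u$ be the unique weak $F_0$-solution of the Riemann problem $$\begin{cases}u_t+H^\alpha(u_x)=0 & \text{on }(0,+\infty)\times J_\alpha^*,\ \alpha=1,\dots,N,\\ u_t+F_0(\partial_1u(t,0^+),\dots,\partial_Nu(t,0^+))=0 & \text{on }(0,+\infty)\times\{0\},\\ u(0,x)=u_0(x):=p^\alpha x & \text{for } x\in J_\alpha,\ \alpha=1,\dots,N,\end{cases}$$ that satisfies the weak continuity condition and for which, for every $T>0$, $|u-u_0|$ is bounded on $[0,T)\times J$ (such a $u$ exists and is unique). Then $$\mathfrak{R}F_0(p)=-u_t(t,0)\quad\text{for all }t>0.$$ Moreover, the restriction of $u$ to each branch has a derivative at $x=0$ and $$u_x(t,0^+)=\hat p\quad\text{for all }t>0,$$ where $\hat p\in\mathbb{R}^N$ is given, with $F=\mathfrak{R}F_0$, by $$\hat p^\alpha=\begin{cases}p^\alpha & \text{if }H^\alpha(p^\alpha)=F(p),\\ \sup\{q^\alpha\ge p^\alpha:\ H^\alpha(q'^\alpha)<F(p)\ \text{for all }q'^\alpha\in[p^\alpha,q^\alpha)\} & \text{if }H^\alpha(p^\alpha)<F(p),\\ \inf\{q^\alpha\le p^\alpha:\ H^\alpha(q'^\alpha)>F(p)\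 \text{for all }q'^\alpha\in(q^\alpha,p^\alpha]\} & \text{if }H^\alpha(p^\alpha)>F(p).\end{cases}$$ Moreover $F(\hat p)=F(p)$, and in particular $(F(\hat p),\hat p)$ belongs to the germ $$\mathcal G=\{(\lambda,q)\in\mathbb{R}\times\mathbb{R}^N:\ \lambda=F(q)=H^\alpha(q^\alpha)\ \text{for all }\alpha=1,\dots,N\}.$$ Therefore $$F(p)=F(\hat p)=G^\alpha(\hat p^\alpha,p^\alpha)=H^\alpha(\hat p^\alpha)\quad\text{for all }\alpha=1,\dots,N.$$
   Context: Junction: $J=\bigcup_{\alpha=1}^N J_\alpha$, where the $J_\alpha$ are $N$ copies of $[0,+\infty)$ glued at the origin, $J_\alpha\cap J_\beta=\{0\}$ for $\alpha\neq\beta$; $J_\alpha^*=J_\alpha\setminus\{0\}$. For a function $\varphi$ on $(0,+\infty)\times J$, $\varphi_x(t,x)=\partial_\alpha\varphi(t,x)$ if $x\in J_\alpha^*$, and $\varphi_x(t,0)=\varphi_x(t,0^+)=(\partial_1\varphi(t,0^+),\dots,\partial_N\varphi(t,0^+))$. Test functions: continuous $\varphi$ on $(0,+\infty)\times J$ whose restriction to each $(0,+\infty)\times J_\alpha$ is $C^1$ (up to $x=0$). ''Touching from above/below at a point'' means $\varphi\ge$ / $\le$ the function in a neighborhood, with equality at the point. For $p\in\mathbb{R}^N$: $H_{\min}(p)=\min_\alpha H^\alpha(p^\alpha)$, $H_{\max}(p)=\max_\alpha H^\alpha(p^\alpha)$; $q\le p$ is componentwise. Weak $F_0$-solution of the problem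 with initial datum $u_0$: a function $u:[0,+\infty)\times J\to\mathbb{R}$ such that its upper (resp. lower) semicontinuous envelope $u^*$ (resp. $u_*$) is locally bounded from above (resp. below); for every test function $\varphi$ touching $u^*$ from above (resp. $u_*$ from below) at $(t_0,x_0)$ with $t_0>0$ one has, if $x_0\in J_\alpha^*$, $\varphi_t+H^\alpha(\varphi_x)\le 0$ (resp. $\ge 0$), and, if $x_0=0$, $\varphi_t+\min\{F_0(\varphi_x),H_{\min}(\varphi_x)\}\le 0$ (resp. $\varphi_t+\max\{F_0(\varphi_x),H_{\max}(\varphi_x)\}\ge 0$) at $(t_0,x_0)$; and $u^*(0,\cdot)\le u_0\le u_*(0,\cdot)$ on $J$. Weak continuity condition: $u(t,0)=\limsup_{(s,y)\to(t,0),\,y\in J_\alpha^*}u(s,y)$ for all $t>0$ and each $\alpha$. Relaxation: $\underline R F(p)=\sup_{q\ge p}\min\{F(q),H_{\min}(q)\}$, $\overline R F(p)=\inf_{q\le p}\max\{F(q),H_{\max}(q)\}$, and $\mathfrak{R}F_0:=\underline R\,\overline R F_0=\overline R\,\underline R F_0$ (these coincide under the stated assumptions). Godunov flux: for $a,b\in\mathbb{R}$, $G^\alpha(a,b)=\min_{[a,b]}H^\alpha$ if $a\le b$ and $G^\alpha(a,b)=\max_{[b,a]}H^\alpha$ if $a\ge b$. *)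

(* Defs.v *)
From HB Require Import structures.
From mathcomp Require Import all_boot all_order all_algebra.
From mathcomp Require Import all_classical all_reals all_analysis.
From mathcomp Require Import wedge_sigT.
Import Order.TTheory GRing.Theory Num.Theory.
Import numFieldNormedType.Exports.

Set Implicit Arguments.
Unset Strict Implicit.
Unset Printing Implicit Defensive.

Local Open Scope classical_set_scope.
Local Open Scope ring_scope.

(* The junction has N = n.+1 branches, indexed by 'I_n.+1, and R^N is
   'rV[R]_n.+1. *)

(* A branch is the type [0, +oo[ with the topology induced by R, so that at 0
   limits in a branch are one-sided. *)
Definition halfline (R : realType) : topologicalType :=
  set_type (`[0, +oo[%classic : set R).

Lemma halfline0_subproof (R : realType) : (0 : R) \in (`[0, +oo[%classic : set R).
Proof. by rewrite inE /= in_itv /= lexx. Qed.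

Definition halfline0 (R : realType) : halfline R :=
  exist _ 0 (halfline0_subproof R).

Definition hval (R : realType) (x : halfline R) : R := set_val x.

Definition junction (R : realType) (n : nat) : topologicalType :=
  wedge (fun _ : 'I_n.+1 => halfline0 R).

(* The point of abscissa x on the branch J_a. *)
Definition branch (R : realType) (n : nat) (a : 'I_n.+1) (x : halfline R)
  : junction R n := @wedge_lift _ _ (fun _ : 'I_n.+1 => halfline0 R) a x.

(* By the gluing, branch a (halfline0 R) is the same point for every a. *)
Definition origin (R : realType) (n : nat) : junction R n :=
  branch ord0 (halfline0 R).

Definition open_branch (R : realType) (n : nat) (a : 'I_n.+1)
  : set (junction R n) := [set branch a x | x in [set x | 0 < hval x]].

Section Derivatives.
Context (R : realType) (n : nat).
Implicit Types (f : halfline R -> R) (phi : R -> junction R n -> R).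

(* Limits as y tends to x are taken in the space [0, +oo[, so that at x = 0
   the limit of the difference quotient is the right derivative. *)
Definition diff_quot f (x y : halfline R) : R :=
  (f y - f x) / (hval y - hval x).

Definition hderivable f (x : halfline R) : Prop := cvg (diff_quot f x @ x^').

Definition has_hderiv f (x : halfline R) (l : R) : Prop :=
  diff_quot f x @ x^' --> l.

Definition hderiv f (x : halfline R) : R := lim (diff_quot f x @ x^').

Definition dt phi (t : R) (x : junction R n) : R := derive1 (phi ^~ x) t.

Definition dx phi (a : 'I_n.+1) (t : R) (x : halfline R) : R :=
  hderiv (fun y => phi t (branch a y)) x.

Definition dx0 phi (t : R) : 'rV[R]_n.+1 :=
  \row_a dx phi a t (halfline0 R).

Definition test_function phi : Prop :=
  (forall t x, 0 < t ->
    {for (t, x), continuous (fun z : R * junction R n => phi z.1 z.2)}) /\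
  (forall (a : 'I_n.+1) t (x : halfline R), 0 < t ->
    [/\ derivable (phi ^~ (branch a x)) t 1,
        hderivable (fun y => phi t (branch a y)) x,
        {for (t, x), continuous
          (fun z : R * halfline R => dt phi z.1 (branch a z.2))} &
        {for (t, x), continuous
          (fun z : R * halfline R => dx phi a z.1 z.2)}]).

End Derivatives.

Section Solutions.
Context (R : realType) (n : nat).
Implicit Types (u phi : R -> junction R n -> R) (p q : 'rV[R]_n.+1).
Implicit Types (H : 'I_n.+1 -> R -> R) (F : 'rV[R]_n.+1 -> R).

(* A function on [0, +oo[ x J is a function on R x J of which only the values
   at times t >= 0 are used: this filter consists of the neighbourhoods of a
   point in [0, +oo[ x J. *)
Definition nbhs_dom (t : R) (x : junction R n) : set_system (R * junction R n) :=
  within [set z | 0 <= z.1] (nbhs (t, x)).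

Definition usc_env u (t : R) (x : junction R n) : \bar R :=
  limf_esup (fun z => (u z.1 z.2)%:E) (nbhs_dom t x).

Definition lsc_env u (t : R) (x : junction R n) : \bar R :=
  limf_einf (fun z => (u z.1 z.2)%:E) (nbhs_dom t x).

Definition loc_bounded_above (v : R -> junction R n -> \bar R) : Prop :=
  forall t x, 0 <= t ->
    exists M : R, \forall z \near nbhs_dom t x, (v z.1 z.2 <= M%:E)%E.

Definition loc_bounded_below (v : R -> junction R n -> \bar R) : Prop :=
  forall t x, 0 <= t ->
    exists M : R, \forall z \near nbhs_dom t x, (M%:E <= v z.1 z.2)%E.

Definition touches_from_above phi (v : R -> junction R n -> \bar R) t x : Prop :=
  (phi t x)%:E = v t x /\
  \forall z \near (t, x), (v z.1 z.2 <= (phi z.1 z.2)%:E)%E.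

Definition touches_from_below phi (v : R -> junction R n -> \bar R) t x : Prop :=
  (phi t x)%:E = v t x /\
  \forall z \near (t, x), ((phi z.1 z.2)%:E <= v z.1 z.2)%E.

(* The seed of each fold is one of its terms. *)
Definition Hmin H p : R :=
  \big[Num.min/H ord0 (p ord0 ord0)]_(a < n.+1) H a (p ord0 a).

Definition Hmax H p : R :=
  \big[Num.max/H ord0 (p ord0 ord0)]_(a < n.+1) H a (p ord0 a).

Definition weak_sub H F u : Prop :=
  loc_bounded_above (usc_env u) /\
  forall phi t, test_function phi -> 0 < t ->
    (forall a x, 0 < hval x ->
      touches_from_above phi (usc_env u) t (branch a x) ->
      dt phi t (branch a x) + H a (dx phi a t x) <= 0) /\
    (touches_from_above phi (usc_env u) t (origin R n) ->
      dt phi t (origin R n) +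
        Num.min (F (dx0 phi t)) (Hmin H (dx0 phi t)) <= 0).

Definition weak_super H F u : Prop :=
  loc_bounded_below (lsc_env u) /\
  forall phi t, test_function phi -> 0 < t ->
    (forall a x, 0 < hval x ->
      touches_from_below phi (lsc_env u) t (branch a x) ->
      0 <= dt phi t (branch a x) + H a (dx phi a t x)) /\
    (touches_from_below phi (lsc_env u) t (origin R n) ->
      0 <= dt phi t (origin R n) +
        Num.max (F (dx0 phi t)) (Hmax H (dx0 phi t))).

Definition weak_solution H F (u0 : junction R n -> R) u : Prop :=
  [/\ weak_sub H F u, weak_super H F u &
      forall x, (usc_env u 0 x <= (u0 x)%:E)%E /\
                ((u0 x)%:E <= lsc_env u 0 x)%E].

Definition weak_continuity u : Prop :=
  forall t, 0 < t -> forall a : 'I_n.+1,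
    (u t (origin R n))%:E =
    limf_esup (fun z : R * junction R n => (u z.1 z.2)%:E)
      (within [set z | open_branch a z.2] (nbhs (t, origin R n))).

Definition riemann_datum p : junction R n -> R :=
  wedge_fun (fun (a : 'I_n.+1) (x : halfline R) => p ord0 a * hval x).

Definition bounded_distance (u0 : junction R n -> R) u : Prop :=
  forall T : R, 0 < T -> exists M : R,
    forall t x, 0 <= t -> t < T -> `|u t x - u0 x| <= M.

Definition riemann_solution H F p u : Prop :=
  [/\ weak_solution H F (riemann_datum p) u, weak_continuity u &
      bounded_distance (riemann_datum p) u].

End Solutions.

Section Relaxation.
Context (R : realType) (n : nat).
Implicit Types (p q : 'rV[R]_n.+1).
Implicit Types (H : 'I_n.+1 -> R -> R) (F : 'rV[R]_n.+1 -> R).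

Definition coercive (h : R -> R) : Prop :=
  (h s @[s --> +oo] --> +oo) /\ (h s @[s --> -oo] --> +oo).

Definition nonincreasing_each F : Prop :=
  forall (a : 'I_n.+1) p q, (forall b, b != a -> p ord0 b = q ord0 b) ->
    p ord0 a <= q ord0 a -> F q <= F p.

Definition vle q p : Prop := forall a, q ord0 a <= p ord0 a.

(* When F is nonincreasing in each argument, F p bounds from above (resp.
   below) the set of which sup (resp. inf) is taken, so both are genuine. *)
Definition lower_relax H F p : R :=
  sup [set Num.min (F q) (Hmin H q) | q in [set q | vle p q]].

Definition upper_relax H F p : R :=
  inf [set Num.max (F q) (Hmax H q) | q in [set q | vle q p]].

(* For continuous coercive H and continuous F nonincreasing in each argument,
   the two relaxations commute. *)
Definition relax H F : 'rV[R]_n.+1 -> R := lower_relax H (upper_relax H F).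

(* For continuous h, the extrema over the compact intervals are attained. *)
Definition godunov (h : R -> R) (a b : R) : R :=
  if a <= b then inf (h @` `[a, b]) else sup (h @` `[b, a]).

(* For coercive H the sup is finite; for F a relaxation, so is the inf. *)
Definition hat H F p : 'rV[R]_n.+1 :=
  \row_a
    if H a (p ord0 a) == F p then p ord0 a
    else if H a (p ord0 a) < F p then
      sup [set q : R | p ord0 a <= q /\
             forall q' : R, q' \in `[p ord0 a, q[ -> H a q' < F p]
    else
      inf [set q : R | q <= p ord0 a /\
             forall q' : R, q' \in `]q, p ord0 a] -> F p < H a q'].

Definition germ H F : set (R * 'rV[R]_n.+1) :=
  [set lq | lq.1 = F lq.2 /\ forall a, lq.1 = H a (lq.2 ord0 a)].

End Relaxation.

(* Main.v *)
(* Let lam = F(p) with F the relaxed flux, and let hat p be the critical slopes,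
   so that H^a(hat p^a) = lam.  The solution is explicit: on each branch it is
   Hopf's formula, a supremum (if hat p^a <= p^a) or an infimum (otherwise) of
   the affine solutions q x - t H^a(q) over the slopes q between p^a and
   hat p^a; it equals - lam t at the origin and has slope hat p^a there.

   Uniqueness needs no doubling of variables.  Subsolutions are compared with
   barriers f = t Psi(x / t), where Psi is a C^1 average of a supremum of affine
   functions of slopes in some interval [c, d].  Since t f_t + x f_x = f, such an
   f is a supersolution as soon as f >= q x - t H^a(q) for all q in [c, d].  At
   the origin there are two cases.  Either there is r <= hat p with
   H^a >= lam on [r^a, hat p^a] for all a and F0(r) >= lam; then barriers of slope
   r^a at 0 cannot be touched at the origin.  Or H^a >= lam on ]-oo, hat p^a] for
   some a; then kappa t^2 / x can be added to the barrier on the branch a, which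
   keeps maxima off the origin, and weak continuity carries the bound over to
   x = 0.  Both give u(t, 0) <= - lam t, and what remains is a Dirichlet problem
   on each branch.  Supersolutions reduce to subsolutions by u |-> - u, which
   changes H^a(q) into - H^a(- q) and F0(q) into - F0(- q). *)

Require Import Defs.
From mathcomp Require Import all_boot all_order all_algebra.
From mathcomp Require Import all_classical all_reals all_analysis.
From mathcomp Require Import wedge_sigT ring lra.
Import Order.TTheory GRing.Theory Num.Theory.
Import numFieldNormedType.Exports.
Local Open Scope classical_set_scope.
Local Open Scope ring_scope.

Set Implicit Arguments.
Unset Strict Implicit.
Unset Printing Implicit Defensive.

(** * Coordinates on the junction *)

(** The two cases at the origin are read off the sup-inf in [relax]. That expression only provides
    approximate competitors; continuity of [F0] and of the Hamiltonians turns them into exact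
    endpoints: [s >= hat p] with [H <= lam] on [[hat p, s]] and [F0 s <= lam], and [r <= hat p] with
    the opposite inequalities. Coercivity at +oo always yields [s]. But [H] also tends to +oo at
    -oo, so it may stay above [lam] on all of []-oo, hat p^a]], and then [r] need not exist. This is
    why the upper bound on [u] at the origin has two cases and appeals to weak continuity, whereas
    the lower bound, obtained from [- u], always has the slopes [- s] available.

    The dual Hamiltonian tends to -oo, so what is applied to both [u] and [- u] rests on continuity
    and on the level structure recorded in [wave_profile], a notion stable under duality. Coercivity
    does its work in the study of [relax] and [hat].

    The difference of [u] and a barrier need not be semicontinuous, so maxima are replaced by points
    near which the supremum persists; these are the points where the envelope is touched. *)

Lemma cvg_map_snd (T U V : topologicalType) (f : U -> V) (t : T) (y : U) :
  {for y, continuous f} ->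
  (fun w : T * U => (w.1, f w.2)) w @[w --> (t, y)] --> (t, f y).
Proof.
move=> cf; apply: (@cvg_pair _ _ _ (nbhs (t, y)) (nbhs t) (nbhs (f y)) _ _ _
  fst (f \o snd)); first exact: cvg_fst.
apply: (@cvg_comp _ _ _ snd f (nbhs (t, y)) (nbhs y)); first exact: cvg_snd.
exact: cf.
Qed.

Arguments cvg_map_snd {T U V f} t {y} _.

Section Junction.
Context (R : realType) (n : nat).
Implicit Types (x : halfline R) (z : junction R n) (a b : 'I_n.+1) (t y : R).

Lemma hval_ge0 x : 0 <= hval x.
Proof.
case: x => v hv; rewrite /hval set_valE /=.
by move: hv; rewrite inE /= in_itv /= andbT.
Qed.

Lemma hval_inj x x' : hval x = hval x' -> x = x'.
Proof. by case: x x' => [v hv] [w hw] /= vw; exact: eq_exist. Qed.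

Lemma halfline_subproof y :
  Num.max 0 y \in (`[0, +oo[%classic : set R).
Proof. by rewrite inE /= in_itv /= andbT le_max lexx. Qed.

(** Clamping at 0 gives a total continuous section of [hval], so that points of a branch are indexed
    by arbitrary reals. *)
Definition hl y : halfline R := exist _ (Num.max 0 y) (halfline_subproof y).

Lemma hval_hl y : 0 <= y -> hval (hl y) = y.
Proof. by move=> y0; rewrite /hval set_valE /=; apply/max_idPr. Qed.

Lemma hl_hval x : hl (hval x) = x.
Proof. by apply: hval_inj; rewrite hval_hl // hval_ge0. Qed.

Lemma hl0 : hl 0 = halfline0 R.
Proof. by apply: hval_inj; rewrite hval_hl. Qed.

Lemma hval_continuous : continuous (@hval R).
Proof. exact: initial_continuous. Qed.

Lemma hl_continuous : continuous hl.
Proof.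
apply: continuous_comp_initial => y.
have -> : set_val \o hl = (fun y : R => Num.max 0 y) by [].
by apply: continuous_max; [exact: cst_continuous|move=> ?; exact: cvg_id].
Qed.

Definition br a y : junction R n := branch a (hl y).

Lemma br0 a : br a 0 = origin R n.
Proof. by rewrite /br hl0; exact: (@wedge_liftE _ _ (fun _ => halfline0 R) ord0 (halfline0 R) a (halfline0 R)). Qed.

Lemma branch_br a x : branch a x = br a (hval x).
Proof. by rewrite /br hl_hval. Qed.

Lemma brP z : exists a y, 0 <= y /\ z = br a y.
Proof.
have : (\bigcup_a (@branch R n a @` setT)) z by rewrite wedgeTE.
by case=> a _ [x _ <-]; exists a, (hval x); rewrite hval_ge0 branch_br.
Qed.

Lemma br_continuous a : continuous (br a).
Proof.
move=> y; apply: (@continuous_comp _ _ _ hl (@branch R n a)).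
  exact: hl_continuous.
exact: wedge_lift_continuous.
Qed.

(** The value 0 off branch [a] makes this continuous on the whole junction and makes [0 < coord a z]
    the open branch. *)
Definition coord a z : R :=
  wedge_fun (fun b x => if b == a then hval x else 0) z.

Lemma coord_agree a b c :
  (if b == a then hval (halfline0 R) else 0) =
  (if c == a then hval (halfline0 R) else 0).
Proof. by rewrite -hl0 hval_hl //; do 2 case: ifP. Qed.

Lemma coord_br a b y : 0 <= y -> coord a (br b y) = if b == a then y else 0.
Proof.
move=> y0; rewrite /coord /br wedge_lift_funE; last exact: coord_agree.
by rewrite hval_hl.
Qed.

Lemma coord_continuous a : continuous (coord a).
Proof.
apply: wedge_fun_continuous; last exact: coord_agree.
by move=> b; case: (b == a); [exact: hval_continuous|exact: cst_continuous].
Qed.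

Lemma coord_ge0 a z : 0 <= coord a z.
Proof. by have [b [y [y0 ->]]] := brP z; rewrite coord_br //; case: ifP. Qed.

Lemma coord_gt0 a z : 0 < coord a z -> z = br a (coord a z).
Proof.
have [b [y [y0 ->]]] := brP z; rewrite coord_br //.
by case: eqP => [->|_]; rewrite ?ltxx.
Qed.

Lemma open_branchE a : open_branch a = [set z | 0 < coord a z].
Proof.
apply/seteqP; split=> [_ [x /= x0 <-]|z /= z0].
  by rewrite branch_br coord_br ?hval_ge0 // eqxx.
by rewrite (coord_gt0 z0); exists (hl (coord a z)); rewrite //= hval_hl // ltW.
Qed.

(* The coordinate maps embed the junction into R^N, which turns neighbourhoods
   in the junction into neighbourhoods in R. *)
Lemma near_br a t y (P : R -> R -> Prop) : 0 < y ->
  (\forall w \near (t, y), P w.1 w.2) ->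
  \forall z \near (t, br a y),
    [/\ 0 < coord a z.2, z.2 = br a (coord a z.2) & P z.1 (coord a z.2)].
Proof.
move=> y0 HP.
have cy : coord a (br a y) = y by rewrite coord_br ?ltW // eqxx.
have H : \forall w \near (t, y), P w.1 w.2 /\ 0 < w.2.
  apply: filterI => //.
  exact: (@cvg_snd _ _ (nbhs t) (nbhs y) _ [set y' | 0 < y'] (lt_nbhsr y0)).
have := cvg_map_snd t (@coord_continuous a (br a y)).
rewrite cy => cvgc.
have K : \forall z \near (t, br a y), P z.1 (coord a z.2) /\ 0 < coord a z.2.
  exact: (cvgc _ H).
by apply: filterS K => z [Pz z0]; split => //; exact: coord_gt0.
Qed.

Lemma near_origin t (P : 'I_n.+1 -> R -> R -> Prop) :
  (forall a, \forall w \near (t, 0 : R), 0 <= w.2 -> P a w.1 w.2) ->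
  \forall z \near (t, origin R n),
    forall a, z.2 = br a (coord a z.2) -> P a z.1 (coord a z.2).
Proof.
move=> HP; apply: (@filter_forall _ _ (fun a (z : R * junction R n) =>
  z.2 = br a (coord a z.2) -> P a z.1 (coord a z.2)) (nbhs (t, origin R n))) => a.
have c0 : coord a (origin R n) = 0 by rewrite -(br0 a) coord_br // eqxx.
have := cvg_map_snd t (@coord_continuous a (origin R n)).
rewrite c0 => cvgc.
have K : \forall z \near (t, origin R n),
    0 <= coord a z.2 -> P a z.1 (coord a z.2) by exact: (cvgc _ (HP a)).
by apply: filterS K => z + _; apply; exact: coord_ge0.
Qed.

Lemma brE z : exists a, z = br a (coord a z).
Proof.
by have [a [y [y0 ->]]] := brP z; exists a; rewrite coord_br // eqxx.
Qed.

Lemma compact_ball (T X : R) :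
  compact (`[0, T] `*` (\bigcup_(a in [set: 'I_n.+1]) (br a @` `[0, X]))).
Proof.
apply: compact_setX; first exact: segment_compact.
rewrite -fsbig_setU; last exact: finite_finset.
apply: big_ind.
- exact: compact0.
- by move=> ? ? ? ?; exact: compactU.
move=> a _; apply: continuous_compact; last exact: segment_compact.
exact/continuous_subspaceT/br_continuous.
Qed.

End Junction.
Arguments hl {R} y.
Arguments br {R n} a y.
Arguments coord {R n} a z.
(** * Test functions *)

Section HalflineDerivative.
Context (R : realType).
Implicit Types (x y : halfline R) (f : halfline R -> R).

Lemma near_halfP x (P : set (halfline R)) :
  (\forall y \near x, P y) <->
  exists2 d : R, 0 < d & forall y, `|hval y - hval x| < d -> P y.
Proof.
split=> [HP|[d d0 Pd]].
  have : \forall r \near hval x, P (hl r).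
    by apply: hl_continuous; rewrite hl_hval.
  move=> /nbhs_ballP[d /= d0 dP]; exists d => // y yd.
  by rewrite -(hl_hval y); apply: dP; rewrite /ball /= distrC.
have : \forall y \near x, ball (hval x) d (hval y).
  by apply: hval_continuous; exact: nbhsx_ballx.
by apply: filterS => y; rewrite /ball /= distrC; exact: Pd.
Qed.

(** A step of [d / 2] to the right never leaves the half-line, so even 0 is not isolated; limits of
    difference quotients are therefore unique. *)
Lemma dnbhs_half_proper x : ProperFilter x^'.
Proof.
apply: Build_ProperFilter_ex => P HP.
have : \forall y \near x, y != x -> P y by [].
move=> /near_halfP[d d0 dP].
exists (hl (hval x + d / 2)); have x0 := hval_ge0 x.
have hE : hval (hl (hval x + d / 2)) = hval x + d / 2 by rewrite hval_hl //; lra.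
apply: dP; first by rewrite hE addrC addKr gtr0_norm; lra.
apply/eqP => /(congr1 (@hval R)); rewrite hE; lra.
Qed.

(** Multiplying out the quotient gives an estimate that also holds at [y = x], so the punctured
    filter disappears. *)
Lemma has_hderivP f x (l : R) : has_hderiv f x l <->
  forall e : R, 0 < e -> exists2 d : R, 0 < d &
    forall y, `|hval y - hval x| < d ->
      `|f y - f x - l * (hval y - hval x)| <= e * `|hval y - hval x|.
Proof.
have ? := dnbhs_half_proper x.
split=> [/cvgrPdist_le fl e e0|H].
  have : \forall y \near x, y != x -> `|l - diff_quot f x y| <= e by exact: fl.
  move=> /near_halfP[d d0 dP]; exists d => // y yd.
  have [->|yx] := eqVneq y x; first by rewrite !subrr mulr0 subrr normr0 mulr0.
  have yx0 : hval y - hval x != 0.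
    by apply: contra yx; rewrite subr_eq0 => /eqP/hval_inj ->.
  have -> : f y - f x - l * (hval y - hval x) =
      - (l - diff_quot f x y) * (hval y - hval x).
    by rewrite /diff_quot; field.
  by rewrite normrM normrN ler_wpM2r // dP.
apply/cvgrPdist_le => e e0; have [d d0 dP] := H e e0.
suff : \forall y \near x, y != x -> `|l - diff_quot f x y| <= e by [].
apply/near_halfP; exists d => // y yd yx.
have yx0 : hval y - hval x != 0.
  by apply: contra yx; rewrite subr_eq0 => /eqP/hval_inj ->.
rewrite -(ler_pM2r (x := `|hval y - hval x|)) ?normr_gt0 // -normrM.
rewrite (_ : _ * _ = - (f y - f x - l * (hval y - hval x))) ?normrN ?dP //.
by rewrite /diff_quot; field.
Qed.

Lemma has_hderiv_hderiv f x l : has_hderiv f x l -> hderiv f x = l.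
Proof. by have ? := dnbhs_half_proper x; move=> fl; exact/cvg_lim. Qed.

Lemma hderivable_has f x : hderivable f x -> has_hderiv f x (hderiv f x).
Proof. by []. Qed.

Lemma is_derive1P (F : R -> R) (y l : R) : is_derive y 1 F l <->
  forall e : R, 0 < e -> exists2 d : R, 0 < d &
    forall z, `|z - y| < d -> `|F z - F y - l * (z - y)| <= e * `|z - y|.
Proof.
split=> [[dF <-] e e0|H].
  have : (fun h => h^-1 *: (F (h *: 1 + y) - F y)) h @[h --> 0^'] --> 'D_1 F y.
    exact: dF.
  move=> /cvgrPdist_le/(_ _ e0) H.
  have : \forall h \near 0, h != 0 ->
      `|'D_1 F y - h^-1 *: (F (h *: 1 + y) - F y)| <= e by exact: H.
  move=> /nbhs_ballP[d /= d0 dP]; exists d => // z zd.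
  have [->|zy] := eqVneq z y; first by rewrite !subrr mulr0 subrr normr0 mulr0.
  have zy0 : z - y != 0 by rewrite subr_eq0.
  have /dP/(_ zy0) : ball 0 d (z - y) by rewrite /ball /= sub0r normrN.
  rewrite [(z - y) *: 1]mulr1 subrK => dPz.
  rewrite (_ : _ - _ = - ('D_1 F y - (z - y)^-1 *: (F z - F y)) * (z - y)).
    by rewrite normrM normrN ler_wpM2r.
  by rewrite /GRing.scale /=; field.
have cl : (fun h => h^-1 *: (F (h *: 1 + y) - F y)) h @[h --> 0^'] --> l.
  apply/cvgrPdist_le => e e0; have [d d0 dP] := H e e0.
  suff : \forall h \near 0, h != 0 ->
      `|l - h^-1 *: (F (h *: 1 + y) - F y)| <= e by [].
  apply/nbhs_ballP; exists d => // h; rewrite /ball /= sub0r normrN => hd h0.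
  have := dP (h + y); rewrite addrK => /(_ hd) hP.
  rewrite [h *: 1]mulr1 -(ler_pM2r (x := `|h|)) ?normr_gt0 // -normrM.
  rewrite (_ : _ * _ = - (F (h + y) - F y - l * h)) ?normrN //.
  by rewrite /GRing.scale /=; field.
split; first by apply/cvg_ex; exists l; exact: cl.
by apply/cvg_lim.
Qed.

Lemma is_derive_hderiv (F : R -> R) x (l : R) :
  is_derive (hval x) 1 F l -> has_hderiv (fun y => F (hval y)) x l.
Proof.
move=> /is_derive1P H; apply/has_hderivP => e e0.
by have [d d0 dP] := H e e0; exists d => // y; exact: dP.
Qed.

End HalflineDerivative.

Section TestFunctions.
Context (R : realType) (n : nat).
Implicit Types (a b : 'I_n.+1) (t x y : R).

(** Derivatives in [x] are two-sided even at [x = 0]: the formulas used extend a little to the left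
    of 0, so the calculus on R applies and then restricts to the branch. *)
Definition C1 (f ft fx : R -> R -> R) : Prop := forall t x, 0 < t -> 0 <= x ->
  [/\ is_derive t (1 : R) (f ^~ x) (ft t x), is_derive x (1 : R) (f t) (fx t x),
      {for (t, x), continuous (fun w : R * R => f w.1 w.2)},
      {for (t, x), continuous (fun w : R * R => ft w.1 w.2)} &
      {for (t, x), continuous (fun w : R * R => fx w.1 w.2)}].

Definition jfun (f : 'I_n.+1 -> R -> R -> R) t (z : junction R n) : R :=
  wedge_fun (fun a (x : halfline R) => f a t (hval x)) z.

Lemma jfun_br (f : 'I_n.+1 -> R -> R -> R) a t x :
  (forall b c, f b t 0 = f c t 0) -> 0 <= x -> jfun f t (br a x) = f a t x.
Proof.
move=> f0 x0; rewrite /jfun /br wedge_lift_funE; first by rewrite hval_hl.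
by move=> b c; rewrite -hl0 hval_hl.
Qed.

Lemma jfun_continuous (f : 'I_n.+1 -> R -> R -> R) t (z : junction R n) :
  (\forall s \near t, forall b c, f b s 0 = f c s 0) ->
  (forall a x, 0 <= x -> {for (t, x), continuous (fun w : R * R => f a w.1 w.2)}) ->
  {for (t, z), continuous (fun w : R * junction R n => jfun f w.1 w.2)}.
Proof.
move=> f0 fc.
have f0t : forall b c, f b t 0 = f c t 0 by exact: nbhs_singleton f0.
have f0z : \forall w \near (t, z), forall b c, f b w.1 0 = f c w.1 0.
  exact: (@cvg_fst _ _ (nbhs t) (nbhs z) _ _ f0).
apply/cvgrPdist_le => e e0 /=.
have [a [x [x0 zE]]] := brP z.
have [x1|x1] := ltP 0 x.
  have fce : \forall w \near (t, x), `|f a t x - f a w.1 w.2| <= e.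
    by have /cvgrPdist_le := fc a x x0; exact.
  have K := @near_br R n a t x (fun s y => `|f a t x - f a s y| <= e) x1 fce; rewrite zE in f0z *; near=> w.
  have [wz wE wf] : [/\ 0 < coord a w.2, w.2 = br a (coord a w.2) &
      `|f a t x - f a w.1 (coord a w.2)| <= e] by near: w.
  rewrite wE !jfun_br ?coord_ge0 //.
  by near: w.
have {x1 x0}x0 : x = 0 by apply/eqP; rewrite eq_le x1.
rewrite {}zE {}x0 br0 in f0z *.
have K := @near_origin R n t (fun a s y => `|f a t 0 - f a s y| <= e).
have {}K : \forall w \near (t, origin R n), forall b, w.2 = br b (coord b w.2) ->
    `|f b t 0 - f b w.1 (coord b w.2)| <= e.
  apply: K => b.
  have : \forall w \near (t, 0 : R), `|f b t 0 - f b w.1 w.2| <= e.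
    by have /cvgrPdist_le := fc b 0 (lexx _); exact.
  by apply: filterS.
near=> w; have [b wE] := brE w.2.
rewrite wE jfun_br ?coord_ge0 //; last by near: w.
rewrite -(br0 R b) jfun_br //.
by move: b wE; near: w.
Unshelve. all: by end_near. Qed.

Lemma test_jfun (f ft fx : 'I_n.+1 -> R -> R -> R) :
  (forall a, C1 (f a) (ft a) (fx a)) ->
  (forall b c t, 0 < t -> f b t 0 = f c t 0) ->
  [/\ test_function (jfun f),
      forall a t x, 0 < t -> 0 <= x -> dt (jfun f) t (br a x) = ft a t x &
      forall a t x, 0 < t -> 0 <= x -> dx (jfun f) a t (hl x) = fx a t x].
Proof.
move=> fC f0.
have f0n t : 0 < t -> \forall s \near t, forall b c, f b s 0 = f c s 0.
  by move=> t0; near=> s; have s0 : 0 < s; [near: s; exact: lt_nbhsr|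
    move=> b c; exact: f0].
have jt a t x : 0 < t -> 0 <= x ->
    is_derive t (1 : R) (jfun f ^~ (br a x)) (ft a t x).
  move=> t0 x0; have [dft _ _ _ _] := fC a t x t0 x0.
  apply/is_derive1P => e e0; have /is_derive1P/(_ e e0)[d d0 dP] := dft.
  have [d' /= d'0 d'P] := iffLR (nbhs_ballP _ _) (f0n t t0).
  exists (Num.min d d'); first by rewrite lt_min d0.
  move=> s; rewrite lt_min => /andP[sd sd'].
  rewrite !jfun_br //; [exact: dP| exact: nbhs_singleton (f0n t t0)|].
  by apply: d'P; rewrite /ball /= distrC.
have jx a t x : 0 < t -> 0 <= x ->
    has_hderiv (fun y : halfline R => jfun f t (branch a y)) (hl x) (fx a t x).
  move=> t0 x0; have [_ dfx _ _ _] := fC a t x t0 x0.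
  have -> : (fun y : halfline R => jfun f t (branch a y)) = (fun y : halfline R => f a t (hval y)).
    apply/funext => y; rewrite branch_br jfun_br ?hval_ge0 //.
    exact: nbhs_singleton (f0n t t0).
  by apply: is_derive_hderiv; rewrite hval_hl.
split; first split=> [t z t0|a t x t0].
- by apply: jfun_continuous; [exact: f0n|move=> a x x0; have [] := fC a t x t0 x0].
- have x0 := hval_ge0 x; have xE := hl_hval x.
  have near0 : \forall w \near (t, x), 0 < w.1.
    exact: (@cvg_fst _ _ (nbhs t) (nbhs x) _ [set s | 0 < s] (lt_nbhsr t0)).
  have cc (g : R -> R -> R) : {for (t, hval x), continuous (fun w : R * R => g w.1 w.2)} ->
      {for (t, x), continuous (fun w : R * halfline R => g w.1 (hval w.2))}.
    move=> gc; apply: (@cvg_comp _ _ _ (fun w : R * halfline R => (w.1, hval w.2))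
      (fun w : R * R => g w.1 w.2)); last exact: gc.
    exact: cvg_map_snd (@hval_continuous R x).
  split.
  + by rewrite branch_br; have [] := jt a t (hval x) t0 x0.
  + by have := jx a t (hval x) t0 x0; rewrite xE => fx_lim; apply/cvg_ex; exists (fx a t (hval x)).
  + have [_ _ _ fc _] := fC a t (hval x) t0 x0.
    have /cvgrPdist_le gc := cc _ fc.
    apply/cvgrPdist_le => e e0; have := gc e e0; near_simpl => ge /=.
    near=> w; have w0 : 0 < w.1 by near: w.
    rewrite !branch_br /dt !derive1E.
    have [_ ->] := jt a t (hval x) t0 x0.
    have [_ ->] := jt a w.1 (hval w.2) w0 (hval_ge0 _).
    by near: w.
  + have [_ _ _ _ fc] := fC a t (hval x) t0 x0.
    have /cvgrPdist_le gc := cc _ fc.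
    apply/cvgrPdist_le => e e0; have := gc e e0; near_simpl => ge /=.
    near=> w; have w0 : 0 < w.1 by near: w.
    rewrite -{1}xE -(hl_hval w.2) /dx (has_hderiv_hderiv (jx _ _ _ t0 x0)).
    rewrite (has_hderiv_hderiv (jx _ _ _ w0 (hval_ge0 _))).
    by near: w.
- by move=> a t x t0 x0; rewrite /dt derive1E; have [_ ->] := jt a t x t0 x0.
- by move=> a t x t0 x0; rewrite /dx (has_hderiv_hderiv (jx _ _ _ t0 x0)).
Unshelve. all: by end_near. Qed.

End TestFunctions.
(** * Semicontinuous envelopes and touching *)

Section Envelopes.
Context (R : realType) (T : topologicalType) (F : set_system T) {FF : Filter F}.
Implicit Types (f : T -> R) (c : R).

Lemma limf_esup_leP f c : (limf_esup (fun z => (f z)%:E) F <= c%:E)%E <->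
  forall e, 0 < e -> \forall z \near F, f z <= c + e.
Proof.
split=> [fc e e0|H].
  have : (limf_esup (fun z => (f z)%:E) F < (c + e)%:E)%E.
    by apply: le_lt_trans fc _; rewrite lte_fin ltrDl.
  move=> /ereal_inf_lt[_ /= [V FV <-]] supV.
  apply: filterS FV => z Vz; rewrite -lee_fin; apply: le_trans (ltW supV).
  by apply: ereal_sup_ubound; exists z.
apply/lee_addgt0Pr => e e0; rewrite -EFinD.
apply: ereal_inf_le; exists (ereal_sup ((fun z => (f z)%:E) @` [set z | f z <= c + e])).
  by exists [set z | f z <= c + e] => //; exact: H.
by apply: ge_ereal_sup => _ [z /= fz <-]; rewrite lee_fin.
Qed.

Lemma limf_esup_geP f c : (c%:E <= limf_esup (fun z => (f z)%:E) F)%E <->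
  forall e, 0 < e -> ~ \forall z \near F, f z <= c - e.
Proof.
split=> [cf e e0 H|H].
  have : (limf_esup (fun z => (f z)%:E) F <= (c - e)%:E)%E.
    apply/limf_esup_leP => e' e'0; apply: filterS H => z /le_trans; apply.
    by rewrite lerDl ltW.
  move=> /(le_trans cf); rewrite lee_fin; lra.
rewrite leNgt; apply/negP => fc.
have [e e0 fe] : exists2 e, 0 < e & (limf_esup (fun z => (f z)%:E) F <= (c - e)%:E)%E.
  move: fc; case: (limf_esup _ _) => [r| |] //=.
    by rewrite lte_fin => rc; exists (c - r); rewrite ?subr_gt0 // lee_fin; lra.
  by move=> _; exists 1 => //; exact: leNye.
apply: (H (e / 2)); first lra.
have /limf_esup_leP/(_ (e / 2)) := fe.
have e2 : 0 < e / 2 by lra.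
by move=> /(_ e2); apply: filterS => z; lra.
Qed.

End Envelopes.

(** [g] has no semicontinuity, so its supremum need not be attained; what survives is a point of [K]
    every neighbourhood of which still sees values close to [S]. Were there none, each point of [K]
    would have a neighbourhood with a gap below [S], and compactness would make the gap uniform,
    lowering the supremum. *)
Lemma compact_sup_point (R : realType) (X : topologicalType) (K D : set X)
    (g : X -> R) (M : R) (z1 : X) :
  compact K -> (forall z, D z -> g z <= M) -> D z1 -> 0 < g z1 ->
  (forall z, D z -> ~ K z -> g z <= 0) ->
  exists z0 S, [/\ K z0, 0 < S, forall z, D z -> g z <= S &
    forall e, 0 < e -> ~ \forall z \near z0, D z -> g z <= S - e].
Proof.
move=> /compact_near_coveringP Kc gM D1 g1 gK.
have hs : has_sup (g @` D).
  by split; [exists (g z1), z1|exists M => _ [z Dz <-]; exact: gM].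
pose S := sup (g @` D).
have gS z : D z -> g z <= S by move=> Dz; apply: sup_upper_bound => //; exists z.
have S0 : 0 < S by apply: lt_le_trans g1 (gS _ D1).
apply: contrapT => nex.
have : forall z, K z -> \forall z' \near z & e \near (0 : R)^'+,
    D z' -> g z' <= S - e.
  move=> z Kz.
  have [e [e0 He]] : exists e, 0 < e /\ \forall z' \near z, D z' -> g z' <= S - e.
    apply: contrapT => ne; apply: nex; exists z, S; split => // e e0 He.
    by apply: ne; exists e.
  exists ([set z' | D z' -> g z' <= S - e], [set e' | e' <= e]).
    by split => //; exact: nbhs_right_le.
  move=> [z' e'] [/= h h'] Dz'; apply: le_trans (h Dz') _.
  by rewrite lerD2l lerN2.
move=> /(Kc _ _ (fun e z' => D z' -> g z' <= S - e)) KP.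
have : \forall e \near (0 : R)^'+, [/\ 0 < e, e <= S & K `<=` (fun z' => D z' -> g z' <= S - e)].
  by near=> e; split; near: e; [exact: nbhs_right_gt|exact: nbhs_right_le|].
move=> /filter_ex[e [e0 eS KS]].
have : S <= S - e.
  apply: sup_le_ub; first by case: hs.
  move=> _ [z Dz <-]; have [Kz|nKz] := pselect (K z); first exact: KS.
  by apply: le_trans (gK _ Dz nKz) _; rewrite subr_ge0.
lra.
Unshelve. all: by end_near. Qed.

Section Touching.
Context (R : realType) (n : nat).
Implicit Types (u phi : R -> junction R n -> R) (a : 'I_n.+1) (t x : R).

Lemma nbhs_domE t (z : junction R n) : 0 < t -> nbhs_dom t z = nbhs (t, z).
Proof.
move=> t0; rewrite /nbhs_dom; apply/seteqP; split=> P HP; last first.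
  have {}HP : \forall w \near (t, z), P w by [].
  by apply: filterS HP => w Pw _.
have H0 : \forall w \near (t, z), 0 < w.1.
  exact: (@cvg_fst _ _ (nbhs t) (nbhs z) _ [set s | 0 < s] (lt_nbhsr t0)).
have H1 : \forall w \near (t, z), 0 <= w.1 -> P w by exact: HP.
by near=> w; have Pw : 0 <= w.1 -> P w; [near: w|apply: Pw; rewrite ltW //; near: w].
Unshelve. all: by end_near. Qed.

(** The two hypotheses say that [S] bounds [u - phi] locally and that no smaller bound holds near
    the point, hence equality for the envelope there. At neighbouring points the bound passes to the
    envelope because it holds on an open set. *)
Lemma env_touch u phi t (z : junction R n) (S : R) : 0 < t ->
  (forall (s : R) y, 0 < s -> {for (s, y), continuous (fun w : R * junction R n => phi w.1 w.2)}) ->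
  (\forall w \near (t, z), u w.1 w.2 <= phi w.1 w.2 + S) ->
  (forall e, 0 < e -> ~ \forall w \near (t, z), u w.1 w.2 <= phi w.1 w.2 + S - e) ->
  touches_from_above (fun s y => phi s y + S) (usc_env u) t z.
Proof.
move=> t0 phic uphi nuphi.
have ule (s : R) (y : junction R n) : 0 < s ->
    (\forall w \near (s, y), u w.1 w.2 <= phi w.1 w.2 + S) ->
    (usc_env u s y <= (phi s y + S)%:E)%E.
  move=> s0 Hs; rewrite /usc_env nbhs_domE //; apply/limf_esup_leP => e e0.
  have /cvgrPdist_le/(_ e e0) pc := phic s y s0.
  near=> w; have h1 : u w.1 w.2 <= phi w.1 w.2 + S by near: w.
  have : `|phi s y - phi w.1 w.2| <= e by near: w.
  rewrite ler_norml => /andP[h2 h3]; lra.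
split.
  apply/eqP; rewrite eq_le ule // andbT /usc_env nbhs_domE //.
  apply/limf_esup_geP => e e0 He; apply: (nuphi (e / 2)); first lra.
  have e2 : 0 < e / 2 by lra.
  have /cvgrPdist_le/(_ _ e2) pc := phic t z t0.
  near=> w; have h1 : u w.1 w.2 <= phi t z + S - e by near: w.
  have : `|phi t z - phi w.1 w.2| <= e / 2 by near: w.
  rewrite ler_norml => /andP[h2 h3]; lra.
have H0 : \forall w \near (t, z), 0 < w.1.
  exact: (@cvg_fst _ _ (nbhs t) (nbhs z) _ [set s | 0 < s] (lt_nbhsr t0)).
have /(@nbhs_interior _ (t, z)) H1 : nbhs (t, z) [set w | u w.1 w.2 <= phi w.1 w.2 + S] by [].
near=> w; apply: ule; first by near: w.
have : [set w | u w.1 w.2 <= phi w.1 w.2 + S]° w by near: w; exact: H1.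
by clear; case: w.
Unshelve. all: by end_near. Qed.

End Touching.

(** * Testing subsolutions with glued C^1 functions *)

Section SubsolutionTests.
Context (R : realType) (n : nat) (H : 'I_n.+1 -> R -> R) (F : 'rV[R]_n.+1 -> R).
Implicit Types (u : R -> junction R n -> R) (a : 'I_n.+1) (t x : R).

Lemma C1_addc (f ft fx : R -> R -> R) (S : R) :
  C1 f ft fx -> C1 (fun t x => f t x + S) ft fx.
Proof.
move=> fC t x t0 x0; have [f1 f2 f3 f4 f5] := fC t x t0 x0; split => //.
- have -> : (fun s => f s x + S) = (f ^~ x) + cst S by [].
  by rewrite -[ft t x]addr0; apply: is_deriveD.
- have -> : (fun y => f t y + S) = f t + cst S by [].
  by rewrite -[fx t x]addr0; apply: is_deriveD.
- by apply: cvgD f3 _; exact: cvg_cst.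
Qed.

Lemma C1_cst0 (f ft fx : R -> R -> R) :
  C1 f ft fx -> C1 (fun t _ => f t 0) (fun t _ => ft t 0) (fun _ _ => 0).
Proof.
move=> fC t x t0 _; have [f1 f2 f3 f4 f5] := fC t 0 t0 (lexx _).
have cc (g : R -> R -> R) : {for (t, 0), continuous (fun w : R * R => g w.1 w.2)} ->
    {for (t, x), continuous (fun w : R * R => g w.1 0)}.
  move=> gc; apply: (@cvg_comp _ _ _ (fun w : R * R => (w.1, 0))
    (fun w : R * R => g w.1 w.2)); last exact: gc.
  exact: (cvg_map_snd t (@cst_continuous R R 0 x)).
split; [exact: f1| exact: is_derive_cst | exact: (cc f) | exact: (cc ft) |].
exact: cvg_cst.
Qed.

(** A test function must live on the whole junction although contact occurs inside branch [a]. The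
    other branches receive [f t 0], constant in [x], which glues continuously; near the contact
    point only branch [a] is seen. *)
Lemma sub_interior u (f ft fx : R -> R -> R) a t x (S : R) :
  weak_sub H F u -> C1 f ft fx -> 0 < t -> 0 < x ->
  (\forall w \near (t, br a x), u w.1 w.2 <= f w.1 (coord a w.2) + S) ->
  (forall e, 0 < e ->
     ~ \forall w \near (t, br a x), u w.1 w.2 <= f w.1 (coord a w.2) + S - e) ->
  ft t x + H a (fx t x) <= 0.
Proof.
move=> [_ usub] fC t0 x0 uf nuf.
pose g (h : R -> R -> R) k b := if b == a then h else k.
have gC b : C1 (g (fun t x => f t x + S) (fun t _ => f t 0 + S) b)
    (g ft (fun t _ => ft t 0) b) (g fx (fun _ _ => 0) b).
  rewrite /g; case: (b == a); apply: C1_addc => //; exact: C1_cst0 fC.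
have g0 b c s : 0 < s -> g (fun t x => f t x + S) (fun t _ => f t 0 + S) b s 0 =
    g (fun t x => f t x + S) (fun t _ => f t 0 + S) c s 0.
  by move=> _; rewrite /g; case: (b == a); case: (c == a).
have [tst dtE dxE] := test_jfun gC g0.
have [/(_ a (hl x)) + _] := usub _ t tst t0.
rewrite hval_hl; last exact: ltW.
move=> /(_ x0).
rewrite (dtE a _ _ t0 (ltW x0)) (dxE a _ _ t0 (ltW x0)) /g eqxx; apply.
set gf := fun b : 'I_n.+1 => _ in tst dtE dxE *.
pose gf' b := if b == a then f else fun t _ => f t 0.
have -> : jfun gf = (fun s y => jfun gf' s y + S).
  apply/funext => s; apply/funext => y.
  pose fs b (x : halfline R) := gf' b s (hval x).
  rewrite /jfun -[RHS]/(((fun v => v + S) \o wedge_fun fs) y) wedge_fun_comp.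
  congr (wedge_fun _ y); apply/funext => b; apply/funext => z.
  by rewrite /fs /gf' /gf /g /=; case: (b == a).
have gf'E w : 0 < coord a w.2 -> w.2 = br a (coord a w.2) ->
    jfun gf' w.1 w.2 = f w.1 (coord a w.2).
  move=> w0 ->; rewrite jfun_br ?coord_ge0 // /gf' ?eqxx ?coord_br // ?eqxx ?ltW //.
  by move=> b c; case: (b == a); case: (c == a).
have nearT : \forall w \near (t, x), True by exact: filterT.
have nearE := @near_br R n a t x (fun _ _ => True) x0 nearT.
apply: env_touch => //.
- move=> s y s0; apply: jfun_continuous.
    near=> r; move=> b c; rewrite /gf'; by case: (b == a); case: (c == a).
  move=> b z z0; have [_ _ f3 _ _] := C1_cst0 fC s0 z0.
  have [_ _ f3' _ _] := fC s z s0 z0.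
  by rewrite /gf'; case: (b == a).
- near=> w; have [w0 wE _] : [/\ 0 < coord a w.2, w.2 = br a (coord a w.2) & True].
    by near: w.
  by rewrite gf'E //; near: w.
- move=> e e0 He; apply: (nuf e e0).
  near=> w; have [w0 wE _] : [/\ 0 < coord a w.2, w.2 = br a (coord a w.2) & True].
    by near: w.
  by rewrite -gf'E //; near: w.
Unshelve. all: by end_near. Qed.

Lemma sub_junction u (f ft fx : 'I_n.+1 -> R -> R -> R) t (S : R) :
  weak_sub H F u -> (forall a, C1 (f a) (ft a) (fx a)) ->
  (forall a b s, 0 < s -> f a s 0 = f b s 0) -> 0 < t ->
  (\forall w \near (t, origin R n), u w.1 w.2 <= jfun f w.1 w.2 + S) ->
  (forall e, 0 < e ->
     ~ \forall w \near (t, origin R n), u w.1 w.2 <= jfun f w.1 w.2 + S - e) ->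
  ft ord0 t 0 + Num.min (F (\row_a fx a t 0)) (Hmin H (\row_a fx a t 0)) <= 0.
Proof.
move=> [_ usub] fC f0 t0 uf nuf.
have gC b : C1 (fun t x => f b t x + S) (ft b) (fx b) by exact: C1_addc.
have g0 b c s : 0 < s -> f b s 0 + S = f c s 0 + S.
  by move=> s0; rewrite (f0 b c s s0).
have [tst dtE dxE] := test_jfun gC g0.
have [_] := usub _ t tst t0.
have -> : dx0 (jfun (fun b t x => f b t x + S)) t = \row_a fx a t 0.
  by apply/rowP => a; rewrite !mxE -hl0 dxE.
rewrite -{2}(br0 R (ord0 : 'I_n.+1)) dtE //; apply.
have -> : jfun (fun b t x => f b t x + S) = (fun s y => jfun f s y + S) :> (R -> junction R n -> R).
  apply/funext => s; apply/funext => y.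
  pose fs b (x : halfline R) := f b s (hval x).
  by rewrite /jfun -[RHS]/(((fun v => v + S) \o wedge_fun fs) y) wedge_fun_comp.
apply: env_touch => //.
move=> s y s0; apply: jfun_continuous.
  by near=> r; move=> b c; apply: f0; near: r; exact: lt_nbhsr.
by move=> b z z0; have [_ _ f3 _ _] := fC b s z s0 z0.
Unshelve. all: by end_near. Qed.

End SubsolutionTests.

(** * Duality between sub- and supersolutions *)

Section Duality.
Context (R : realType) (n : nat).
Implicit Types (u phi : R -> junction R n -> R) (a : 'I_n.+1) (t x : R).
Implicit Types (H : 'I_n.+1 -> R -> R) (F : 'rV[R]_n.+1 -> R).

Definition opp_ham H a (q : R) : R := - H a (- q).
Definition opp_flux F (q : 'rV[R]_n.+1) : R := - F (- q).

Lemma usc_envN u t z : usc_env (fun s y => - u s y) t z = (- lsc_env u t z)%E.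
Proof. by rewrite /usc_env /lsc_env -limf_esupN. Qed.

Lemma Hmax_ge H (q : 'rV[R]_n.+1) a : H a (q ord0 a) <= Hmax H q.
Proof. by rewrite /Hmax (bigD1 a) //= le_max lexx. Qed.

Lemma Hmax_attained H (q : 'rV[R]_n.+1) : exists a, Hmax H q = H a (q ord0 a).
Proof.
rewrite /Hmax; apply: (big_ind (fun x => exists a, x = H a (q ord0 a))).
- by exists ord0.
- by move=> x y [a ->] [b ->]; case: (leP (H a _) (H b _)); [exists b|exists a].
- by move=> a _; exists a.
Qed.

Lemma Hmin_opp H (q : 'rV[R]_n.+1) : Hmin (opp_ham H) q = - Hmax H (- q).
Proof.
rewrite /Hmin /Hmax.
rewrite (big_morph (fun x => - x) (@oppr_max R) (erefl _)) /opp_ham !mxE.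
by apply: eq_bigr => a _; rewrite mxE.
Qed.

Lemma has_hderivN (f : halfline R -> R) (x : halfline R) (l : R) :
  has_hderiv f x l -> has_hderiv (fun y => - f y) x (- l).
Proof.
move=> /has_hderivP fl; apply/has_hderivP => e e0; have [d d0 dP] := fl e e0.
exists d => // y yd; rewrite (_ : _ - _ - _ =
  - (f y - f x - l * (hval y - hval x))) ?normrN ?dP //; first by ring.
Qed.

Lemma test_functionN phi : test_function phi ->
  [/\ test_function (fun s y => - phi s y),
      forall t z, 0 < t -> dt (fun s y => - phi s y) t z = - dt phi t z &
      forall a t (x : halfline R), 0 < t -> dx (fun s y => - phi s y) a t x = - dx phi a t x].
Proof.
move=> [phic phid].
have dtN t z : 0 < t -> dt (fun s y => - phi s y) t z = - dt phi t z.
  move=> t0; have [a [x [x0 ->]]] := brP z; rewrite /dt !derive1E.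
  have [d _ _ _] := phid a t (hl x) t0.
  by have -> : (fun s => - phi s (br a x)) = - (phi ^~ (br a x)) by []; rewrite deriveN.
have dxN a t (x : halfline R) : 0 < t -> dx (fun s y => - phi s y) a t x = - dx phi a t x.
  move=> t0; have [_ d _ _] := phid a t x t0.
  exact/has_hderiv_hderiv/has_hderivN/hderivable_has.
split => //; split=> [t z t0|a t x t0].
  by apply: cvgN; exact: phic.
have [d1 d2 d3 d4] := phid a t x t0.
have near0 : \forall w \near (t, x), 0 < w.1.
  exact: (@cvg_fst _ _ (nbhs t) (nbhs x) _ [set s | 0 < s] (lt_nbhsr t0)).
split.
- exact: derivableN.
- by apply/cvg_ex; exists (- hderiv (fun y => phi t (branch a y)) x);
    exact/has_hderivN/hderivable_has.
- have /cvgrPdist_le d3N : (- dt phi w.1 (branch a w.2)) @[w --> (t, x)] -->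
      - dt phi t (branch a x) by exact: cvgN d3.
  apply/cvgrPdist_le => e e0; have := d3N e e0; near_simpl => de /=.
  near=> w; have w0 : 0 < w.1 by near: w.
  by rewrite !dtN //; near: w.
- have /cvgrPdist_le d4N : (- dx phi a w.1 w.2) @[w --> (t, x)] -->
      - dx phi a t x by exact: cvgN d4.
  apply/cvgrPdist_le => e e0; have := d4N e e0; near_simpl => de /=.
  near=> w; have w0 : 0 < w.1 by near: w.
  by rewrite !dxN //; near: w.
Unshelve. all: by end_near. Qed.

Lemma weak_super_dual H F u :
  weak_super H F u <-> weak_sub (opp_ham H) (opp_flux F) (fun s y => - u s y).
Proof.
have rowN phi t : test_function phi -> 0 < t ->
    dx0 (fun s y => - phi s y) t = - dx0 phi t.
  move=> /test_functionN[_ _ dxN] t0.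
  by apply/rowP => a; rewrite !mxE dxN.
have touchN phi t z : touches_from_below phi (lsc_env u) t z <->
    touches_from_above (fun s y => - phi s y) (usc_env (fun s y => - u s y)) t z.
  rewrite /touches_from_above usc_envN; split=> -[e1 e2].
    split; first by rewrite EFinN e1.
    by apply: filterS e2 => w; rewrite usc_envN EFinN leeN2.
  split; first by apply: oppe_inj; rewrite -e1 EFinN.
  by apply: filterS e2 => w; rewrite usc_envN EFinN leeN2.
split=> -[b sup]; split.
- move=> t z t0; have [M HM] := b t z t0; exists (- M).
  by apply: filterS HM => w; rewrite usc_envN EFinN leeN2.
- move=> phi t tst t0; have [tstN dtN dxN] := test_functionN tst.
  have phiNN : phi = (fun s y => - - phi s y).
    by apply/funext => s; apply/funext => y; rewrite opprK.
  have [s1 s2] := sup _ t tstN t0; split=> [a x x0|] tch.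
    have : touches_from_below (fun s y => - phi s y) (lsc_env u) t (branch a x).
      by apply/touchN; rewrite -phiNN.
    by move=> /(s1 _ _ x0); rewrite dtN // dxN // /opp_ham; lra.
  have : touches_from_below (fun s y => - phi s y) (lsc_env u) t (origin R n).
    by apply/touchN; rewrite -phiNN.
  move=> /s2; rewrite dtN // rowN // Hmin_opp /opp_flux -oppr_max; lra.
- move=> t z t0; have [M HM] := b t z t0; exists (- M).
  by apply: filterS HM => w; rewrite usc_envN EFinN leeNl.
- move=> phi t tst t0; have [tstN dtN dxN] := test_functionN tst.
  have [s1 s2] := sup _ t tstN t0; split=> [a x x0|] tch.
    have := s1 a x x0; rewrite dtN // dxN // /opp_ham opprK => s.
    by have /touchN/s := tch; lra.
  have := s2; rewrite dtN // rowN // Hmin_opp /opp_flux opprK -oppr_max => s.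
  by have /touchN/s := tch; lra.
Unshelve. all: by end_near. Qed.

End Duality.
(** * Self-similar barriers *)

Section Barrier.
Context (R : realType).
Implicit Types (h V : R -> R) (c d t x y q L e : R).

Definition hopf h c d t x : R := sup [set q * x - t * h q | q in `[c, d]%classic].

Section Hopf.
Context (h : R -> R) (c d : R) (hc : continuous h) (cd : c <= d).

Lemma hopf_argmax t x :
  exists q, [/\ c <= q, q <= d & forall q', c <= q' -> q' <= d ->
    q' * x - t * h q' <= q * x - t * h q].
Proof.
have cont : {within `[c, d], continuous (fun q => q * x - t * h q)}.
  apply: continuous_subspaceT => q; apply: cvgB.
    by apply: cvgMl; exact: cvg_id.
  by apply: cvgMr; exact: hc.
have [q] := EVT_max cd cont.
rewrite in_itv /= => /andP[cq qd] qmax; exists q; split=> // q' cq' q'd.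
by apply: qmax; rewrite in_itv /= cq'.
Qed.

Lemma hopf_attained t x :
  exists q, [/\ c <= q, q <= d & hopf h c d t x = q * x - t * h q].
Proof.
have [q [cq qd qmax]] := hopf_argmax t x; exists q; split=> //.
apply/eqP; rewrite eq_le; apply/andP; split.
  apply: sup_le_ub; first by exists (q * x - t * h q), q => //=; rewrite in_itv /= cq.
  by move=> _ /= [q' + <-]; rewrite in_itv /= => /andP[? ?]; exact: qmax.
apply: ub_le_sup; last by exists q => //=; rewrite in_itv /= cq.
exists (q * x - t * h q) => _ /= [q' + <-]; rewrite in_itv /= => /andP[? ?].
exact: qmax.
Qed.

Lemma hopf_ge t x q : c <= q -> q <= d -> q * x - t * h q <= hopf h c d t x.
Proof.
move=> cq qd; have [q0 [cq0 q0d qmax]] := hopf_argmax t x.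
apply: ub_le_sup; last by exists q => //=; rewrite in_itv /= cq.
exists (q0 * x - t * h q0) => _ /= [q' + <-]; rewrite in_itv /= => /andP[? ?].
exact: qmax.
Qed.

End Hopf.

Lemma primitive V a : continuous V ->
  exists G : R -> R, forall y, a < y -> is_derive y 1 G (V y).
Proof.
move=> Vc; exists (fun x => \int[lebesgue_measure]_(t in `[a, x]) V t)%R => y ay.
have yu : y < y + 1 by rewrite ltrDl.
have Vi : lebesgue_measure.-integrable `[a, y + 1] (EFin \o V).
  apply: continuous_compact_integrable; first exact: segment_compact.
  exact: continuous_subspaceT.
have [d dE] := continuous_FTC1_closed yu Vi ay (Vc y).
by split=> //; rewrite -derive1E dE.
Qed.

Lemma lipschitz_continuous V (D : R) :
  (forall y y', y <= y' -> `|V y' - V y| <= D * (y' - y)) -> continuous V.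
Proof.
move=> VD y; apply/cvgrPdist_le => e e0.
have D0 : 0 <= D.
  have := VD y (y + 1); rewrite lerDl ler01 => /(_ isT).
  have -> : y + 1 - y = 1 by ring.
  by rewrite mulr1; apply: le_trans.
have VD' y' : `|V y - V y'| <= D * `|y - y'|.
  have [yy'|/ltW yy'] := leP y' y.
    by rewrite (ger0_norm (x := y - y')) ?subr_ge0 //; exact: VD.
  by rewrite distrC [in leRHS]distrC (ger0_norm (x := y' - y)) ?subr_ge0 //; exact: VD.
near=> y'; apply: le_trans (VD' y') _.
apply: (@le_trans _ _ ((D + 1) * (e / (D + 1)))).
  apply: ler_pM => //; first by rewrite lerDl.
  near: y'; apply: cvgr_dist_le; first exact: cvg_id.
  by rewrite divr_gt0 // ltr_wpDl.
by rewrite mulrC divfK // gt_eqF // ltr_wpDl.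
Unshelve. all: by end_near. Qed.

(* The backward average of V over a window of length s is C^1; because V is
   affine on the negative axis, its slope at 0 is exactly c. *)
Lemma steklov V c d L e : 0 < e -> c <= d ->
  (forall y y', y <= y' -> c * (y' - y) <= V y' - V y) ->
  (forall y y', y <= y' -> V y' - V y <= d * (y' - y)) ->
  (forall y, y <= 0 -> V y = c * y - L) ->
  exists Psi dPsi : R -> R,
    [/\ forall y, -1 < y -> is_derive y 1 Psi (dPsi y) /\ {for y, continuous dPsi},
        forall y, c <= dPsi y /\ dPsi y <= d,
        forall y, -1 < y -> V y <= Psi y /\ Psi y <= V y + e,
        dPsi 0 = c & - L <= Psi 0].
Proof.
move=> e0 cd Vl Vu V0.
pose D := `|c| + `|d| + 1.
have D1 : 1 <= D by rewrite lerDr addr_ge0.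
have D0 : 0 < D by exact: lt_le_trans D1.
have cD : c <= D /\ - D <= c.
  have := normr_ge0 d; have := ler_norm c; have := ler_norm (- c).
  by rewrite normrN /D; lra.
have dD : d <= D /\ - D <= d.
  have := normr_ge0 c; have := ler_norm d; have := ler_norm (- d).
  by rewrite normrN /D; lra.
have Vlip y y' : y <= y' -> `|V y' - V y| <= D * (y' - y).
  move=> yy'; have := Vl _ _ yy'; have := Vu _ _ yy'.
  by rewrite ler_norml; nra.
have Vc := lipschitz_continuous Vlip.
(* For [y > -1] and [s <= 1/2] the window [[y - s, y]] stays to the right of -3, where [G] is
   differentiable. *)
have [G dG] := @primitive V (-3) Vc.
(* [D] bounds the slopes of [V], so its oscillation on a window is at most [D * s <= e / 4]; the
   final shift by [e / 2] then places the average between [V] and [V + e]. *)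
pose s := Num.min (1 / 2) (e / (4 * D)).
have s0 : 0 < s by rewrite lt_min; apply/andP; split; [lra|rewrite divr_gt0 // mulr_gt0].
have s1 : s <= 1 / 2 by rewrite ge_min lexx.
have sD : D * s <= e / 4.
  have : s <= e / (4 * D) by rewrite ge_min lexx orbT.
  rewrite ler_pdivlMr ?mulr_gt0 //; lra.
pose P y := (G y - G (y - s)) / s.
pose dP y := (V y - V (y - s)) / s.
have PV y : -1 < y -> exists z, [/\ y - s <= z, z <= y & P y = V z].
  move=> y1; have ys : y - s < y by lra.
  have dG' z : z \in `](y - s), y[ -> is_derive z 1 G (V z).
    by rewrite in_itv /= => /andP[? ?]; apply: dG; lra.
  have cG : {within `[(y - s), y], continuous G}.
    apply: derivable_within_continuous => z; rewrite in_itv /= => /andP[? ?].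
    by have [] : is_derive z 1 G (V z) by apply: dG; lra.
  have [z] := MVT ys dG' cG; rewrite in_itv /= => /andP[z1 z2] GE.
  exists z; split; [exact: ltW|exact: ltW|].
  rewrite /P GE; have -> : y - (y - s) = s by ring.
  by rewrite mulfK // gt_eqF.
have Pclose y : -1 < y -> `|P y - V y| <= e / 4.
  move=> /PV[z [z1 z2 ->]]; rewrite distrC; apply: le_trans (Vlip _ _ z2) _.
  by apply: le_trans sD; rewrite ler_pM2l //; lra.
have P0 : - L <= P 0 + e / 4 /\ P 0 <= - L + e / 4.
  have := Pclose 0; rewrite ltrN10 (V0 0 (lexx _)) => /(_ isT).
  by rewrite ler_norml => /andP[]; lra.
exists (fun y => P y + e / 2), dP; split.
- move=> y y1; split; last first.
    apply: cvgMl; apply: cvgB; first exact: Vc.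
    apply: (@cvg_comp _ _ _ (fun y => y - s) V); last exact: Vc.
    by apply: cvgB; [exact: cvg_id|exact: cvg_cst].
  have d1 : is_derive y 1 G (V y) by apply: dG; lra.
  have d2 : is_derive (y - s) 1 G (V (y - s)) by apply: dG; lra.
  have d3 : is_derive y 1 (shift (- s)) 1 by exact: is_derive_shift.
  have d4 := @is_derive1_comp _ G (shift (- s)) y _ _ d2 d3.
  have d5 := is_deriveD (is_deriveZ (s^-1) (is_deriveB d1 d4)) (is_derive_cst (e / 2) y 1).
  have -> : (fun y => P y + e / 2) = s^-1 *: (G - (G \o shift (- s))) + cst (e / 2).
    by apply/funext => z; rewrite /P [_ / s]mulrC.
  apply: (is_derive_eq d5).
  by rewrite addr0 mulr1 /dP mulrC.
- move=> y; have ys : y - s <= y by lra.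
  have := Vl _ _ ys; have := Vu _ _ ys; have -> : y - (y - s) = s by ring.
  by rewrite /dP ler_pdivlMr // ler_pdivrMr // => -> ->.
- by move=> y y1; have := Pclose y y1; rewrite ler_norml => /andP[]; lra.
- rewrite /dP !V0 //; last by lra.
  by field; rewrite gt_eqF.
- by lra.
Qed.

(** Profile of [t Psi(x / t)]: up to [e], [- L] is the time derivative at the origin; [c] is the
    slope there and [d] bounds the slopes. [barrier_ge] yields the supersolution property,
    [barrier_ge_line] replaces it for slopes below [c], and [barrier_le] makes the barrier sharp as
    [e] tends to 0. The range [y > -1] leaves room for two-sided derivatives at 0. *)
Record is_barrier h c d L e (Psi dPsi : R -> R) : Prop := IsBarrier {
  barrier_derive : forall y, -1 < y -> is_derive y 1 Psi (dPsi y);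
  barrier_cont : forall y, -1 < y -> {for y, continuous dPsi};
  barrier_slope : forall y, c <= dPsi y /\ dPsi y <= d;
  barrier_ge : forall y q, -1 < y -> c <= q -> q <= d -> q * y - h q <= Psi y;
  barrier_ge_line : forall y, -1 < y -> c * y - L <= Psi y;
  barrier_le : forall y, -1 < y ->
    Psi y <= Num.max (hopf h c d 1 y) (c * y - L) + 2 * e;
  barrier_slope0 : dPsi 0 = c;
  barrier0 : Psi 0 = - L + e }.

(** The profile to be smoothed is the maximum of [hopf] at time 1 and the line [c y - L]. Since
    [L <= h] on [[c, d]], the line wins for [y <= 0], which is what [steklov] requires to give slope
    exactly [c] at 0. *)
Lemma barrier_exists h c d L e : continuous h -> c <= d -> 0 < e ->
  (forall q, c <= q -> q <= d -> L <= h q) ->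
  exists Psi dPsi : R -> R, is_barrier h c d L e Psi dPsi.
Proof.
move=> hc cd e0 Lh.
pose V y := Num.max (hopf h c d 1 y) (c * y - L).
(* The maximum is attained by a line with slope in [[c, d]] lying below [V]; comparing two points
   gives the slope bounds on [V]. *)
have VE y : exists q m, [/\ c <= q, q <= d, V y = q * y - m &
    forall y', q * y' - m <= V y'].
  rewrite /V; case: leP => _.
    exists c, L; split=> // y'.
    by rewrite le_max lexx orbT.
  have [q [cq qd ->]] := hopf_attained hc cd 1 y.
  exists q, (h q); split=> //; first by rewrite mul1r.
  by move=> y'; rewrite le_max -{1}(mul1r (h q)) hopf_ge.
have V0 y : y <= 0 -> V y = c * y - L.
  move=> y0; apply/max_idPr.
  have [q [cq qd ->]] := hopf_attained hc cd 1 y.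
  by have := Lh q cq qd; nra.
have [Psi [dPsi [P1 P2 P3 P4 P5]]] : exists Psi dPsi : R -> R,
    [/\ forall y, -1 < y -> is_derive y 1 Psi (dPsi y) /\ {for y, continuous dPsi},
        forall y, c <= dPsi y /\ dPsi y <= d,
        forall y, -1 < y -> V y <= Psi y /\ Psi y <= V y + e,
        dPsi 0 = c & - L <= Psi 0].
  apply: steklov => // y y' yy'.
    have [q [m [cq qd -> /(_ y')]]] := VE y; nra.
  have [q [m [cq qd -> /(_ y)]]] := VE y'; nra.
(* A vertical shift of at most [e] normalises the value at 0 to [- L + e], common to all branches,
   so that barriers glue; it accounts for the [2 * e] in [barrier_le]. *)
have shift_ge0 : 0 <= - L + e - Psi 0 /\ - L + e - Psi 0 <= e.
  have [_] := P3 0 (ltrN10 _).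
  by rewrite (V0 0 (lexx _)) mulr0; lra.
exists (fun y => Psi y + (- L + e - Psi 0)), dPsi; split=> //.
- move=> y y1; have [d1 _] := P1 y y1.
  by apply: (is_derive_eq (is_deriveD d1 (is_derive_cst (- L + e - Psi 0) y 1))); rewrite addr0.
- by move=> y /P1[].
- move=> y q y1 cq qd; have [VP _] := P3 y y1.
  suff : q * y - h q <= V y by lra.
  by rewrite /V le_max -{1}(mul1r (h q)) hopf_ge.
- move=> y y1; have [VP _] := P3 y y1.
  suff : c * y - L <= V y by lra.
  by rewrite /V le_max lexx orbT.
- by move=> y y1; have [_ VP] := P3 y y1; rewrite -/(V y); lra.
- by lra.
Qed.

End Barrier.
Section SelfSimilar.
Context (R : realType).
Implicit Types (Psi dPsi : R -> R) (t x eta k T : R).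

(* The exponential term makes a supersolution strict, is eta at time T, and for
   large k dominates any given bound from time T + 1 on. *)
Definition selfsim Psi eta k T t x : R :=
  t * Psi (x / t) + eta * expR (k * (t - T)).
Definition selfsim_t Psi dPsi eta k T t x : R :=
  Psi (x / t) - x / t * dPsi (x / t) + k * (eta * expR (k * (t - T))).
Definition selfsim_x dPsi t x : R := dPsi (x / t).

Lemma selfsim_C1 Psi dPsi eta k T :
  (forall y : R, -1 < y -> is_derive y 1 Psi (dPsi y)) ->
  (forall y : R, -1 < y -> {for y, continuous dPsi}) ->
  C1 (selfsim Psi eta k T) (selfsim_t Psi dPsi eta k T) (fun t x => selfsim_x dPsi t x).
Proof.
move=> dP cP t x t0 x0.
have y1 : -1 < x / t by apply: lt_le_trans (ltrN10 _) (divr_ge0 x0 (ltW t0)).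
have tn0 : t != 0 by rewrite gt_eqF.
have dPy := dP _ y1.
have cE : continuous (fun w : R * R => eta * expR (k * (w.1 - T))).
  move=> w; apply: cvgMr; apply: (@cvg_comp _ _ _ (fun w : R * R => k * (w.1 - T)) expR).
    by apply: cvgMr; apply: cvgB; [exact: cvg_fst|exact: cvg_cst].
  exact: continuous_expR.
have cq : {for (t, x), continuous (fun w : R * R => w.2 / w.1)}.
  by apply: cvgM; [exact: cvg_snd|apply: cvgV => //; exact: cvg_fst].
have cPsi_y : {for x / t, continuous Psi}.
  by apply: differentiable_continuous; apply/derivable1_diffP; case: dPy.
have cPsi : {for (t, x), continuous (fun w : R * R => Psi (w.2 / w.1))}.
  apply: (@cvg_comp _ _ _ (fun w : R * R => w.2 / w.1) Psi); first exact: cq.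
  exact: cPsi_y.
have cdPsi : {for (t, x), continuous (fun w : R * R => dPsi (w.2 / w.1))}.
  apply: (@cvg_comp _ _ _ (fun w : R * R => w.2 / w.1) dPsi); first exact: cq.
  exact: cP.
split.
- have dV : is_derive t 1 (fun s => x / s) (- x / t ^+ 2).
    have dI : is_derive t 1 (GRing.inv \o id) (- (id t) ^- 2 *: 1) by exact: is_deriveV.
    apply: (is_derive_eq (is_deriveZ x dI)).
    by rewrite /GRing.scale /=; field.
  have d1 := @is_derive1_comp _ Psi (fun s => x / s) t _ _ dPy dV.
  have d2 := is_deriveM (is_derive_id t 1) d1.
  have dA : is_derive t 1 (fun s => k * (s - T)) k.
    have dB := is_deriveZ k (is_deriveB (is_derive_id t (1 : R)) (is_derive_cst T t (1 : R))).
    by apply: (is_derive_eq dB); rewrite subr0 [k *: 1]mulr1.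
  have d3 := is_deriveZ eta (@is_derive1_comp _ expR (fun s => k * (s - T)) t _ _ (is_derive_expR _) dA).
  apply: (is_derive_eq (is_deriveD d2 d3)).
  by rewrite /selfsim_t /GRing.scale /=; field.
- have dV : is_derive x 1 (fun y => y / t) (t^-1).
    have dB := is_deriveZ t^-1 (is_derive_id x (1 : R)).
    have -> : (fun y => y / t) = t^-1 *: id by apply/funext => y; rewrite mulrC.
    by apply: (is_derive_eq dB); rewrite [_ *: 1]mulr1.
  have d1 := is_deriveZ t (@is_derive1_comp _ Psi (fun y => y / t) x _ _ dPy dV).
  apply: (is_derive_eq (is_deriveD d1 (is_derive_cst (eta * expR (k * (t - T))) x (1 : R)))).
  by rewrite /selfsim_x /GRing.scale /=; field.
- by apply: cvgD; [apply: cvgM; [exact: cvg_fst|exact: cPsi]|exact: cE].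
- apply: cvgD; last by apply: cvgMr; exact: cE.
  by apply: cvgB; [exact: cPsi|apply: cvgM; [exact: cq|exact: cdPsi]].
- exact: cdPsi.
Qed.

End SelfSimilar.
(** * Comparison with barriers *)

Section RiemannDatum.
Context (R : realType) (n : nat) (p : 'rV[R]_n.+1).

Lemma riemann_br a (x : R) : 0 <= x -> riemann_datum p (br a x) = p ord0 a * x.
Proof.
move=> x0; rewrite /riemann_datum /br wedge_lift_funE ?hval_hl // => b c.
by rewrite -hl0 hval_hl // !mulr0.
Qed.

Lemma riemann_continuous : continuous (riemann_datum p).
Proof.
apply: wedge_fun_continuous => [a x|a b]; last by rewrite -hl0 hval_hl // !mulr0.
by apply: (@cvgMr _ _ (nbhs x)); exact: (@hval_continuous R x).
Qed.

End RiemannDatum.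

Section Maximizer.
Context (R : realType) (n : nat) (p : 'rV[R]_n.+1) (u : R -> junction R n -> R).
Context (uinit : forall z, (usc_env u 0 z <= (riemann_datum p z)%:E)%E).
Context (ubd : forall T : R, 0 < T -> exists M : R, forall (t : R) z,
  0 <= t -> t < T -> u t z <= riemann_datum p z + M).
Implicit Types (t x e : R) (a : 'I_n.+1).

(* The superlinear gap delta confines maximizing sequences to a compact set. *)
Lemma sup_point (Dom : set (junction R n)) (phi : R -> junction R n -> R)
    (delta C T1 eta : R) (z1 : junction R n) :
  0 < delta -> 0 < T1 -> 0 < eta -> Dom z1 ->
  (forall t a x, 0 < t -> 0 <= x -> Dom (br a x) ->
    (p ord0 a + delta) * x - C * t <= phi t (br a x)) ->
  phi T1 z1 + eta < u T1 z1 ->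
  exists (k S t0 : R) (z0 : junction R n), [/\ 0 < k /\ 0 < S, 0 < t0, t0 < T1 + 2,
    forall t z, 0 < t -> t < T1 + 2 -> Dom z ->
      u t z <= phi t z + eta * expR (k * (t - T1)) + S &
    forall e, 0 < e -> ~ \forall w \near (t0, z0),
      0 < w.1 -> w.1 < T1 + 2 -> Dom w.2 ->
      u w.1 w.2 <= phi w.1 w.2 + eta * expR (k * (w.1 - T1)) + S - e].
Proof.
move=> delta0 T10 eta0 Dz1 phige uphi.
have T20 : 0 < T1 + 2 by lra.
have [M HM] := ubd T20.
pose B := `|M| + `|C| * (T1 + 2) + 1.
have B0 : 0 < B.
  have := normr_ge0 M; have := mulr_ge0 (normr_ge0 C) (ltW T20); rewrite /B; lra.
(* The gap [g] below is at most [B - delta * x - P t]. The equalities [eta * k = B] and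
   [delta * X = B] make this nonpositive after time [T1 + 1], by [1 + z <= expR z], and beyond
   abscissa [X]. *)
pose k := B / eta; pose X := B / delta.
have k0 : 0 < k by rewrite divr_gt0.
have keta : eta * k = B by rewrite /k mulrC divfK // gt_eqF.
have Xdelta : delta * X = B by rewrite /X mulrC divfK // gt_eqF.
pose P t := eta * expR (k * (t - T1)).
have P0 t : 0 < P t by rewrite mulr_gt0 // expR_gt0.
pose g (w : R * junction R n) := u w.1 w.2 - phi w.1 w.2 - P w.1.
pose D := [set w : R * junction R n | [/\ 0 < w.1, w.1 < T1 + 2 & Dom w.2]].
have Ct t : 0 < t -> t < T1 + 2 -> C * t <= `|C| * (T1 + 2).
  move=> t0 t2; apply: (@le_trans _ _ (`|C| * t)).
    by rewrite ler_pM2r // ler_norm.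
  by rewrite ler_wpM2l // ltW.
have gB t a x : D (t, br a x) -> 0 <= x -> g (t, br a x) <= B - delta * x - P t.
  move=> [/= t0 t2 Dx] x0; rewrite /g /=.
  have := HM t (br a x) (ltW t0) t2; rewrite riemann_br //.
  have := phige t a x t0 x0 Dx; have := Ct t t0 t2; have := ler_norm M.
  rewrite /B mulrDl; lra.
have [[t0 z0] [S [K0 S0 gS ngS]]] : exists z0 S,
    [/\ (`[0, T1 + 1] `*` (\bigcup_(a in [set: 'I_n.+1]) (br a @` `[0, X]))) z0, 0 < S,
      forall z, D z -> g z <= S &
      forall e, 0 < e -> ~ \forall z \near z0, D z -> g z <= S - e].
  apply: (@compact_sup_point _ _ _ D g B (T1, z1)).
  - exact: compact_ball.
  - move=> [t z] Dtz; have [a [x [x0 zE]]] := brP z; rewrite zE in Dtz *.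
    apply: le_trans (gB t a x Dtz x0) _.
    have := P0 t; have := mulr_ge0 (ltW delta0) x0; lra.
  - by split=> //=; lra.
  - rewrite /g /= /P subrr mulr0 expR0 mulr1; lra.
  - move=> [t z] Dtz; have [a [x [x0 zE]]] := brP z; rewrite zE in Dtz *.
    move=> nK; apply: le_trans (gB t a x Dtz x0) _.
    have [/= t0 t2 _] := Dtz.
    have [tT|tT] := leP t (T1 + 1); last first.
      have : 1 + k * (t - T1) <= expR (k * (t - T1)) by exact: expR_ge1Dx.
      rewrite -(ler_pM2l eta0) -/(P t) mulrDr mulrA keta.
      have := mulr_ge0 (ltW delta0) x0.
      have : B * 1 <= B * (t - T1) by rewrite ler_pM2l //; lra.
      lra.
    have [xX|xX] := leP x X.
      exfalso; apply: nK; split=> /=; first by rewrite in_itv /= tT ltW.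
      by exists a => //; exists x => //=; rewrite in_itv /= x0.
    have : delta * X <= delta * x by rewrite ler_pM2l // ltW.
    have := P0 t; lra.
have [/= t0ge z0K] := K0; move: t0ge; rewrite in_itv /= => /andP[t0ge t0T].
exists k, S, t0, z0; split=> //.
(* Time 0 is excluded: the initial condition, continuity of the datum and the term [C * t] each cost
   at most [S / 6], so that [g <= S / 2] near such a point. *)
- rewrite lt_def t0ge andbT; apply/eqP => t00.
  have e0 : 0 < S / 6 by lra.
  have S2 : 0 < S / 2 by lra.
  apply: (ngS (S / 2)) => //.
  have /limf_esup_leP/(_ (S / 6) e0) := uinit z0; rewrite -t00 => un.
  have {}un : \forall w \near (t0, z0), 0 <= w.1 ->
    u w.1 w.2 <= riemann_datum p z0 + S / 6 by exact: un.
  have rn : \forall w \near (t0, z0),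
      `|riemann_datum p z0 - riemann_datum p w.2| <= S / 6.
    have : (riemann_datum p w.2) @[w --> (t0, z0)] --> riemann_datum p z0.
      apply: (@cvg_comp _ _ _ snd (riemann_datum p) (nbhs (t0, z0)) (nbhs z0)).
        exact: cvg_snd.
      exact: riemann_continuous.
    by move=> /cvgrPdist_le/(_ _ e0).
  have tn : \forall w \near (t0, z0), w.1 < S / 6 / (`|C| + 1).
    have C1 : 0 < `|C| + 1 by rewrite ltr_wpDl.
    have : \forall s \near t0, s < S / 6 / (`|C| + 1).
      by rewrite t00; apply: lt_nbhsl; rewrite divr_gt0.
    exact: (@cvg_fst _ _ (nbhs t0) (nbhs z0) _ _).
  near=> w => Dw; have [w0 w2 wD] := Dw.
  have h1 : 0 <= w.1 -> u w.1 w.2 <= riemann_datum p z0 + S / 6 by near: w.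
  have {}h1 := h1 (ltW w0).
  have : `|riemann_datum p z0 - riemann_datum p w.2| <= S / 6 by near: w.
  rewrite ler_norml => /andP[h2 h3].
  have h4 : w.1 < S / 6 / (`|C| + 1) by near: w.
  have [a [x [x0 wE]]] := brP w.2.
  have h5 := phige w.1 a x w0 x0; rewrite -wE in h5; have {}h5 := h5 wD.
  have h6 : C * w.1 <= S / 6.
    move: h4; rewrite ltr_pdivlMr ?ltr_wpDl // => h4.
    apply: (@le_trans _ _ (w.1 * (`|C| + 1))); last exact: ltW.
    by rewrite mulrC ler_pM2l // (le_trans (ler_norm _)) // lerDl.
  have h7 : riemann_datum p w.2 = p ord0 a * x by rewrite wE riemann_br.
  have := P0 w.1; have := mulr_ge0 (ltW delta0) x0.
  by rewrite /g; move: h5; rewrite mulrDl; lra.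
- by lra.
- by move=> t z tt0 t2 Dz; have := gS (t, z); rewrite /g /P /= => /(_ (And3 tt0 t2 Dz)); lra.
- move=> e e0 He; apply: (ngS e e0).
  apply: filterS He => w hw [w0 w2 wD]; have := hw w0 w2 wD; rewrite /g /P; lra.
Unshelve. all: by end_near. Qed.

End Maximizer.
Section C1Algebra.
Context (R : realType).
Implicit Types (f g : R -> R -> R).

(** For the polynomials below the remainder is an explicit multiple of a square, so [ring] settles
    the derivatives. *)
Lemma is_derive_quadratic (G : R -> R) (y l C : R) :
  (forall z, `|G z - G y - l * (z - y)| <= C * (z - y) ^+ 2) -> is_derive y 1 G l.
Proof.
move=> HG; apply/is_derive1P => e e0.
have C0 : 0 < `|C| + 1 by rewrite ltr_wpDl.
exists (e / (`|C| + 1)); first by rewrite divr_gt0.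
move=> z; rewrite ltr_pdivlMr // => ze; apply: le_trans (HG z) _.
rewrite -real_normK ?num_real // expr2 mulrA ler_wpM2r //.
apply: le_trans (ltW ze); rewrite mulrC ler_wpM2l //.
by rewrite (le_trans (ler_norm _)) // lerDl.
Qed.

Lemma C1D f ft fx g gt gx : C1 f ft fx -> C1 g gt gx ->
  C1 (fun t x => f t x + g t x) (fun t x => ft t x + gt t x)
     (fun t x => fx t x + gx t x).
Proof.
move=> fC gC t x t0 x0; have [f1 f2 f3 f4 f5] := fC t x t0 x0.
have [g1 g2 g3 g4 g5] := gC t x t0 x0; split.
- exact: is_deriveD f1 g1.
- exact: is_deriveD f2 g2.
- exact: cvgD f3 g3.
- exact: cvgD f4 g4.
- exact: cvgD f5 g5.
Qed.

(** The second order Taylor polynomial of [1 / x] at [m], with its quadratic coefficient doubled. It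
    touches [1 / x] from above at [m] and, unlike [1 / x], is smooth up to [x = 0], as a test
    function has to be. *)
Definition inv_majorant (m x : R) : R :=
  m^-1 - (x - m) / m ^+ 2 + 2 * (x - m) ^+ 2 / m ^+ 3.

Lemma C1_inv_majorant (kappa m : R) : C1 (fun t x => kappa * t ^+ 2 * inv_majorant m x)
  (fun t x => 2 * kappa * t * inv_majorant m x)
  (fun t x => kappa * t ^+ 2 * (- 1 / m ^+ 2 + 4 * (x - m) / m ^+ 3)).
Proof.
have ct : continuous (fun w : R * R => w.1) by move=> w; exact: cvg_fst.
have cx : continuous (fun w : R * R => w.2) by move=> w; exact: cvg_snd.
have cxm : continuous (fun w : R * R => w.2 - m).
  by move=> w; apply: cvgB; [exact: cx|exact: cvg_cst].
have cM : continuous (fun w : R * R => inv_majorant m w.2).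
  move=> w; apply: cvgD; first apply: cvgB; first exact: cvg_cst.
    by apply: cvgMl; exact: cxm.
  apply: cvgMl; apply: cvgMr; rewrite expr2.
  have -> : (fun w : R * R => (w.2 - m) ^+ 2) = (fun w : R * R => (w.2 - m) * (w.2 - m)) by [].
  by apply: cvgM; exact: cxm.
have ct2 : continuous (fun w : R * R => kappa * w.1 ^+ 2).
  move=> w; apply: cvgMr.
  have -> : (fun w : R * R => w.1 ^+ 2) = (fun w : R * R => w.1 * w.1) by [].
  by apply: cvgM; exact: ct.
move=> t x _ _; split.
- apply: (@is_derive_quadratic _ _ _ (`|kappa * inv_majorant m x|)) => z.
  rewrite (_ : _ - _ = kappa * inv_majorant m x * (z - t) ^+ 2); last by ring.
  by rewrite normrM [X in _ * X]ger0_norm // sqr_ge0.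
- apply: (@is_derive_quadratic _ _ _ (`|kappa * t ^+ 2 * (2 / m ^+ 3)|)) => z.
  rewrite (_ : _ - _ = kappa * t ^+ 2 * (2 / m ^+ 3) * (z - x) ^+ 2); last first.
    by rewrite /inv_majorant; ring.
  by rewrite normrM [X in _ * X]ger0_norm // sqr_ge0.
- by apply: cvgM; [exact: ct2|exact: cM].
- by apply: cvgM; [apply: cvgMr; exact: ct|exact: cM].
- apply: cvgM; first exact: ct2.
  by apply: cvgD; [exact: cvg_cst|apply: cvgMl; apply: cvgMr; exact: cxm].
Qed.

Lemma inv_majorant_ge (m x : R) : 0 < m -> m / 2 <= x -> x^-1 <= inv_majorant m x.
Proof.
move=> m0 mx; have x0 : 0 < x by lra.
have -> : inv_majorant m x = x^-1 + (x - m) ^+ 2 * (2 * x - m) / (m ^+ 3 * x).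
  by rewrite /inv_majorant; field; rewrite !gt_eqF.
rewrite lerDl divr_ge0 //; last by rewrite mulr_ge0 ?exprn_ge0 // ltW.
by rewrite mulr_ge0 ?sqr_ge0 //; lra.
Qed.

End C1Algebra.

(** * Comparison on a single open branch *)

Section OpenBranch.
Context (R : realType) (n : nat) (H : 'I_n.+1 -> R -> R) (F : 'rV[R]_n.+1 -> R).
Context (p : 'rV[R]_n.+1) (u : R -> junction R n -> R).
Context (usub : weak_sub H F u).
Context (uinit : forall z, (usc_env u 0 z <= (riemann_datum p z)%:E)%E).
Context (ubd : forall T : R, 0 < T -> exists M : R, forall (t : R) z,
  0 <= t -> t < T -> u t z <= riemann_datum p z + M).
Implicit Types (t x y e L : R) (a b : 'I_n.+1).

Lemma near_coord a t (z : junction R n) (P : R -> R -> Prop) :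
  (\forall w \near (t, coord a z), P w.1 w.2) ->
  \forall w \near (t, z), P w.1 (coord a w.2).
Proof. by have := cvg_map_snd t (@coord_continuous R n a z); exact. Qed.

(* By 1-homogeneity of t Psi(x/t), its derivatives satisfy
   t f_t + x f_x = f, so that f_t + H(f_x) is nonnegative as soon as f lies
   above the affine solution of slope f_x. *)
Lemma no_interior_max a c d L e Psi dPsi eta k T1 kappa S t0 x0 :
  is_barrier (H a) c d L e Psi dPsi -> 0 <= kappa ->
  (0 < kappa -> forall q, q <= c -> L <= H a q) ->
  0 < eta -> 0 < k -> 0 < t0 -> 0 < x0 ->
  (\forall w \near (t0, br a x0), u w.1 w.2 <=
     w.1 * Psi (coord a w.2 / w.1) + kappa * w.1 ^+ 2 / coord a w.2
     + eta * expR (k * (w.1 - T1)) + S) ->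
  ~ (forall e, 0 < e -> ~ \forall w \near (t0, br a x0), u w.1 w.2 <=
     w.1 * Psi (coord a w.2 / w.1) + kappa * w.1 ^+ 2 / coord a w.2
     + eta * expR (k * (w.1 - T1)) + S - e).
Proof.
move=> bP kappa0 Hk eta0 k0 t00 x00 uf nuf.
have fC := C1D (selfsim_C1 eta k T1 (barrier_derive bP) (barrier_cont bP))
  (C1_inv_majorant kappa x0).
have cc : coord a (br a x0) = x0 by rewrite coord_br ?ltW // eqxx.
have x02 : 0 < x0 / 2 by lra.
have nx : \forall w \near (t0, br a x0), x0 / 2 < coord a w.2.
  apply: (@near_coord a t0 (br a x0) (fun _ y => x0 / 2 < y)); rewrite cc.
  have : \forall y \near x0, x0 / 2 < y by apply: lt_nbhsr; lra.
  exact: (@cvg_snd _ _ (nbhs t0) (nbhs x0) _ _).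
have maj (r y : R) : x0 / 2 < y ->
    kappa * r ^+ 2 / y <= kappa * r ^+ 2 * inv_majorant x0 y.
  move=> xy; apply: ler_wpM2l; first by rewrite mulr_ge0 ?sqr_ge0.
  by apply: inv_majorant_ge => //; exact: ltW.
have := sub_interior (S := S) usub fC t00 x00.
have x0n : x0 != 0 by rewrite gt_eqF.
have t0n : t0 != 0 by rewrite gt_eqF.
have -> : inv_majorant x0 x0 = x0^-1 by rewrite /inv_majorant subrr expr0n /=; field.
rewrite subrr mulr0 mul0r addr0 => test.
suff : ~ (selfsim_t Psi dPsi eta k T1 t0 x0 + 2 * kappa * t0 * x0^-1 +
    H a (selfsim_x dPsi t0 x0 + kappa * t0 ^+ 2 * (-1 / x0 ^+ 2)) <= 0).
  apply; apply: test.
    near=> w; have xw : x0 / 2 < coord a w.2 by near: w.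
    have : u w.1 w.2 <= w.1 * Psi (coord a w.2 / w.1) +
      kappa * w.1 ^+ 2 / coord a w.2 + eta * expR (k * (w.1 - T1)) + S by near: w.
    have := maj w.1 _ xw; rewrite /selfsim; lra.
  (* The majorant agrees with [1 / x] at [x0], so near the contact point exchanging the two costs at
     most [e' / 2]. *)
  move=> e' e'0 He; apply: (nuf (e' / 2)); first lra.
  have e2 : 0 < e' / 2 by lra.
  have cm : \forall w \near (t0, br a x0),
      `|kappa * w.1 ^+ 2 * (inv_majorant x0 (coord a w.2) - (coord a w.2)^-1)| <= e' / 2.
    apply: (@near_coord a t0 (br a x0) (fun s y =>
      `|kappa * s ^+ 2 * (inv_majorant x0 y - y^-1)| <= e' / 2)); rewrite cc.
    have [_ _ c1 _ _] := C1_inv_majorant kappa x0 t00 (ltW x00).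
    have c2 : {for (t0, x0), continuous (fun w : R * R => kappa * w.1 ^+ 2 * w.2^-1)}.
      apply: cvgM; last by apply: cvgV => //; exact: cvg_snd.
      apply: cvgMr.
      have -> : (fun w : R * R => w.1 ^+ 2) = (fun w : R * R => w.1 * w.1) by [].
      by apply: cvgM; exact: cvg_fst.
    have : (kappa * w.1 ^+ 2 * inv_majorant x0 w.2 - kappa * w.1 ^+ 2 / w.2)
        @[w --> (t0, x0)] --> kappa * t0 ^+ 2 * inv_majorant x0 x0 - kappa * t0 ^+ 2 / x0.
      exact: cvgB c1 c2.
    move=> /cvgrPdist_le/(_ _ e2).
    apply: filterS => w /=.
    have -> : inv_majorant x0 x0 = x0^-1 by rewrite /inv_majorant subrr expr0n /=; field.
    rewrite -mulrBr subrr mulr0 sub0r normrN.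
    by rewrite /= -mulrBr.
  near=> w; have xw : x0 / 2 < coord a w.2 by near: w.
  have h1 : u w.1 w.2 <= selfsim Psi eta k T1 w.1 (coord a w.2) +
    kappa * w.1 ^+ 2 * inv_majorant x0 (coord a w.2) + S - e' by near: w.
  have : `|kappa * w.1 ^+ 2 * (inv_majorant x0 (coord a w.2) - (coord a w.2)^-1)|
    <= e' / 2 by near: w.
  by rewrite mulrBr ler_norml => /andP[_]; move: h1; rewrite /selfsim; lra.
apply/negP; rewrite -ltNge /selfsim_t /selfsim_x.
set y := x0 / t0; have y0 : 0 < y by rewrite divr_gt0.
have y1 : -1 < y by apply: lt_trans y0.
have -> : kappa * t0 ^+ 2 * (-1 / x0 ^+ 2) = - (kappa / y ^+ 2).
  by rewrite /y; field; rewrite ?x0n ?t0n.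
have -> : 2 * kappa * t0 * x0^-1 = 2 * (kappa / y).
  by rewrite /y; field; rewrite ?x0n ?t0n.
have P0 : 0 < k * (eta * expR (k * (t0 - T1))) by rewrite !mulr_gt0 ?expR_gt0.
have ky0 : 0 <= kappa / y by rewrite divr_ge0 // ltW.
(* [b] is the full space slope. By homogeneity, which [kappa * t ^+ 2 / x] shares, the left side of
   the equation is [Psi y - (b * y - H a b)] plus the nonnegative [kappa / y] and the positive
   exponential term. *)
set b := dPsi y - kappa / y ^+ 2.
have bE : y * dPsi y = y * b + kappa / y by rewrite /b; field; rewrite gt_eqF.
have [s1 s2] := barrier_slope bP y.
have bd : b <= d.
  by apply: le_trans s2; rewrite /b gerBl divr_ge0 // sqr_ge0.
suff : b * y - H a b <= Psi y by move: bE; lra.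
have [cb|bc] := leP c b; first exact: (barrier_ge bP).
(* A slope below [c] can only come from the [kappa] term; the line [c y - L] and [L <= H a] on
   []-oo, c]] then replace [barrier_ge]. *)
have kappa1 : 0 < kappa.
  rewrite lt_def kappa0 andbT; apply/eqP => kE.
  by move: bc; rewrite /b kE mul0r subr0 ltNge s1.
have := Hk kappa1 b (ltW bc); have := barrier_ge_line bP y1.
have : b * y <= c * y by rewrite ler_pM2r // ltW.
lra.
Unshelve. all: by end_near. Qed.

(** The open branch is not closed, but the origin is its only missing limit point; a maximising
    point thus lies inside the branch or at the origin. *)
Lemma near_offbranch a t (z : junction R n) : coord a z = 0 -> z <> origin R n ->
  \forall w \near (t, z), ~ 0 < coord a w.2.
Proof.
have [b [x [x0 ->]]] := brP z; rewrite coord_br // => ba xo.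
have x1 : 0 < x.
  rewrite lt_def x0 andbT; apply/eqP => xE; apply: xo; by rewrite xE br0.
have {}ba : (b == a) = false.
  by case: eqP ba => // _ xE; rewrite xE ltxx in x1.
have nearT : \forall w \near (t, x), True by exact: filterT.
have := @near_br R n b t x (fun _ _ => True) x1 nearT.
apply: filterS => w [w0 -> _]; by rewrite coord_br ?coord_ge0 // ba ltxx.
Qed.

Lemma barrier_near0 h c d L e Psi dPsi t e' : is_barrier h c d L e Psi dPsi ->
  0 < t -> 0 < e' -> \forall w \near (t, 0 : R),
    `|t * Psi 0 - w.1 * Psi (w.2 / w.1)| <= e'.
Proof.
move=> bP t0 e'0.
have [_ _ c1 _ _] := selfsim_C1 0 0 0 (barrier_derive bP) (barrier_cont bP) t0 (lexx 0).
have /cvgrPdist_le/(_ _ e'0) := c1.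
by apply: filterS => w /=; rewrite /selfsim mul0r !mul0r !addr0.
Qed.

(** The origin must not carry the maximum, and two mechanisms ensure it. For [kappa > 0] the
    singular term blows up there, at the price of [L <= H a] below [c]; for [kappa = 0] a bound on
    [u] near the origin serves as Dirichlet data. The strict inequality between [p] and [d] makes
    the barrier outgrow the datum. *)
Lemma compare_open a c d L e Psi dPsi kappa t x :
  is_barrier (H a) c d L e Psi dPsi -> c <= d -> p ord0 a < d -> 0 < e ->
  0 <= kappa -> (0 < kappa -> forall q, q <= c -> L <= H a q) ->
  (kappa = 0 -> forall t e, 0 < t -> 0 < e -> \forall w \near (t, origin R n),
     0 < coord a w.2 -> u w.1 w.2 <= - L * t + e) ->
  0 < t -> 0 < x -> u t (br a x) <= t * Psi (x / t) + kappa * t ^+ 2 / x.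
Proof.
move=> bP cd pd e0 kappa0 Hk Hbd t0 x0; rewrite leNgt; apply/negP => ugt.
pose phi (s : R) (z : junction R n) :=
  s * Psi (coord a z / s) + kappa * s ^+ 2 / coord a z.
pose eta := (u t (br a x) - phi t (br a x)) / 2.
have cbr y : 0 < y -> coord a (br a y) = y.
  by move=> y0; rewrite coord_br ?ltW // eqxx.
have phix : phi t (br a x) < u t (br a x) by rewrite /phi cbr.
have eta0 : 0 < eta by rewrite /eta; lra.
have [||||k [S [s0 [z0 [[k0 S0] s00 s0T uS nuS]]]]] := @sup_point R n p u uinit ubd
  [set z | 0 < coord a z] phi (d - p ord0 a) (H a d) t eta (br a x) _ t0 eta0.
- lra.
- by rewrite /= cbr.
- move=> s b y s_0 y0; rewrite /= coord_br //; case: eqP => [->|_]; last by rewrite ltxx.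
  move=> y00; rewrite /phi cbr //.
  have ys : -1 < y / s by apply: lt_trans (divr_gt0 y00 s_0).
  have := barrier_ge bP ys cd (lexx d); rewrite -(ler_pM2l s_0).
  have -> : s * (d * (y / s) - H a d) = d * y - H a d * s by field; rewrite gt_eqF.
  have : 0 <= kappa * s ^+ 2 / y by rewrite divr_ge0 // mulr_ge0 ?sqr_ge0.
  have -> : p ord0 a + (d - p ord0 a) = d by ring.
  lra.
- by rewrite /eta; lra.
have tn : \forall w \near (s0, z0), 0 < w.1 /\ w.1 < t + 2.
  have : \forall s \near s0, 0 < s /\ s < t + 2.
    by near=> s; split; near: s; [exact: lt_nbhsr|exact: lt_nbhsl].
  exact: (@cvg_fst _ _ (nbhs s0) (nbhs z0) _ _).
have [z00|z00] := ltP 0 (coord a z0).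
  have zE := coord_gt0 z00; rewrite {}zE in tn nuS *.
  have nearT : \forall w \near (s0, coord a z0), True by exact: filterT.
  have nz := @near_br R n a s0 (coord a z0) (fun _ _ => True) z00 nearT.
  apply: (no_interior_max (S := S) (T1 := t) bP kappa0 Hk eta0 k0 s00 z00).
    near=> w; have [w0 w2] : 0 < w.1 /\ w.1 < t + 2 by near: w.
    have [wz _ _] : [/\ 0 < coord a w.2, w.2 = br a (coord a w.2) & True] by near: w.
    by have := uS w.1 w.2 w0 w2 wz.
  move=> e' e'0 He; apply: (nuS e' e'0).
  by apply: filterS He => w He _ _ _; exact: He.
have {}z00 : coord a z0 = 0 by apply/eqP; rewrite eq_le z00 coord_ge0.
have [zo|zo] := pselect (z0 = origin R n); last first.
  apply: (nuS 1 ltr01); apply: filterS (near_offbranch s0 z00 zo) => w nw _ _.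
  by move=> /nw.
rewrite {}zo in z00 tn nuS *.
have S2 : 0 < S / 2 by lra.
have P0 s : 0 < eta * expR (k * (s - t)) by rewrite mulr_gt0 ?expR_gt0.
move: kappa0; rewrite le_eqVlt => /orP[/eqP kE|kappa1].
  have S4 : 0 < S / 4 by lra.
  have n1 := Hbd (esym kE) s0 (S / 4) s00 S4.
  have n2 : \forall w \near (s0, origin R n),
      `|s0 * Psi 0 - w.1 * Psi (coord a w.2 / w.1)| <= S / 4.
    apply: (@near_coord a s0 (origin R n) (fun s y =>
      `|s0 * Psi 0 - s * Psi (y / s)| <= S / 4)); rewrite z00.
    exact: barrier_near0 bP s00 S4.
  apply: (nuS (S / 2) S2); near=> w => w0 w2 /= wz.
  have h1 : 0 < coord a w.2 -> u w.1 w.2 <= - L * s0 + S / 4 by near: w.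
  have {}h1 := h1 wz.
  have : `|s0 * Psi 0 - w.1 * Psi (coord a w.2 / w.1)| <= S / 4 by near: w.
  rewrite (barrier0 bP) ler_norml => /andP[h2 h3].
  have := P0 w.1; have := mulr_gt0 s00 e0; rewrite /phi -kE !mul0r addr0; nra.
have T20 : 0 < t + 2 by lra.
have [M HM] := ubd T20.
(* Near the origin [B] bounds [u] minus the regular part of the barrier; for [x] below
   [kappa * (s0 / 2) ^+ 2 / B] the singular term exceeds it. *)
pose B := `|p ord0 a| + `|M| + `|s0 * Psi 0| + 1 + 1.
have B0 : 0 < B.
  have := normr_ge0 (p ord0 a); have := normr_ge0 M; have := normr_ge0 (s0 * Psi 0).
  rewrite /B; lra.
have n2 : \forall w \near (s0, origin R n),
      `|s0 * Psi 0 - w.1 * Psi (coord a w.2 / w.1)| <= 1.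
  apply: (@near_coord a s0 (origin R n) (fun s y =>
    `|s0 * Psi 0 - s * Psi (y / s)| <= 1)); rewrite z00.
  exact: barrier_near0 bP s00 ltr01.
have n3 : \forall w \near (s0, origin R n), s0 / 2 < w.1.
  have : \forall s \near s0, s0 / 2 < s by apply: lt_nbhsr; lra.
  exact: (@cvg_fst _ _ (nbhs s0) (nbhs (origin R n)) _ _).
have X0 : 0 < Num.min 1 (kappa * (s0 / 2) ^+ 2 / B).
  by rewrite lt_min ltr01 divr_gt0 // mulr_gt0 // exprn_gt0 // divr_gt0.
have n4 : \forall w \near (s0, origin R n),
    coord a w.2 < Num.min 1 (kappa * (s0 / 2) ^+ 2 / B).
  apply: (@near_coord a s0 (origin R n) (fun _ y => y < Num.min 1 (kappa * (s0 / 2) ^+ 2 / B))).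
  rewrite z00.
  have : \forall y \near (0 : R), y < Num.min 1 (kappa * (s0 / 2) ^+ 2 / B) by exact: lt_nbhsl.
  exact: (@cvg_snd _ _ (nbhs s0) (nbhs (0 : R)) _ _).
apply: (nuS S S0); near=> w => w0 w2 /= wz.
have : `|s0 * Psi 0 - w.1 * Psi (coord a w.2 / w.1)| <= 1 by near: w.
rewrite ler_norml => /andP[h1 h2].
have h3 : s0 / 2 < w.1 by near: w.
have : coord a w.2 < Num.min 1 (kappa * (s0 / 2) ^+ 2 / B) by near: w.
rewrite lt_min => /andP[h4 h5].
have h6 := HM w.1 w.2 (ltW w0) w2.
have wE := coord_gt0 wz; rewrite {2}wE (riemann_br p a (ltW wz)) in h6.
have h7 : p ord0 a * coord a w.2 <= `|p ord0 a|.
  apply: le_trans (_ : `|p ord0 a| * coord a w.2 <= _).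
    by rewrite ler_pM2r // ler_norm.
  by rewrite -[leRHS]mulr1 ler_wpM2l // ltW.
have h8 : B <= kappa * w.1 ^+ 2 / coord a w.2.
  rewrite ler_pdivlMr //; move: h5; rewrite ltr_pdivlMr // => h5.
  apply: ltW; rewrite mulrC; apply: lt_le_trans h5 _.
  rewrite ler_pM2l // ler_sqr ?nnegrE; lra.
have := P0 w.1; have := ler_norm M; have := ler_norm (- (s0 * Psi 0)).
by move: h8; rewrite normrN /phi /B; lra.
Unshelve. all: by end_near. Qed.

End OpenBranch.

(** * Bounds at the origin and their propagation into the branches *)

Section FullJunction.
Context (R : realType) (n : nat) (H : 'I_n.+1 -> R -> R) (F : 'rV[R]_n.+1 -> R).
Context (p : 'rV[R]_n.+1) (u : R -> junction R n -> R).
Context (usub : weak_sub H F u).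
Context (uinit : forall z, (usc_env u 0 z <= (riemann_datum p z)%:E)%E).
Context (ubd : forall T : R, 0 < T -> exists M : R, forall (t : R) z,
  0 <= t -> t < T -> u t z <= riemann_datum p z + M).
Context (Hc : forall a, continuous (H a)).
Implicit Types (t x y e L : R) (a b : 'I_n.+1).

Lemma Hmin_ge (G : 'I_n.+1 -> R -> R) (q : 'rV[R]_n.+1) L :
  (forall a, L <= G a (q ord0 a)) -> L <= Hmin G q.
Proof.
move=> LG; rewrite /Hmin; apply: (big_ind (fun v => L <= v)) => // v w vL wL.
by rewrite le_min vL.
Qed.

Lemma Hmin_le (G : 'I_n.+1 -> R -> R) (q : 'rV[R]_n.+1) a :
  Hmin G q <= G a (q ord0 a).
Proof. by rewrite /Hmin (bigD1 a) //= ge_min lexx. Qed.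

(** Contact at the origin is impossible: the time derivative there is [- L + e] plus a positive
    term, while the slopes are exactly [c], at which both [F] and every [H a] are at least [L].
    Contact inside a branch is excluded by [no_interior_max] with [kappa = 0]. *)
Lemma compare_full (c d : 'I_n.+1 -> R) (delta L e : R)
    (Psi dPsi : 'I_n.+1 -> R -> R) :
  (forall a, is_barrier (H a) (c a) (d a) L e (Psi a) (dPsi a)) ->
  (forall a, c a <= d a) -> 0 < delta -> (forall a, p ord0 a + delta <= d a) ->
  (forall a, L <= H a (c a)) -> 0 < e -> L <= F (\row_a c a) ->
  forall t a x, 0 < t -> 0 <= x -> u t (br a x) <= t * Psi a (x / t).
Proof.
move=> bP cd delta0 pd LH e0 LF t1 a1 x1 t10 x10; rewrite leNgt; apply/negP => ugt.
pose phi := jfun (fun a (s x : R) => s * Psi a (x / s)).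
have phi0 s a b : s * Psi a (0 / s) = s * Psi b (0 / s).
  by rewrite mul0r (barrier0 (bP a)) (barrier0 (bP b)).
have phiE s a x : 0 <= x -> phi s (br a x) = s * Psi a (x / s).
  by move=> x0; rewrite /phi jfun_br.
pose eta := (u t1 (br a1 x1) - phi t1 (br a1 x1)) / 2.
have phix : phi t1 (br a1 x1) < u t1 (br a1 x1) by rewrite phiE.
have eta0 : 0 < eta by rewrite /eta; lra.
pose C := \sum_a `|H a (d a)|.
have CH a : H a (d a) <= C.
  apply: le_trans (ler_norm _) _; rewrite /C (bigD1 a) //= lerDl.
  by apply: sumr_ge0.
have [|||k [S [s0 [z0 [[k0 S0] s00 s0T uS nuS]]]]] := @sup_point R n p u uinit ubd
  setT phi delta C t1 eta (br a1 x1) delta0 t10 eta0.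
- by [].
- move=> s a x s_0 x0 _; rewrite phiE //.
  have ys : -1 < x / s by apply: lt_le_trans (ltrN10 _) (divr_ge0 x0 (ltW s_0)).
  have := barrier_ge (bP a) ys (cd a) (lexx _); rewrite -(ler_pM2l s_0).
  have -> : s * (d a * (x / s) - H a (d a)) = d a * x - H a (d a) * s.
    by field; rewrite gt_eqF.
  apply: le_trans; apply: lerB; first by rewrite ler_wpM2r.
  by rewrite ler_wpM2r // ltW.
- by rewrite /eta; lra.
pose f a := selfsim (Psi a) eta k t1.
have fC a : C1 (f a) (selfsim_t (Psi a) (dPsi a) eta k t1) (fun t x => selfsim_x (dPsi a) t x).
  exact: selfsim_C1 (barrier_derive (bP a)) (barrier_cont (bP a)).
have f0 a b s : f a s 0 = f b s 0 by rewrite /f /selfsim (phi0 s a b).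
have fE w : jfun f w.1 w.2 = phi w.1 w.2 + eta * expR (k * (w.1 - t1)).
  by have [a [x [x0 ->]]] := brP w.2; rewrite phiE // jfun_br.
have tn : \forall w \near (s0, z0), 0 < w.1 /\ w.1 < t1 + 2.
  have : \forall s \near s0, 0 < s /\ s < t1 + 2.
    by near=> s; split; near: s; [exact: lt_nbhsr|exact: lt_nbhsl].
  exact: (@cvg_fst _ _ (nbhs s0) (nbhs z0) _ _).
have near1 : \forall w \near (s0, z0), u w.1 w.2 <= jfun f w.1 w.2 + S.
  near=> w; have [w0 w2] : 0 < w.1 /\ w.1 < t1 + 2 by near: w.
  by rewrite fE; apply: uS.
have near2 e' : 0 < e' -> ~ \forall w \near (s0, z0),
    u w.1 w.2 <= jfun f w.1 w.2 + S - e'.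
  move=> e'0 He; apply: (nuS e' e'0).
  by apply: filterS He => w; rewrite fE.
have [a zE] := brE z0; have := coord_ge0 a z0.
rewrite le_eqVlt => /orP[/eqP z00|z00].
  have {}zE : z0 = origin R n by rewrite zE -z00 br0.
  rewrite {}zE in near1 near2.
  have := sub_junction usub fC (fun a b s _ => f0 a b s) s00 near1 near2.
  have -> : \row_a selfsim_x (dPsi a) s0 0 = \row_a c a.
    by apply/rowP => b; rewrite !mxE /selfsim_x mul0r (barrier_slope0 (bP b)).
  rewrite /selfsim_t !mul0r (barrier0 (bP _)) subr0.
  have : L <= Num.min (F (\row_a c a)) (Hmin H (\row_a c a)).
    by rewrite le_min LF; apply: Hmin_ge => b; rewrite mxE.
  have : 0 < k * (eta * expR (k * (s0 - t1))).
    by apply: mulr_gt0 => //; apply: mulr_gt0 => //; exact: expR_gt0.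
  lra.
rewrite {}zE in near1 near2.
have nearT : \forall w \near (s0, coord a z0), True by exact: filterT.
have nz := @near_br R n a s0 (coord a z0) (fun _ _ => True) z00 nearT.
have gE w : w.2 = br a (coord a w.2) -> jfun f w.1 w.2 =
    w.1 * Psi a (coord a w.2 / w.1) + 0 * w.1 ^+ 2 / coord a w.2
     + eta * expR (k * (w.1 - t1)).
  move=> wE; rewrite {1}wE (jfun_br a (fun b b' => f0 b b' _) (coord_ge0 a w.2)).
  by rewrite /f /selfsim !mul0r addr0.
apply: (no_interior_max (S := S) (T1 := t1) (kappa := 0) usub (bP a) (lexx 0) _ eta0 k0 s00 z00).
- by rewrite ltxx.
- near=> w.
  have [_ wE _] : [/\ 0 < coord a w.2, w.2 = br a (coord a w.2) & True] by near: w.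
  by rewrite -gE //; near: w.
- move=> e' e'0 He; apply: (near2 e' e'0); near=> w.
  have [_ wE _] : [/\ 0 < coord a w.2, w.2 = br a (coord a w.2) & True] by near: w.
  by rewrite gE //; near: w.
Unshelve. all: by end_near. Qed.

(** Barriers need slopes strictly above those of the datum; enlarging the interval to the right of
    [m] by a small [k] costs only [e] in the level. *)
Lemma right_margin (h : R -> R) (m L e : R) : continuous h -> L <= h m -> 0 < e ->
  \forall k \near (0 : R)^'+, forall q, m <= q -> q <= m + k -> L - e <= h q.
Proof.
move=> hc Lm e0; have /cvgrPdist_le/(_ _ e0) := hc m.
move=> /nbhs_ballP[r /= r0 rP]; near=> k => q mq qk.
have : ball m r q.
  rewrite /ball /= distrC ger0_norm ?subr_ge0 // ltrBlDl.
  by apply: le_lt_trans qk _; rewrite ltrD2l; near: k; exact: nbhs_right_lt.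
by move=> /rP; rewrite ler_norml => /andP[]; lra.
Unshelve. all: by end_near. Qed.

Lemma near_origin_barrier a h c d L e Psi dPsi t e' :
  is_barrier h c d L e Psi dPsi ->
  (forall t x, 0 < t -> 0 < x -> u t (br a x) <= t * Psi (x / t)) ->
  0 < t -> 0 < e' -> \forall w \near (t, origin R n),
    0 < coord a w.2 -> u w.1 w.2 <= t * (- L + e) + e'.
Proof.
move=> bP uP t0 e'0.
have c0 : coord a (origin R n) = 0 by rewrite -(br0 R a) coord_br // eqxx.
have n1 : \forall w \near (t, origin R n),
    `|t * Psi 0 - w.1 * Psi (coord a w.2 / w.1)| <= e'.
  apply: (@near_coord R n a t (origin R n) (fun s y =>
    `|t * Psi 0 - s * Psi (y / s)| <= e')); rewrite c0.
  exact: barrier_near0 bP t0 e'0.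
have n2 : \forall w \near (t, origin R n), 0 < w.1.
  exact: (@cvg_fst _ _ (nbhs t) (nbhs (origin R n)) _ [set s | 0 < s] (lt_nbhsr t0)).
near=> w => wz; have w0 : 0 < w.1 by near: w.
have : `|t * Psi 0 - w.1 * Psi (coord a w.2 / w.1)| <= e' by near: w.
have := uP w.1 (coord a w.2) w0 wz; rewrite -(coord_gt0 wz) (barrier0 bP).
by rewrite ler_norml => h1 /andP[]; lra.
Unshelve. all: by end_near. Qed.

Context (m : 'I_n.+1 -> R) (lam : R) (pm : forall a, p ord0 a <= m a).

(** The second clause, on neighbourhoods and along every branch, is the Dirichlet data that
    [compare_open] asks for when [kappa = 0]. *)
Definition origin_bounded : Prop :=
  (forall t, 0 < t -> u t (origin R n) <= - lam * t) /\
  (forall a t e, 0 < t -> 0 < e -> \forall w \near (t, origin R n),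
     0 < coord a w.2 -> u w.1 w.2 <= - lam * t + e).

(** Barriers with slopes in [[r, m + k]] and level [lam - e] take the value [t (- lam + 2 e)] at the
    origin, and [e] is sent to 0. The flux supports the barrier at [r], and [m] dominates the slopes
    of the datum. *)
Lemma origin_bound_junction (r : 'rV[R]_n.+1) : (forall a, r ord0 a <= m a) ->
  (forall a q, r ord0 a <= q -> q <= m a -> lam <= H a q) -> lam <= F r ->
  origin_bounded.
Proof.
move=> rm Hr Fr.
have main e : 0 < e -> exists (d : 'I_n.+1 -> R) (Psi dPsi : 'I_n.+1 -> R -> R),
    (forall a, is_barrier (H a) (r ord0 a) (d a) (lam - e) e (Psi a) (dPsi a)) /\
    forall t a x, 0 < t -> 0 <= x -> u t (br a x) <= t * Psi a (x / t).
  move=> e0.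
  have : \forall k \near (0 : R)^'+, 0 < k /\ forall a q, m a <= q -> q <= m a + k ->
      lam - e <= H a q.
    near=> k; split; first by near: k; exact: nbhs_right_gt.
    near: k; apply: (@filter_forall _ _ (fun a k => forall q, m a <= q ->
      q <= m a + k -> lam - e <= H a q)) => a.
    by apply: right_margin => //; exact: Hr.
  move=> /filter_ex[k [k0 Hk]].
  have Hd a q : r ord0 a <= q -> q <= m a + k -> lam - e <= H a q.
    move=> rq qk; have [qm|/ltW mq] := leP q (m a); last exact: Hk.
    by have := Hr a q rq qm; lra.
  have rd a : r ord0 a <= m a + k by have := rm a; lra.
  have /choice[P HP] : forall a, exists P : (R -> R) * (R -> R),
      is_barrier (H a) (r ord0 a) (m a + k) (lam - e) e P.1 P.2.
    move=> a; have [Psi [dPsi bP]] := barrier_exists (@Hc a) (rd a) e0 (Hd a).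
    by exists (Psi, dPsi).
  exists (fun a => m a + k), (fun a => (P a).1), (fun a => (P a).2); split=> //.
  apply: (@compare_full (fun a => r ord0 a) (fun a => m a + k) k (lam - e) e
    (fun a => (P a).1) (fun a => (P a).2)) => //.
  - by move=> a; rewrite lerD2r.
  - by move=> a; apply: Hd.
  - have -> : \row_a r ord0 a = r by apply/rowP => a; rewrite mxE.
    by lra.
split=> [t t0|a t e t0 e0].
  apply/ler_addgt0Pr => e e0; have e'0 : 0 < e / (2 * t) by rewrite divr_gt0 // mulr_gt0.
  have [d [Psi [dPsi [bP uP]]]] := main _ e'0.
  have := uP t ord0 0 t0 (lexx 0); rewrite br0 mul0r (barrier0 (bP _)).
  have -> : t * (- (lam - e / (2 * t)) + e / (2 * t)) = - lam * t + e.
    by field; rewrite gt_eqF.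
  by [].
have e'0 : 0 < e / (4 * t) by rewrite divr_gt0 // mulr_gt0.
have e2 : 0 < e / 2 by lra.
have [d [Psi [dPsi [bP uP]]]] := main _ e'0.
have uPa s x : 0 < s -> 0 < x -> u s (br a x) <= s * Psi a (x / s).
  by move=> s0 x0; apply: uP => //; exact: ltW.
have := near_origin_barrier (bP a) uPa t0 e2.
apply: filterS => w hw wz; apply: le_trans (hw wz) _.
have -> : t * (- (lam - e / (4 * t)) + e / (4 * t)) = - lam * t + e / 2.
  by field; rewrite gt_eqF.
lra.
Unshelve. all: by end_near. Qed.

(** Information comes from branch [a] alone, the singular term keeping contact away from the origin.
    Once that term is removed, [u] is bounded near the origin on branch [a]; weak continuity along
    [a] bounds [u] at the origin, and weak continuity along [b], read backwards, bounds the other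
    branches. *)
Lemma origin_bound_coercive a : weak_continuity u ->
  (forall q, q <= m a -> lam <= H a q) -> origin_bounded.
Proof.
move=> wc Hr.
have main e : 0 < e -> exists (d : R) (Psi dPsi : R -> R),
    is_barrier (H a) (m a) d (lam - e) e Psi dPsi /\
    forall t x, 0 < t -> 0 < x -> u t (br a x) <= t * Psi (x / t).
  move=> e0.
  have [k [k0 Hk]] : exists k : R, 0 < k /\ forall q, m a <= q -> q <= m a + k ->
      lam - e <= H a q.
    apply: (@filter_ex _ (0 : R)^'+); near=> k; split.
      by near: k; exact: nbhs_right_gt.
    by near: k; apply: right_margin => //; exact: Hr.
  have mk : m a <= m a + k by rewrite lerDl ltW.
  have [Psi [dPsi bP]] := barrier_exists (@Hc a) mk e0 Hk.
  exists (m a + k), Psi, dPsi; split=> // t x t0 x0.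
  apply/ler_addgt0Pr => e' e'0.
  (* With this [kappa] the singular term equals [e'] at the point considered, and [e'] is
     arbitrary. *)
  have kappa0 : 0 < e' * x / t ^+ 2 by rewrite divr_gt0 ?mulr_gt0 ?exprn_gt0.
  have -> : e' = (e' * x / t ^+ 2) * t ^+ 2 / x by field; rewrite !gt_eqF.
  apply: (compare_open usub uinit ubd bP) => //.
  - by have := pm a; lra.
  - exact: ltW.
  - by move=> _ q /Hr; lra.
  - by move=> kE; rewrite kE ltxx in kappa0.
have step t e : 0 < t -> 0 < e -> \forall w \near (t, origin R n),
     0 < coord a w.2 -> u w.1 w.2 <= - lam * t + e.
  move=> t0 e0; have e'0 : 0 < e / (4 * t) by rewrite divr_gt0 // mulr_gt0.
  have e2 : 0 < e / 2 by lra.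
  have [d [Psi [dPsi [bP uP]]]] := main _ e'0.
  have := near_origin_barrier bP uP t0 e2.
  apply: filterS => w hw wz; apply: le_trans (hw wz) _.
  have -> : t * (- (lam - e / (4 * t)) + e / (4 * t)) = - lam * t + e / 2.
    by field; rewrite gt_eqF.
  lra.
have u0 t : 0 < t -> u t (origin R n) <= - lam * t.
  move=> t0; rewrite -lee_fin (wc t t0 a); apply/limf_esup_leP => e e0.
  by have := step t e t0 e0; apply: filterS => w hw; rewrite /= open_branchE.
split=> // b t e t0 e0.
have := u0 t t0; rewrite -lee_fin (wc t t0 b) => /limf_esup_leP/(_ e e0) hw.
have {}hw : \forall w \near (t, origin R n), open_branch b w.2 ->
  u w.1 w.2 <= - lam * t + e by exact: hw.
by apply: filterS hw => w; rewrite open_branchE.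
Unshelve. all: by end_near. Qed.

(** Since [H a c <= lam], a barrier of level [H a c] stays above [- lam t] at the origin, so
    [origin_bounded] provides the boundary data. The lemma serves both for the interval from the
    critical slope to the datum and for single slopes, [c = d]. *)
Lemma branch_bound a (c d t x : R) : origin_bounded -> c <= d -> p ord0 a <= d ->
  (forall q, c <= q -> q <= d -> H a c <= H a q) -> H a c <= lam ->
  0 < t -> 0 < x -> u t (br a x) <= hopf (H a) c d t x.
Proof.
move=> [_ ob] cd pd Hcd Hlam t0 x0.
have [q0 [cq0 q0d hE]] := hopf_attained (@Hc a) cd t x.
apply/ler_addgt0Pr => e e0.
pose y := x / t; have y0 : 0 < y by rewrite divr_gt0.
(* The barrier exceeds its profile by at most [2 * e']; enlarging [d] to [d + k] and lowering the
   level add at most [2 * e'] more. Multiplied by [t] this is [e]. *)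
pose e' := e / (4 * t); have e'0 : 0 < e' by rewrite divr_gt0 // mulr_gt0.
have [k [k0 ky Hk]] : exists k : R, [/\ 0 < k, k * y <= e' & forall q, d <= q ->
    q <= d + k -> H a d - e' <= H a q].
  apply: (@filter_ex _ (0 : R)^'+); near=> k; split.
  - by near: k; exact: nbhs_right_gt.
  - rewrite -ler_pdivlMr //; near: k; apply: nbhs_right_le; by rewrite divr_gt0.
  - by near: k; exact: right_margin.
have dk : c <= d + k by lra.
have Hdk q : c <= q -> q <= d + k -> H a c - e' <= H a q.
  move=> cq qd; have [qd'|/ltW dq] := leP q d; first by have := Hcd q cq qd'; lra.
  by have := Hk q dq qd; have := Hcd d cd (lexx d); lra.
have [Psi [dPsi bP]] := barrier_exists (@Hc a) dk e'0 Hdk.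
have := @compare_open R n H F p u usub uinit ubd a _ _ _ _ _ _ 0 t x bP dk.
rewrite !mul0r addr0 => cmp.
have {}cmp : u t (br a x) <= t * Psi (x / t).
  apply: cmp => //; [by lra|by rewrite ltxx|].
  move=> _ s e1 s0 e10; have := ob a s e1 s0 e10; apply: filterS => w hw wz.
  apply: le_trans (hw wz) _; rewrite lerD2r.
  by rewrite ler_wpM2r ?lerN2 //; lra.
apply: le_trans cmp _.
have y1 : -1 < x / t by apply: lt_trans y0.
have hy : t * hopf (H a) c d 1 y = hopf (H a) c d t x.
  apply/eqP; rewrite eq_le; apply/andP; split.
    have [q [cq qd ->]] := hopf_attained (@Hc a) cd 1 y.
    apply: le_trans (hopf_ge (@Hc a) cd t x cq qd).
    by rewrite /y (_ : t * (q * (x / t) - 1 * H a q) = q * x - t * H a q) //; field; rewrite gt_eqF.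
  rewrite hE; have := hopf_ge (@Hc a) cd 1 y cq0 q0d; rewrite -(ler_pM2l t0).
  by apply: le_trans; rewrite /y (_ : t * (q0 * (x / t) - 1 * H a q0) = q0 * x - t * H a q0) //; field; rewrite gt_eqF.
suff mx : Num.max (hopf (H a) c (d + k) 1 y) (c * y - (H a c - e')) <= hopf (H a) c d 1 y + 2 * e'.
  have Py : Psi (x / t) <= hopf (H a) c d 1 y + 4 * e'.
    by apply: le_trans (barrier_le bP y1) _; rewrite -/y; lra.
  rewrite -(ler_pM2l t0) mulrDr hy in Py; apply: le_trans Py _.
  by rewrite lerD2l le_eqVlt /e'; apply/orP; left; apply/eqP; field; rewrite gt_eqF.
rewrite ge_max; apply/andP; split.
  have [q [cq qd ->]] := hopf_attained (@Hc a) dk 1 y.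
  have [qd'|/ltW dq] := leP q d.
    by have := hopf_ge (@Hc a) cd 1 y cq qd'; lra.
  have := hopf_ge (@Hc a) cd 1 y cd (lexx d); have := Hk q dq qd.
  have : q * y <= (d + k) * y by rewrite ler_pM2r.
  rewrite mulrDl; lra.
have := hopf_ge (@Hc a) cd 1 y (lexx c) cd; lra.
Unshelve. all: by end_near. Qed.

End FullJunction.
(** * The explicit solution *)

Section HopfProperties.
Context (R : realType) (h : R -> R) (c d : R) (hc : continuous h) (cd : c <= d).
Implicit Types (t x y q s : R).

Lemma hopf_slope t x y : x <= y ->
  c * (y - x) <= hopf h c d t y - hopf h c d t x /\
  hopf h c d t y - hopf h c d t x <= d * (y - x).
Proof.
move=> xy; have [q [cq qd qE]] := hopf_attained hc cd t x.
have [q' [cq' q'd q'E]] := hopf_attained hc cd t y.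
have h1 := hopf_ge hc cd t y cq qd; have h2 := hopf_ge hc cd t x cq' q'd.
split; first by rewrite qE; nra.
by rewrite q'E; nra.
Qed.

Lemma hopf_bounded : exists2 B, 0 <= B & forall q, c <= q -> q <= d -> `|h q| <= B.
Proof.
have hw : {within `[c, d], continuous h} by exact: continuous_subspaceT.
have [q1 _ m1] := EVT_max cd hw; have [q2 _ m2] := EVT_min cd hw.
exists (`|h q1| + `|h q2|); first exact: addr_ge0.
move=> q cq qd; have qI : q \in `[c, d] by rewrite in_itv /= cq.
have := m1 q qI; have := m2 q qI.
have := ler_norm (h q1); have := ler_norm (- h q2); have := normr_ge0 (h q1).
have := normr_ge0 (h q2).
by rewrite normrN ler_norml; lra.
Qed.

Lemma hopf_lipschitz : exists2 D, 0 < D & forall t x t' x',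
  `|hopf h c d t x - hopf h c d t' x'| <= D * (`|t - t'| + `|x - x'|).
Proof.
have [B B0 HB] := hopf_bounded.
exists (B + `|c| + `|d| + 1).
  by have := normr_ge0 c; have := normr_ge0 d; lra.
have half t x t' x' : hopf h c d t x - hopf h c d t' x' <=
    (B + `|c| + `|d| + 1) * (`|t - t'| + `|x - x'|).
  have [q [cq qd ->]] := hopf_attained hc cd t x.
  have := hopf_ge hc cd t' x' cq qd.
  have h1 : q * (x - x') <= (`|c| + `|d|) * `|x - x'|.
    apply: le_trans (ler_norm _) _; rewrite normrM ler_wpM2r //.
    have := ler_norm d; have := ler_norm (- c); have := normr_ge0 c; have := normr_ge0 d.
    by rewrite normrN ler_norml; lra.
  have h2 : - h q * (t - t') <= B * `|t - t'|.
    by apply: le_trans (ler_norm _) _; rewrite normrM normrN ler_wpM2r // HB.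
  have := normr_ge0 (t - t'); have := normr_ge0 (x - x').
  have := mulr_ge0 (addr_ge0 (normr_ge0 c) (normr_ge0 d)) (normr_ge0 (t - t')).
  have := mulr_ge0 B0 (normr_ge0 (x - x')).
  lra.
by move=> t x t' x'; rewrite ler_norml half andbT lerNl opprB distrC (distrC x) half.
Qed.

Lemma hopf_continuous t x : {for (t, x), continuous (fun w : R * R => hopf h c d w.1 w.2)}.
Proof.
have [D D0 HD] := hopf_lipschitz.
apply/cvgrPdist_le => e e0 /=.
have eD : 0 < e / (2 * D) by rewrite divr_gt0 // mulr_gt0.
near=> w; apply: le_trans (HD _ _ _ _) _.
have h1 : `|t - w.1| <= e / (2 * D).
  by near: w; apply: cvgr_dist_le => //; exact: cvg_fst.
have h2 : `|x - w.2| <= e / (2 * D).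
  by near: w; apply: cvgr_dist_le => //; exact: cvg_snd.
have -> : e = D * (e / (2 * D) + e / (2 * D)) by field; rewrite gt_eqF.
by rewrite ler_pM2l // lerD.
Unshelve. all: by end_near. Qed.

Lemma hopf_time0 x : 0 <= x -> hopf h c d 0 x = d * x.
Proof.
move=> x0; apply/eqP; rewrite eq_le; apply/andP; split.
  have [q [cq qd ->]] := hopf_attained hc cd 0 x.
  by rewrite mul0r subr0 ler_wpM2r.
by have := hopf_ge hc cd 0 x cd (lexx d); rewrite mul0r subr0.
Qed.

Lemma hopf_scale s t x : 0 < s -> hopf h c d (s * t) (s * x) = s * hopf h c d t x.
Proof.
move=> s0; apply/eqP; rewrite eq_le; apply/andP; split.
  have [q [cq qd ->]] := hopf_attained hc cd (s * t) (s * x).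
  have := hopf_ge hc cd t x cq qd; rewrite -(ler_pM2l s0); lra.
have [q [cq qd ->]] := hopf_attained hc cd t x.
by have := hopf_ge hc cd (s * t) (s * x) cq qd; lra.
Qed.

Context (hmin : forall q, c <= q -> q <= d -> h c <= h q).

Lemma hopf_space0 t : 0 <= t -> hopf h c d t 0 = - (h c * t).
Proof.
move=> t0; apply/eqP; rewrite eq_le; apply/andP; split.
  have [q [cq qd ->]] := hopf_attained hc cd t 0.
  have := hmin cq qd; nra.
by have := hopf_ge hc cd t 0 (lexx c) cd; rewrite mulr0 sub0r mulrC.
Qed.

(** By compactness, slopes at least [c + e] have [h] larger than [h c] by some [g > 0]. Their gain
    [(q - c) x] is below [t g] for small [x], so they do not beat the slope [c]. *)
Lemma hopf_deriv0 t e : (forall q, c < q -> q <= d -> h c < h q) ->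
  0 < t -> 0 < e -> exists2 r, 0 < r & forall x, 0 <= x -> x < r ->
    c * x <= hopf h c d t x - hopf h c d t 0 /\
    hopf h c d t x - hopf h c d t 0 <= (c + e) * x.
Proof.
move=> hlt t0 e0.
have [g g0 Hg] : exists2 g, 0 < g & forall q, c + e <= q -> q <= d -> h c + g <= h q.
  have [ced|dce] := leP (c + e) d; last by exists 1 => // q q1 q2; lra.
  have hw : {within `[c + e, d], continuous h} by exact: continuous_subspaceT.
  have [q1] := EVT_min ced hw; rewrite in_itv /= => /andP[q1c q1d] m1.
  exists (h q1 - h c); first by rewrite subr_gt0 hlt //; lra.
  by move=> q cq qd; rewrite addrC subrK m1 // in_itv /= cq.
have D0 : 0 < `|d - c| + 1 by rewrite ltr_wpDl.
exists (t * g / (`|d - c| + 1)); first by rewrite divr_gt0 // mulr_gt0.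
move=> x x0; rewrite ltr_pdivlMr // => xr; rewrite hopf_space0 ?(ltW t0) //; split.
  by have := hopf_ge hc cd t x (lexx c) cd; lra.
have [q [cq qd ->]] := hopf_attained hc cd t x.
have [qe|/ltW qe] := leP (c + e) q; last first.
  have : q * x <= (c + e) * x by rewrite ler_wpM2r.
  have := hmin cq qd; nra.
have h1 := Hg q qe qd.
have h2 : (q - c) * x <= t * g.
  apply: le_trans (ltW xr); rewrite mulrC ler_wpM2l //.
  by have := ler_norm (d - c); lra.
have h3 : 0 <= e * x by rewrite mulr_ge0 // ltW.
have h4 : t * (h c + g) <= t * h q by rewrite ler_pM2l.
lra.
Qed.

End HopfProperties.

Section OneSided.
Context (R : realType).

(** Only a step to the right is taken, so this applies at the origin; contact there constrains
    slopes from this side only. *)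
Lemma hderiv_ge (f : halfline R -> R) (x : halfline R) (l k : R) :
  has_hderiv f x l ->
  (\forall y \near x, hval x <= hval y -> k * (hval y - hval x) <= f y - f x) ->
  k <= l.
Proof.
move=> /has_hderivP fl /near_halfP[d d0 dP]; apply/ler_addgt0Pr => e e0.
have [d' d'0 d'P] := fl e e0; have x0 := hval_ge0 x.
pose r := Num.min d d' / 2.
have m0 : 0 < Num.min d d' by rewrite lt_min d0.
have r0 : 0 < r by rewrite divr_gt0.
have [rd rd'] : r < d /\ r < d'.
  have : Num.min d d' <= d /\ Num.min d d' <= d' by rewrite !ge_min !lexx orbT.
  by rewrite /r; lra.
have hE : hval (hl (hval x + r)) = hval x + r by rewrite hval_hl //; lra.
have := dP (hl (hval x + r)); have := d'P (hl (hval x + r)); rewrite hE.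
rewrite (_ : hval x + r - hval x = r); last by ring.
rewrite gtr0_norm // => /(_ rd') + /(_ rd) h1; have {}h1 : k * r <= f (hl (hval x + r)) - f x.
  by apply: h1; lra.
rewrite ler_norml => /andP[_ h2].
by rewrite -(ler_pM2r r0) mulrDl; lra.
Qed.

Lemma hderiv_le (f : halfline R -> R) (x : halfline R) (l k : R) : 0 < hval x ->
  has_hderiv f x l ->
  (\forall y \near x, hval y <= hval x -> k * (hval y - hval x) <= f y - f x) ->
  l <= k.
Proof.
move=> x0 /has_hderivP fl /near_halfP[d d0 dP]; apply/ler_addgt0Pr => e e0.
have [d' d'0 d'P] := fl e e0.
pose r := Num.min (hval x) (Num.min d d') / 2.
have m0 : 0 < Num.min (hval x) (Num.min d d') by rewrite !lt_min x0 d0.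
have r0 : 0 < r by rewrite divr_gt0.
have [rx rd rd'] : [/\ r < hval x, r < d & r < d'].
  have [h1 h2 h3] : [/\ Num.min (hval x) (Num.min d d') <= hval x,
     Num.min (hval x) (Num.min d d') <= d & Num.min (hval x) (Num.min d d') <= d'].
    by rewrite !ge_min !lexx !orbT.
  by rewrite /r; split; lra.
have hE : hval (hl (hval x - r)) = hval x - r by rewrite hval_hl //; lra.
have := dP (hl (hval x - r)); have := d'P (hl (hval x - r)); rewrite hE.
rewrite (_ : hval x - r - hval x = - r); last by ring.
rewrite normrN gtr0_norm // => /(_ rd') + /(_ rd) h1.
have {}h1 : k * - r <= f (hl (hval x - r)) - f x by apply: h1; lra.
rewrite ler_norml => /andP[_ h2].
by rewrite -(ler_pM2r r0) mulrDl; lra.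
Qed.

Lemma derive_touch (f : R -> R) (y l k : R) : is_derive y 1 f l ->
  (\forall z \near y, k * (z - y) <= f z - f y) -> l = k.
Proof.
move=> /is_derive1P fl /nbhs_ballP[d /= d0 dP].
suff H : forall e, 0 < e -> l <= k + e /\ k <= l + e.
  by apply/eqP; rewrite eq_le; apply/andP; split; apply/ler_addgt0Pr => e /H[].
move=> e e0; have [d' d'0 d'P] := fl e e0.
pose r := Num.min d d' / 2.
have m0 : 0 < Num.min d d' by rewrite lt_min d0.
have r0 : 0 < r by rewrite divr_gt0.
have [rd rd'] : r < d /\ r < d'.
  have : Num.min d d' <= d /\ Num.min d d' <= d' by rewrite !ge_min !lexx orbT.
  by rewrite /r; lra.
have nr : `|r| = r by rewrite gtr0_norm.
have E1 : y - r - y = - r by ring.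
have E2 : y + r - y = r by ring.
have F1 : y - (y - r) = r by ring.
have F2 : y - (y + r) = - r by ring.
have := dP (y - r); have := d'P (y - r); rewrite /ball /= E1 F1 normrN nr.
move=> /(_ rd') + /(_ rd); rewrite ler_norml => /andP[h1 h2] h3.
have := dP (y + r); have := d'P (y + r); rewrite /ball /= E2 F2 normrN nr.
move=> /(_ rd') + /(_ rd); rewrite ler_norml => /andP[h1' h2'] h3'.
by split; rewrite -(ler_pM2r r0) mulrDl; lra.
Qed.

End OneSided.

Section WaveSubsolution.
Context (R : realType) (n : nat) (H : 'I_n.+1 -> R -> R) (F : 'rV[R]_n.+1 -> R).
Context (p ph : 'rV[R]_n.+1) (lam : R).
Context (Hc : forall a, continuous (H a)).
Implicit Types (t x y : R) (a b : 'I_n.+1).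

(** Infima are written through the dual Hamiltonian, so that the facts on [hopf] serve both shapes.
    Here [q] is the slope of the datum and [qh] the slope at 0; for [q = qh] the two formulas
    agree. *)
Definition wave (h : R -> R) (q qh t x : R) : R :=
  if qh <= q then hopf h qh q t x
  else - hopf (fun r => - h (- r)) (- qh) (- q) t x.

(** What the explicit solution uses of [hat]. The strict inequalities make [qh] the exact slope at
    0, and duality exchanges the two alternatives. *)
Definition wave_profile (h : R -> R) (q qh : R) : Prop :=
  h qh = lam /\
  ((qh <= q /\ forall r, qh < r -> r <= q -> lam < h r) \/
   (q <= qh /\ forall r, q <= r -> r < qh -> h r < lam)).

(** With [|t|] the branches share the value [- lam * |t|] at 0 for every real [t], so gluing and
    continuity hold across time 0 as well. *)
Definition riemann_wave t (z : junction R n) : R :=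
  jfun (fun a t x => wave (H a) (p ord0 a) (ph ord0 a) `|t| x) t z.

Lemma opp_cont (h : R -> R) : continuous h -> continuous (fun r => - h (- r)).
Proof.
move=> hc r; apply: cvgN; apply: (@cvg_comp _ _ _ (fun r => - r) h).
  by apply: cvgN; exact: cvg_id.
exact: hc.
Qed.

Lemma wave_concave (h : R -> R) (q qh t x : R) : q <= qh ->
  wave h q qh t x = - hopf (fun r => - h (- r)) (- qh) (- q) t x.
Proof.
rewrite /wave le_eqVlt => /orP[/eqP ->|qqh]; last by rewrite leNgt qqh.
rewrite lexx.
have E (g : R -> R) r : hopf g r r t x = r * x - t * g r.
  by rewrite /hopf set_itv1 image_set1 sup1.
by rewrite !E opprK; ring.
Qed.

(** In both alternatives the slope at 0 becomes the left end of the interval and the strict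
    minimiser of the Hamiltonian inside [hopf], the form in which the lemmas on [hopf] are
    stated. *)
Lemma wave_cases (h : R -> R) (q qh : R) : wave_profile h q qh ->
  (qh <= q /\ (forall r, qh < r -> r <= q -> h qh < h r)) \/
  (- qh <= - q /\ (forall r, - qh < r -> r <= - q -> - h (- - qh) < - h (- r)) /\
   forall t x, wave h q qh t x = - hopf (fun r => - h (- r)) (- qh) (- q) t x).
Proof.
move=> [<- [[qq hq]|[qq hq]]]; [by left|right]; split; first by rewrite lerN2.
split=> [r r1 r2|t x]; last exact: wave_concave.
by rewrite opprK ltrN2; apply: hq; lra.
Qed.

Lemma lt_le_min (h : R -> R) (c d : R) :
  (forall r, c < r -> r <= d -> h c < h r) -> forall r, c <= r -> r <= d -> h c <= h r.
Proof.
move=> hlt r; rewrite le_eqVlt => /orP[/eqP -> //|cr] rd; exact/ltW/hlt.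
Qed.

Section Branch.
Context (h : R -> R) (q qh : R) (hc : continuous h) (prof : wave_profile h q qh).

Lemma wave_continuous t x : {for (t, x), continuous (fun w : R * R => wave h q qh `|w.1| w.2)}.
Proof.
have ca : (fun w : R * R => (`|w.1|, w.2)) w @[w --> (t, x)] --> (`|t|, x).
  apply: (@cvg_pair _ _ _ (nbhs (t, x)) (nbhs `|t|) (nbhs x)); last exact: cvg_snd.
  by apply: cvg_norm; exact: cvg_fst.
case: (wave_cases prof) => [[qq _]|[qq [_ E]]].
  have -> : (fun w : R * R => wave h q qh `|w.1| w.2) =
      (fun w => hopf h qh q w.1 w.2) \o (fun w : R * R => (`|w.1|, w.2)).
    by apply/funext => w; rewrite /wave qq.
  by apply: (@cvg_comp _ _ _ _ _ _ _ _ ca); exact: hopf_continuous.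
have -> : (fun w : R * R => wave h q qh `|w.1| w.2) =
    (fun w => - hopf (fun r => - h (- r)) (- qh) (- q) w.1 w.2) \o
    (fun w : R * R => (`|w.1|, w.2)).
  by apply/funext => w; rewrite E.
apply: (@cvg_comp _ _ _ _ _ _ _ _ ca); apply: cvgN.
by apply: hopf_continuous => //; exact: opp_cont.
Qed.

Lemma wave_time0 x : 0 <= x -> wave h q qh 0 x = q * x.
Proof.
move=> x0; case: (wave_cases prof) => [[qq _]|[qq [_ ->]]].
  by rewrite /wave qq hopf_time0.
by rewrite hopf_time0 //; [rewrite mulNr opprK|exact: opp_cont].
Qed.

Lemma wave_space0 t : 0 <= t -> wave h q qh t 0 = - lam * t.
Proof.
move=> t0; have [hq _] := prof; case: (wave_cases prof) => [[qq hlt]|[qq [hlt ->]]].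
  by rewrite /wave qq (hopf_space0 hc qq (lt_le_min hlt) t0) hq mulNr.
have hmin := @lt_le_min (fun r => - h (- r)) (- qh) (- q) hlt.
by rewrite (hopf_space0 (opp_cont hc) qq hmin t0) !opprK hq.
Qed.

Lemma wave_deriv0 t e : 0 < t -> 0 < e -> exists2 r, 0 < r & forall x, 0 <= x -> x < r ->
  `|wave h q qh t x - wave h q qh t 0 - qh * x| <= e * x.
Proof.
move=> t0 e0; case: (wave_cases prof) => [[qq hlt]|[qq [hlt E]]].
  have [r r0 rP] := hopf_deriv0 hc qq (lt_le_min hlt) hlt t0 e0.
  exists r => // x x0 xr; rewrite /wave qq; have [h1 h2] := rP x x0 xr.
  have := mulr_ge0 (ltW e0) x0.
  by rewrite ler_norml; lra.
have hmin := @lt_le_min (fun r => - h (- r)) (- qh) (- q) hlt.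
have [r r0 rP] := hopf_deriv0 (opp_cont hc) qq hmin hlt t0 e0.
exists r => // x x0 xr; rewrite !E; have [h1 h2] := rP x x0 xr.
have := mulr_ge0 (ltW e0) x0.
by rewrite ler_norml; lra.
Qed.

Lemma wave_bounded : exists M, forall t x, 0 <= t -> 0 <= x ->
  `|wave h q qh t x - q * x| <= M * t.
Proof.
case: (wave_cases prof) => [[qq _]|[qq [_ E]]].
  have [D D0 HD] := hopf_lipschitz hc qq; exists D => t x t0 x0.
  have := HD t x 0 x; rewrite subrr normr0 addr0 subr0 (ger0_norm t0) /wave qq.
  by rewrite (hopf_time0 hc qq x0).
have [D D0 HD] := hopf_lipschitz (opp_cont hc) qq; exists D => t x t0 x0.
have := HD t x 0 x; rewrite subrr normr0 addr0 subr0 (ger0_norm t0) E.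
rewrite (hopf_time0 (opp_cont hc) qq x0) -normrN.
by rewrite (_ : - (_ - _) = - hopf (fun r => - h (- r)) (- qh) (- q) t x - q * x) //; ring.
Qed.

End Branch.
End WaveSubsolution.
Lemma usc_env_continuous (R : realType) (n : nat) (u : R -> junction R n -> R) (t : R) z :
  {for (t, z), continuous (fun w : R * junction R n => u w.1 w.2)} -> 0 <= t ->
  usc_env u t z = (u t z)%:E.
Proof.
move=> /cvgrPdist_le uc t0; apply/eqP; rewrite eq_le; apply/andP; split.
  apply/limf_esup_leP => e e0; have ue := uc e e0.
  have {}ue : \forall w \near (t, z), 0 <= w.1 -> `|u t z - u w.1 w.2| <= e.
    by apply: filterS ue => w /= h _.
  have {}ue : \forall w \near nbhs_dom t z, `|u t z - u w.1 w.2| <= e by exact: ue.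
  by apply: filterS ue => w; rewrite ler_norml => /andP[]; lra.
apply/limf_esup_geP => e e0 He.
have {}He : \forall w \near (t, z), 0 <= w.1 -> u w.1 w.2 <= u t z - e by exact: He.
by have := nbhs_singleton He t0 => /=; lra.
Qed.

Section RiemannWave.
Context (R : realType) (n : nat) (H : 'I_n.+1 -> R -> R) (F : 'rV[R]_n.+1 -> R).
Context (p ph : 'rV[R]_n.+1) (lam : R).
Context (Hc : forall a, continuous (H a)).
Context (prof : forall a, wave_profile lam (H a) (p ord0 a) (ph ord0 a)).
Implicit Types (t y : R) (a b : 'I_n.+1).
Local Notation w := (riemann_wave H p ph).
Local Notation wb a := (wave (H a) (p ord0 a) (ph ord0 a)).

Lemma riemann_wave_br a t (x : R) : 0 <= x -> w t (br a x) = wb a `|t| x.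
Proof.
move=> x0; rewrite /riemann_wave jfun_br // => b c.
by rewrite (wave_space0 (@Hc b) (prof b)) // (wave_space0 (@Hc c) (prof c)).
Qed.

Lemma riemann_wave_continuous t z :
  {for (t, z), continuous (fun v : R * junction R n => w v.1 v.2)}.
Proof.
apply: jfun_continuous.
  near=> s; move=> b c.
  by rewrite (wave_space0 (@Hc b) (prof b)) // (wave_space0 (@Hc c) (prof c)).
by move=> a x _; exact: wave_continuous.
Unshelve. all: by end_near. Qed.

Lemma riemann_wave0 z : w 0 z = riemann_datum p z.
Proof.
have [a [x [x0 ->]]] := brP z.
by rewrite riemann_wave_br // normr0 riemann_br // (wave_time0 (@Hc a) (prof a)).
Qed.

Lemma riemann_wave_origin t : 0 <= t -> w t (origin R n) = - lam * t.
Proof.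
move=> t0; rewrite -(br0 R ord0) riemann_wave_br // ger0_norm //.
exact: (wave_space0 (@Hc _) (prof _)).
Qed.

Lemma riemann_wave_hderiv a t : 0 < t ->
  has_hderiv (fun x => w t (branch a x)) (halfline0 R) (ph ord0 a).
Proof.
move=> t0; have h0 : hval (halfline0 R) = 0 by rewrite -hl0 hval_hl.
apply/has_hderivP => e e0.
have [r r0 rP] := wave_deriv0 (@Hc a) (prof a) t0 e0.
exists r => // y; rewrite h0 !subr0 (ger0_norm (hval_ge0 y)) => yr.
rewrite !branch_br !riemann_wave_br ?hval_ge0 // h0 (gtr0_norm t0).
exact: rP (hval_ge0 y) yr.
Qed.

Lemma riemann_wave_distance : bounded_distance (riemann_datum p) w.
Proof.
move=> T T0.
have /choice[M HM] : forall a, exists M, forall t x, 0 <= t -> 0 <= x ->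
    `|wb a t x - p ord0 a * x| <= M * t.
  by move=> a; exact: (wave_bounded (@Hc a) (prof a)).
exists (\sum_a `|M a| * T) => t z t0 tT; have [a [x [x0 ->]]] := brP z.
rewrite riemann_wave_br // riemann_br // (ger0_norm t0).
apply: le_trans (HM a t x t0 x0) _; apply: (@le_trans _ _ (`|M a| * T)).
  apply: (@le_trans _ _ (`|M a| * t)); first by rewrite ler_wpM2r // ler_norm.
  by rewrite ler_wpM2l // ltW.
by rewrite (bigD1 a) //= lerDl sumr_ge0 // => b _; rewrite mulr_ge0 // ltW.
Qed.

Lemma riemann_wave_weak_continuity : weak_continuity w.
Proof.
move=> t t0 a.
have wc := @riemann_wave_continuous t (origin R n).
apply/eqP; rewrite eq_le; apply/andP; split; last first.
  apply/limf_esup_leP => e e0; have /cvgrPdist_le/(_ e e0) we := wc.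
  have {}we : \forall v \near (t, origin R n), open_branch a v.2 ->
    `|w t (origin R n) - w v.1 v.2| <= e by apply: filterS we => v /= h _.
  have {}we : \forall v \near within [set v | open_branch a v.2] (nbhs (t, origin R n)),
    `|w t (origin R n) - w v.1 v.2| <= e by exact: we.
  by apply: filterS we => v; rewrite ler_norml => /andP[]; lra.
apply/limf_esup_geP => e e0 He.
have {}He : \forall v \near (t, origin R n), open_branch a v.2 ->
  w v.1 v.2 <= w t (origin R n) - e by exact: He.
have e2 : 0 < e / 2 by lra.
have /cvgrPdist_le/(_ _ e2) we := wc.
have HH : \forall v \near (t, origin R n), `|w t (origin R n) - w v.1 v.2| <= e / 2 /\
    (open_branch a v.2 -> w v.1 v.2 <= w t (origin R n) - e) by exact: filterI.
have bc : (fun y : R => (t, br a y)) y @[y --> (0 : R)] --> (t, origin R n).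
  rewrite -(br0 R a); apply: (@cvg_pair _ _ _ (nbhs (0 : R)) (nbhs t) (nbhs (br a 0))).
    exact: cvg_cst.
  exact: br_continuous.
have {}HH : \forall y \near (0 : R), `|w t (origin R n) - w t (br a y)| <= e / 2 /\
    (open_branch a (br a y) -> w t (br a y) <= w t (origin R n) - e) by exact: (bc _ HH).
have [r /= r0 rP] := iffLR (nbhs_ballP _ _) HH.
have rr : ball 0 r (r / 2) by rewrite /ball /= sub0r normrN gtr0_norm; lra.
have [h1 h2] := rP _ rr.
have : open_branch a (br a (r / 2)).
  by rewrite open_branchE /= coord_br ?eqxx; lra.
move=> /h2; move: h1; rewrite ler_norml => /andP[]; lra.
Qed.

(* Only the inequality along the ray through the touching point is needed, so a
   one-sided chain rule for C^1 functions suffices. *)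
Lemma ray_touch (phi : R -> junction R n -> R) (W : R -> R -> R) a t (x : halfline R) (w0 : R) :
  test_function phi -> 0 < t -> 0 < hval x -> phi t (branch a x) = w0 ->
  (forall s, 0 < s -> s < 1 -> W (s * t) (s * hval x) = s * w0) ->
  (\forall v \near (t, hval x), W v.1 v.2 <= phi v.1 (br a v.2)) ->
  dt phi t (branch a x) * t + dx phi a t x * hval x <= w0.
Proof.
move=> [_ tst] t0 x0 phi0 Ws near1; rewrite leNgt; apply/negP => gt0.
set A := dt phi t (branch a x) in gt0; set B := dx phi a t x in gt0.
set X := hval x in x0 gt0 Ws near1.
have tX : 0 < t + X by lra.
(* Over a fraction [th] of the ray the errors in time and space add up to [th * e * (t + X)], half
   of [th] times the excess assumed for contradiction. *)
pose e := (A * t + B * X - w0) / (2 * (t + X)).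
have e0 : 0 < e by rewrite divr_gt0 ?mulr_gt0 //; lra.
have eE : e * (t + X) = (A * t + B * X - w0) / 2 by rewrite /e; field; rewrite gt_eqF.
have [_ dB cA _] := tst a t x t0.
have /has_hderivP/(_ e e0)[d d0 dP] : has_hderiv (fun y : halfline R => phi t (branch a y)) x B by [].
have near2 : \forall v \near (t, X), A - e <= dt phi v.1 (br a v.2).
  have /cvgrPdist_le/(_ e e0) := cA => ne.
  have := cvg_map_snd t (@hl_continuous R X); rewrite hl_hval => cv.
  have {}ne : \forall v \near (t, X), `|A - dt phi v.1 (branch a (hl v.2))| <= e.
    exact: (cv _ ne).
  by apply: filterS ne => v; rewrite ler_norml => /andP[]; rewrite /br; lra.
have : \forall v \near (t, X), [/\ W v.1 v.2 <= phi v.1 (br a v.2) &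
  A - e <= dt phi v.1 (br a v.2)].
  by near=> v; split; near: v.
move=> /nbhs_ballP[r /= r0 rP].
pose m := Num.min (Num.min 1 (r / (t + X))) (d / X).
have m0 : 0 < m by rewrite !lt_min ltr01 !divr_gt0.
pose th := m / 2; have th0 : 0 < th by rewrite divr_gt0.
have [m1 m2 m3] : [/\ m <= 1, m <= r / (t + X) & m <= d / X].
  by rewrite /m !ge_min !lexx !orbT.
have th1 : th < 1 by rewrite /th; lra.
have thr : th * (t + X) < r.
  by rewrite -ltr_pdivlMr //; apply: lt_le_trans m2; rewrite /th; lra.
have thd : th * X < d.
  by rewrite -ltr_pdivlMr //; apply: lt_le_trans m3; rewrite /th; lra.
have ht0 : 0 < th * t by rewrite mulr_gt0.
have hX0 : 0 < th * X by rewrite mulr_gt0.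
pose s := 1 - th; pose y := s * X; pose t1 := s * t.
have s0 : 0 < s by rewrite /s; lra.
have y0 : 0 < y by rewrite mulr_gt0.
have t10 : 0 < t1 by rewrite mulr_gt0.
have t1t : t1 < t by rewrite /t1 /s; lra.
have yE : hval (hl y) = y by rewrite hval_hl // ltW.
have inball tau : t1 <= tau -> tau <= t -> ball (t, X) r (tau, y).
  move=> h1 h2; split; rewrite /ball /= ger0_norm ?subr_ge0 //.
  - by apply: le_lt_trans thr; move: h1; rewrite /t1 /s; lra.
  - by apply: le_lt_trans thr; rewrite /y /s; lra.
  - by rewrite /y /s; lra.
have dphi tau : tau \in `]t1, t[ -> is_derive tau 1 (phi ^~ (br a y)) (dt phi tau (br a y)).
  rewrite in_itv /= => /andP[h1 h2]; have tau0 : 0 < tau by lra.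
  have [dd _ _ _] := tst a tau (hl y) tau0.
  by split => //; rewrite /dt derive1E.
have cphi : {within `[t1, t], continuous (phi ^~ (br a y))}.
  apply: derivable_within_continuous => tau; rewrite in_itv /= => /andP[h1 h2].
  have tau0 : 0 < tau by lra.
  by have [dd _ _ _] := tst a tau (hl y) tau0.
(* The step along the ray is split: in space at time [t], by the expansion [dP], and in time at
   abscissa [y], by the mean value theorem with [dt phi] close to [A]. *)
have [tau] := MVT t1t dphi cphi; rewrite in_itv /= => /andP[h1 h2] E.
have [_ h3] := rP _ (inball tau (ltW h1) (ltW h2)).
have [h4 _] := rP _ (inball t1 (lexx _) (ltW t1t)).
have h5 : (A - e) * (th * t) <= dt phi tau (br a y) * (t - t1).
  have -> : t - t1 = th * t by rewrite /t1 /s; ring.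
  by rewrite ler_pM2r.
have := dP (hl y); rewrite yE -/X.
have -> : y - X = - (th * X) by rewrite /y /s; ring.
rewrite normrN (gtr0_norm hX0) => /(_ thd); rewrite ler_norml phi0 => /andP[_ h6].
have h7 : W t1 y = s * w0 by apply: Ws; rewrite // /s; lra.
rewrite /= h7 in h4.
have h8 : th * (e * (t + X)) = th * ((A * t + B * X - w0) / 2) by rewrite eE.
have h9 : 0 < th * (A * t + B * X - w0) by rewrite mulr_gt0 // subr_gt0.
have sE : s = 1 - th by [].
move: h4 h6 h5 E; rewrite -/(br a y) sE => h4 h6 h5 E.
lra.
Unshelve. all: by end_near. Qed.

(** The hypothesis is the junction inequality for slopes at least [ph], the only ones a test
    function touching from above at the origin can have. *)
Lemma riemann_wave_sub :
  (forall q : 'rV[R]_n.+1, (forall a, ph ord0 a <= q ord0 a) -> Num.min (F q) (Hmin H q) <= lam) ->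
  weak_sub H F w.
Proof.
move=> S1.
have envE t z : 0 <= t -> usc_env w t z = (w t z)%:E.
  by move=> t0; apply: usc_env_continuous => //; exact: riemann_wave_continuous.
split=> [t z t0|phi t tst t0].
  exists (w t z + 1); have /cvgrPdist_le/(_ _ ltr01) we := @riemann_wave_continuous t z.
  have K : \forall v \near (t, z), 0 <= v.1 -> (usc_env w v.1 v.2 <= (w t z + 1)%:E)%E.
    apply: filterS we => v /= + v0; rewrite envE // lee_fin ler_norml => /andP[]; lra.
  exact: K.
have touch z : touches_from_above phi (usc_env w) t z ->
    phi t z = w t z /\ \forall v \near (t, z), w v.1 v.2 <= phi v.1 v.2.
  move=> [e1 e2]; split; first by move: e1; rewrite envE ?(ltW t0) // => -[].
  have n0 : \forall v \near (t, z), 0 < v.1.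
    exact: (@cvg_fst _ _ (nbhs t) (nbhs z) _ [set s | 0 < s] (lt_nbhsr t0)).
  near=> v; have v0 : 0 < v.1 by near: v.
  rewrite -lee_fin -envE ?(ltW v0) //; near: v; exact: e2.
have dtP z : is_derive t 1 (phi ^~ z) (dt phi t z).
  have [a [x [x0 ->]]] := brP z; have [_ tst'] := tst.
  by have [d _ _ _] := tst' a t (hl x) t0; split=> //; rewrite /dt derive1E.
have dxP a (x : halfline R) : has_hderiv (fun y : halfline R => phi t (branch a y)) x (dx phi a t x).
  by have [_ tst'] := tst; have [_ d _ _] := tst' a t x t0.
have near_t z : (\forall v \near (t, z), w v.1 v.2 <= phi v.1 v.2) ->
    \forall s \near t, w s z <= phi s z.
  move=> hn; have cz : (fun s : R => (s, z)) s @[s --> t] --> (t, z).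
    by apply: (@cvg_pair _ _ _ (nbhs t) (nbhs t) (nbhs z)); [exact: cvg_id|exact: cvg_cst].
  exact: (cz _ hn).
have near_x a (x : halfline R) : (\forall v \near (t, branch a x), w v.1 v.2 <= phi v.1 v.2) ->
    \forall y \near (x : halfline R), wb a t (hval y) <= phi t (branch a y).
  move=> hn; have cz : (fun y : halfline R => (t, branch a y)) y @[y --> x] --> (t, branch a x).
    apply: (@cvg_pair _ _ _ (nbhs x) (nbhs t) (nbhs (branch a x))); first exact: cvg_cst.
    exact: wedge_lift_continuous.
  have : \forall y \near (x : halfline R), w t (branch a y) <= phi t (branch a y) by exact: (cz _ hn).
  by apply: filterS => y; rewrite {1}branch_br riemann_wave_br ?hval_ge0 // gtr0_norm.
split=> [a x x0 /touch[phiE hn]|/touch[phiE hn]].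
  rewrite branch_br riemann_wave_br ?(ltW x0) // gtr0_norm // -branch_br in phiE.
  have nx := near_x a x hn; have nt := near_t _ hn.
  case: (wave_cases (prof a)) => [[pq hlt]|[pq [hlt E]]].
    have WE s y : wb a s y = hopf (H a) (ph ord0 a) (p ord0 a) s y by rewrite /wave pq.
    (* The affine solution of an active slope [q] lies below the wave with equality at the point, so
       [phi] touches it from above and inherits its derivatives. *)
    have [q [cq qd qE]] := hopf_attained (@Hc a) pq t (hval x).
    have -> : dt phi t (branch a x) = - H a q.
      apply: (derive_touch (dtP _)); near=> s.
      have s0 : 0 < s by near: s; exact: lt_nbhsr.
      have : w s (branch a x) <= phi s (branch a x) by near: s.
      rewrite {1}branch_br riemann_wave_br ?(ltW x0) // gtr0_norm // phiE !WE qE.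
      by have := hopf_ge (@Hc a) pq s (hval x) cq qd; lra.
    have -> : dx phi a t x = q.
      apply/eqP; rewrite eq_le; apply/andP; split.
        apply: (hderiv_le x0 (dxP a x)); apply: filterS nx => y; rewrite phiE !WE qE => hy _.
        by have := hopf_ge (@Hc a) pq t (hval y) cq qd; lra.
      apply: (hderiv_ge (dxP a x)); apply: filterS nx => y; rewrite phiE !WE qE => hy _.
      by have := hopf_ge (@Hc a) pq t (hval y) cq qd; lra.
    by lra.
  (* On an infimum branch the slope [q] of [phi] lies in [[p, ph]], so [q x - t H(q)] bounds the
     wave from above, while the ray estimate bounds [t phi_t + x q] by the wave. Subtracting gives
     the inequality. *)
  have hc := opp_cont (@Hc a).
  have b1 : p ord0 a <= dx phi a t x.
    apply: (hderiv_ge (dxP a x)); apply: filterS nx => y; rewrite phiE !E => hy xy.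
    by have [] := hopf_slope hc pq t xy; lra.
  have b2 : dx phi a t x <= ph ord0 a.
    apply: (hderiv_le x0 (dxP a x)); apply: filterS nx => y; rewrite phiE !E => hy yx.
    by have [] := hopf_slope hc pq t yx; lra.
  have ray : dt phi t (branch a x) * t + dx phi a t x * hval x <= wb a t (hval x).
    apply: (@ray_touch phi (fun s y => wb a `|s| y) a t x) => //.
      move=> s s0 _; rewrite !E normrM (gtr0_norm s0) (gtr0_norm t0).
      by rewrite (hopf_scale hc pq) // mulrN.
    have := cvg_map_snd t (@br_continuous R n a (hval x)).
    rewrite -branch_br => cv.
    have : \forall v \near (t, hval x), w v.1 (br a v.2) <= phi v.1 (br a v.2) by exact: (cv _ hn).
    have vx : \forall v \near (t, hval x), 0 < v.2.
      exact: (@cvg_snd _ _ (nbhs t) (nbhs (hval x)) _ [set s | 0 < s] (lt_nbhsr x0)).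
    move=> hv; near=> v; have v0 : 0 < v.2 by near: v.
    by rewrite -riemann_wave_br ?(ltW v0) //; near: v.
  have pq1 : - ph ord0 a <= - dx phi a t x by lra.
  have pq2 : - dx phi a t x <= - p ord0 a by lra.
  have hge := hopf_ge hc pq t (hval x) pq1 pq2; rewrite opprK in hge; rewrite E in ray.
  by rewrite -(ler_pM2r t0) mul0r mulrDl; lra.
have -> : dt phi t (origin R n) = - lam.
  apply: (derive_touch (dtP _)); have nt := near_t _ hn; near=> s.
  have s0 : 0 < s by near: s; exact: lt_nbhsr.
  have : w s (origin R n) <= phi s (origin R n) by near: s.
  by rewrite phiE (riemann_wave_origin (ltW s0)) (riemann_wave_origin (ltW t0)); lra.
have : Num.min (F (dx0 phi t)) (Hmin H (dx0 phi t)) <= lam; last by lra.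
apply: S1 => a; rewrite mxE.
have oE : origin R n = branch a (halfline0 R) by rewrite -hl0; rewrite -(br0 R a).
have h0 : hval (halfline0 R) = 0 by rewrite -hl0 hval_hl.
rewrite oE in hn phiE; have nx := near_x _ _ hn.
rewrite branch_br riemann_wave_br ?hval_ge0 // h0 gtr0_norm // -{1}h0 -branch_br in phiE.
apply/ler_addgt0Pr => e e0; rewrite -lerBlDr.
apply: (hderiv_ge (dxP a (halfline0 R))).
have [r r0 rP] := wave_deriv0 (@Hc a) (prof a) t0 e0.
have nr : \forall y \near halfline0 R, hval (y : halfline R) < r.
  by apply/near_halfP; exists r => // y; rewrite h0 subr0; exact/le_lt_trans/ler_norm.
near=> y => _; have h1 : wb a t (hval y) <= phi t (branch a y) by near: y.
have yr : hval y < r by near: y.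
have := rP _ (hval_ge0 y) yr; rewrite ler_norml => /andP[h2 _].
by rewrite h0 phiE; lra.
Unshelve. all: by end_near. Qed.

End RiemannWave.

Lemma wave_profile_dual (R : realType) (lam : R) (h : R -> R) (q qh : R) :
  wave_profile lam h q qh -> wave_profile (- lam) (fun r => - h (- r)) (- q) (- qh).
Proof.
move=> [hq cases]; split; first by rewrite opprK hq.
case: cases => [[qq hr]|[qq hr]]; [right|left]; rewrite lerN2; split=> // r r1 r2.
  by rewrite ltrN2; apply: hr; lra.
by rewrite ltrN2; apply: hr; lra.
Qed.

Lemma riemann_wave_dual (R : realType) (n : nat) (H : 'I_n.+1 -> R -> R)
    (p ph : 'rV[R]_n.+1) (lam : R) :
  (forall a, continuous (H a)) ->
  (forall a, wave_profile lam (H a) (p ord0 a) (ph ord0 a)) ->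
  riemann_wave (opp_ham H) (- p) (- ph) = (fun t z => - riemann_wave H p ph t z).
Proof.
move=> Hc prof; apply/funext => t; apply/funext => z.
have Hc' a : continuous (opp_ham H a) by exact: opp_cont.
have prof' a : wave_profile (- lam) (opp_ham H a) ((- p) ord0 a) ((- ph) ord0 a).
  by rewrite !mxE; exact: wave_profile_dual.
have [a [x [x0 ->]]] := brP z.
rewrite (riemann_wave_br Hc' prof') // (riemann_wave_br Hc prof) // !mxE.
have [_ [[qq _]|[qq _]]] := prof a.
  rewrite wave_concave ?lerN2 // /wave qq !opprK.
  by congr (- hopf _ _ _ _ _); apply/funext => r; rewrite /opp_ham !opprK.
rewrite [in RHS]wave_concave // opprK /wave lerN2 qq //.
Qed.
(** * Relaxation *)

Section LevelIntervals.
Context (R : realType).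
Implicit Types (h : R -> R) (x q k lam : R).

Lemma near_lt h x lam : continuous h -> h x < lam ->
  exists2 k, 0 < k & forall q, `|q - x| < k -> h q < lam.
Proof.
move=> hc hx; have : \forall q \near x, h q < lam.
  exact: (cvgr_lt (h x) (hc x) lam hx).
by move=> /nbhs_ballP[k /= k0 kP]; exists k => // q qx; apply: kP; rewrite /ball /= distrC.
Qed.

Lemma near_gt h x lam : continuous h -> lam < h x ->
  exists2 k, 0 < k & forall q, `|q - x| < k -> lam < h q.
Proof.
move=> hc hx; have : \forall q \near x, lam < h q.
  exact: (cvgr_gt (h x) (hc x) lam hx).
by move=> /nbhs_ballP[k /= k0 kP]; exists k => // q qx; apply: kP; rewrite /ball /= distrC.
Qed.

Definition below_set h lam x :=
  [set q : R | x <= q /\ forall q' : R, q' \in `[x, q[ -> h q' < lam].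

Definition above_set h lam x :=
  [set q : R | q <= x /\ forall q' : R, q' \in `]q, x] -> lam < h q'].

Lemma first_crossing h x lam (M : R) : continuous h -> h x < lam -> x <= M -> lam <= h M ->
  let s := sup (below_set h lam x) in
  [/\ x <= s, h s = lam & forall q, x <= q -> q < s -> h q < lam].
Proof.
move=> hc hx xM hM s.
pose A := below_set h lam x.
have Ax : A x.
  by split=> // q'; rewrite in_itv /= => /andP[h1 h2]; have := le_lt_trans h1 h2; rewrite ltxx.
have hsA : has_sup A.
  split; first by exists x.
  exists M => q [xq qA]; rewrite leNgt; apply/negP => Mq.
  by have := qA M; rewrite in_itv /= xM Mq => /(_ isT); rewrite ltNge hM.
have xs : x <= s by apply: sup_upper_bound.
have lts q : x <= q -> q < s -> h q < lam.
  move=> xq qs; have e0 : 0 < s - q by rewrite subr_gt0.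
  have [q' [_ q'A] qq'] := sup_adherent e0 hsA.
  by apply: q'A; rewrite in_itv /= xq; move: qq'; rewrite -/s; lra.
split=> //; apply/eqP; rewrite eq_le; apply/andP; split.
  rewrite leNgt; apply/negP => /(near_gt hc)[k k0 kP].
  have [xs'|sx] := ltP x s; last first.
    have E : s = x by apply/eqP; rewrite eq_le sx.
    have := kP x; rewrite E subrr normr0 => /(_ k0); rewrite ltNge; lra.
  pose q := Num.max x (s - k / 2).
  have qx : x <= q by rewrite /q le_max lexx.
  have qk : s - k / 2 <= q by rewrite /q le_max lexx orbT.
  have qs : q < s by rewrite /q gt_max xs'; lra.
  have := lts q qx qs; have := kP q; rewrite ltr0_norm ?subr_lt0 //.
  have : - (q - s) < k by lra.
  by move=> h1 /(_ h1); lra.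
rewrite leNgt; apply/negP => /(near_lt hc)[k k0 kP].
have : s + k / 2 <= s.
  apply: sup_upper_bound => //; split; first by lra.
  move=> q; rewrite in_itv /= => /andP[xq qs].
  have [qs'|sq] := ltP q s; first exact: lts.
  by apply: kP; rewrite ger0_norm ?subr_ge0 //; lra.
lra.
Qed.

(** In contrast with [first_crossing] the inequality is non-strict, so [s] may lie beyond the first
    point of level [lam]. The points just right of [s] with [h > lam] later serve as competitors in
    the relaxation. *)
Lemma last_below h x lam (M : R) : continuous h -> h x <= lam -> x <= M -> lam < h M ->
  exists s, [/\ x <= s, forall q, x <= q -> q <= s -> h q <= lam &
    forall k, 0 < k -> exists q, [/\ s < q, q < s + k & lam < h q]].
Proof.
move=> hc hx xM hM.
pose A := [set q | x <= q /\ forall q' : R, x <= q' -> q' <= q -> h q' <= lam].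
have Ax : A x.
  split=> // q' h1 h2; suff -> : q' = x by [].
  by apply/eqP; rewrite eq_le h1 h2.
have hsA : has_sup A.
  split; first by exists x.
  exists M => q [xq qA]; rewrite leNgt; apply/negP => Mq.
  by have := qA M xM (ltW Mq); rewrite leNgt hM.
pose s := sup A.
have xs : x <= s by apply: sup_upper_bound.
have lts q : x <= q -> q < s -> h q <= lam.
  move=> xq qs; have e0 : 0 < s - q by rewrite subr_gt0.
  have [q' [_ q'A] qq'] := sup_adherent e0 hsA.
  by apply: q'A => //; move: qq'; rewrite -/s; lra.
have hs : h s <= lam.
  rewrite leNgt; apply/negP => /(near_gt hc)[k k0 kP].
  have [xs'|sx] := ltP x s; last first.
    have E : s = x by apply/eqP; rewrite eq_le sx.
    have := kP x; rewrite E subrr normr0 => /(_ k0); lra.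
  pose q := Num.max x (s - k / 2).
  have qx : x <= q by rewrite /q le_max lexx.
  have qk : s - k / 2 <= q by rewrite /q le_max lexx orbT.
  have qs : q < s by rewrite /q gt_max xs'; lra.
  have := lts q qx qs; have := kP q; rewrite ltr0_norm ?subr_lt0 //.
  have : - (q - s) < k by lra.
  by move=> h1 /(_ h1); lra.
have les q : x <= q -> q <= s -> h q <= lam.
  by move=> xq; rewrite le_eqVlt => /orP[/eqP -> //|]; exact: lts.
exists s; split=> // k k0; apply: contrapT => nex.
have : s + k / 2 <= s.
  apply: sup_upper_bound => //; split; first by lra.
  move=> q xq qs; have [qs'|sq] := leP q s; first exact: les.
  rewrite leNgt; apply/negP => hq; apply: nex; exists q; split=> //; lra.
lra.
Qed.

Lemma last_above h x lam (M : R) : continuous h -> lam <= h x -> M <= x -> h M < lam ->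
  exists r, [/\ r <= x, forall q, r <= q -> q <= x -> lam <= h q &
    forall k, 0 < k -> exists q, [/\ r - k < q, q < r & h q < lam]].
Proof.
move=> hc hx xM hM.
have [||||s [xs sP sk]] := @last_below (fun r => - h (- r)) (- x) (- lam) (- M).
- exact: opp_cont.
- by rewrite opprK lerN2.
- by rewrite lerN2.
- by rewrite opprK ltrN2.
exists (- s); split; first by lra.
  move=> q q1 q2; have : - h (- - q) <= - lam by apply: sP; lra.
  by rewrite opprK; lra.
move=> k k0; have [q [q1 q2 q3]] := sk k k0.
by exists (- q); split; lra.
Qed.

Lemma last_crossing h x lam (M : R) : continuous h -> lam < h x -> M <= x -> h M <= lam ->
  let s := inf (above_set h lam x) in
  [/\ s <= x, h s = lam & forall q, s < q -> q <= x -> lam < h q].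
Proof.
move=> hc hx xM hM s.
have [||||] := @first_crossing (fun r => - h (- r)) (- x) (- lam) (- M).
- exact: opp_cont.
- by rewrite opprK ltrN2.
- by rewrite lerN2.
- by rewrite opprK lerN2.
have -> : sup (below_set (fun r => - h (- r)) (- lam) (- x)) = - s.
  rewrite /s /inf opprK; congr sup; apply/seteqP; split=> q.
    move=> [q1 q2]; exists (- q); last by rewrite opprK.
    split=> [|q']; first by lra.
    rewrite in_itv /= => /andP[h1 h2].
    have : - h (- - q') < - lam by apply: q2; rewrite in_itv /=; apply/andP; split; lra.
    by rewrite opprK; lra.
  move=> [q0 [q1 q2] <-]; split; first by lra.
  move=> q'; rewrite in_itv /= => /andP[h1 h2]; rewrite ltrN2; apply: q2.
  by rewrite in_itv /=; apply/andP; split; lra.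
move=> h1 h2 h3; split; first by lra.
  by rewrite opprK in h2; lra.
move=> q q1 q2; have : - h (- - q) < - lam by apply: h3; lra.
by rewrite opprK; lra.
Qed.

Lemma coercive_right h x lam : coercive h -> exists M, x <= M /\ lam < h M.
Proof.
move=> [/cvgryPgt/(_ lam) H _].
have : \forall q \near +oo, x <= q /\ lam < h q.
  by near=> q; split; near: q; [apply: nbhs_pinfty_ge; exact: num_real|exact: H].
by move=> /filter_ex.
Unshelve. all: by end_near. Qed.

(** The relaxation gives levels only up to [e]; coercivity at -oo confines near-minimisers to a
    segment, where the minimum is attained. *)
Lemma coercive_inf h x lam : continuous h -> coercive h ->
  (forall e, 0 < e -> exists2 q, q <= x & h q < lam + e) ->
  exists2 q, q <= x & h q <= lam.
Proof.
move=> hc [_ /cvgryPge/(_ (lam + 1)) Hl] Hx.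
have [N [Nx HN]] : exists N, N <= x /\ forall q, q < N -> lam + 1 <= h q.
  have [N [_ HN]] := Hl; exists (Num.min N x); split; first by rewrite ge_min lexx orbT.
  by move=> q; rewrite lt_min => /andP[qN _]; exact: HN.
have hw : {within `[N, x], continuous h} by exact: continuous_subspaceT.
have [q0] := EVT_min Nx hw; rewrite in_itv /= => /andP[q0N q0x] qmin.
exists q0 => //; rewrite leNgt; apply/negP => hq0.
(* The bound by 1 keeps the near-minimiser out of []-oo, N[]; the other bound contradicts the
   minimality of [h q0]. *)
have e0 : 0 < Num.min 1 (h q0 - lam) by rewrite lt_min ltr01 subr_gt0.
have [q qx] := Hx _ e0; have [m1 m2] : Num.min 1 (h q0 - lam) <= 1 /\
  Num.min 1 (h q0 - lam) <= h q0 - lam by rewrite !ge_min !lexx orbT.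
have [qN|Nq] := ltP q N; first by have := HN q qN; lra.
by have := qmin q; rewrite in_itv /= Nq qx => /(_ isT); lra.
Qed.

End LevelIntervals.

Section Relaxation.
Context (R : realType) (n : nat) (H : 'I_n.+1 -> R -> R) (F0 : 'rV[R]_n.+1 -> R).
Context (Hc : forall a, continuous (H a)) (Hco : forall a, coercive (H a)).
Context (F0c : continuous F0) (F0n : nonincreasing_each F0).
Implicit Types (p q r v : 'rV[R]_n.+1) (a b : 'I_n.+1).

Lemma nonincreasing_vle p q : vle q p -> F0 p <= F0 q.
Proof.
move=> qp; pose m k : 'rV[R]_n.+1 := \row_a (if (a < k)%N then q ord0 a else p ord0 a).
have m0 : m 0%N = p by apply/rowP => a; rewrite mxE.
have mn : m n.+1 = q by apply/rowP => a; rewrite mxE ltn_ord.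
rewrite -m0 -mn.
have step k : (k <= n.+1)%N -> F0 (m 0%N) <= F0 (m k).
  elim: k => [//|k IH kn]; apply: le_trans (IH (ltnW kn)) _.
  apply: (F0n (a := Ordinal kn)) => [b bk|].
    rewrite !mxE ltnS leq_eqVlt; case: eqP => [bE|//].
    by move: bk; rewrite -val_eqE /= bE eqxx.
  by rewrite !mxE /= ltnn ltnS leqnn.
exact: step.
Qed.

Local Notation U := (upper_relax H F0).
Local Notation L := (lower_relax H (upper_relax H F0)).

Lemma vle_refl p : vle p p. Proof. by move=> a. Qed.

Lemma vle_trans p q r : vle p q -> vle q r -> vle p r.
Proof. by move=> pq qr a; exact: le_trans (pq a) (qr a). Qed.

Lemma upper_relax_has_inf p :
  has_inf [set Num.max (F0 q) (Hmax H q) | q in [set q | vle q p]].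
Proof.
split; first by exists (Num.max (F0 p) (Hmax H p)), p.
exists (F0 p) => _ [q qp <-]; rewrite le_max.
by rewrite nonincreasing_vle.
Qed.

Lemma upper_relax_le p q : vle q p -> U p <= Num.max (F0 q) (Hmax H q).
Proof. by move=> qp; apply: ge_inf; [have [] := upper_relax_has_inf p|exists q]. Qed.

Lemma upper_relax_ge p c : (forall q, vle q p -> c <= Num.max (F0 q) (Hmax H q)) ->
  c <= U p.
Proof.
move=> cq; apply: lb_le_inf; first by have [] := upper_relax_has_inf p.
by move=> _ [q qp <-]; exact: cq.
Qed.

Lemma upper_relax_lt p c : U p < c -> exists q, [/\ vle q p, F0 q < c & Hmax H q < c].
Proof.
move=> Uc; have e0 : 0 < c - U p by rewrite subr_gt0.
have [_ [q qp <-]] := inf_adherent e0 (upper_relax_has_inf p).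
rewrite addrC subrK gt_max => /andP[h1 h2]; by exists q.
Qed.

Lemma upper_relax_noninc p q : vle q p -> U p <= U q.
Proof.
move=> qp; apply: upper_relax_ge => r rq; apply: upper_relax_le.
exact: vle_trans rq qp.
Qed.

Lemma relax_has_sup p :
  has_sup [set Num.min (U q) (Hmin H q) | q in [set q | vle p q]].
Proof.
split; first by exists (Num.min (U p) (Hmin H p)), p.
exists (U p) => _ [q pq <-]; rewrite ge_min.
by rewrite upper_relax_noninc.
Qed.

Lemma relax_ge p q : vle p q -> Num.min (U q) (Hmin H q) <= relax H F0 p.
Proof. by move=> pq; apply: sup_upper_bound; [exact: relax_has_sup|exists q]. Qed.

Lemma relax_le p c : (forall q, vle p q -> Num.min (U q) (Hmin H q) <= c) ->
  relax H F0 p <= c.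
Proof.
move=> cq; apply: sup_le_ub; first by have [] := relax_has_sup p.
by move=> _ [q pq <-]; exact: cq.
Qed.

Lemma relax_gt p c : c < relax H F0 p -> exists q, [/\ vle p q, c < U q & c < Hmin H q].
Proof.
move=> cL; have e0 : 0 < relax H F0 p - c by rewrite subr_gt0.
have [_ [q pq <-]] := sup_adherent e0 (relax_has_sup p).
rewrite -/(relax H F0 p) opprB addrC subrK lt_min => /andP[h1 h2]; by exists q.
Qed.

Lemma Hmin_gt (G : 'I_n.+1 -> R -> R) q c : (forall a, c < G a (q ord0 a)) -> c < Hmin G q.
Proof.
move=> cG; rewrite /Hmin; apply: (big_ind (fun x => c < x)) => // x y cx cy.
by rewrite lt_min cx.
Qed.

Context (p : 'rV[R]_n.+1).
Local Notation lam := (relax H F0 p).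
Local Notation ph := (hat H (relax H F0) p).

(** This makes the infimum in [hat] finite. Moving the other coordinates to the right, where
    [H > lam], gives [q >= p] with [Hmin H q > lam], so [relax] forces [U q <= lam]; a
    near-minimiser for [U q] then has its coordinate [a] below that of [p], at level less than
    [lam + e]. *)
Lemma level_reached a : lam < H a (p ord0 a) ->
  exists2 q, q <= p ord0 a & H a q <= lam.
Proof.
move=> Hpa; apply: coercive_inf => // e e0.
have /choice[M HM] : forall b, exists M, p ord0 b <= M /\ lam < H b M.
  by move=> b; exact: coercive_right.
pose q : 'rV[R]_n.+1 := \row_b (if b == a then p ord0 a else M b).
have pq : vle p q.
  by move=> b; rewrite mxE; case: eqP => [->//|_]; have [] := HM b.
have Hq : lam < Hmin H q.
  by apply: Hmin_gt => b; rewrite mxE; case: eqP => [->//|_]; have [] := HM b.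
have Uq : U q < lam + e.
  have := relax_ge pq; rewrite ge_min => /orP[h|h]; first lra.
  by move: Hq; rewrite ltNge h.
have [q' [q'q _ Hq']] := upper_relax_lt Uq.
exists (q' ord0 a); first by have := q'q a; rewrite mxE eqxx.
exact: le_lt_trans (Hmax_ge H q' a) Hq'.
Qed.

Lemma hat_profile a : wave_profile lam (H a) (p ord0 a) (ph ord0 a).
Proof.
rewrite /wave_profile mxE; case: eqP => [E|/eqP E].
  by split=> //; left; split=> // r r1 r2; have := lt_le_trans r1 r2; rewrite ltxx.
case: ltP => [lt|ge].
  have [M [pM HM]] := coercive_right (p ord0 a) lam (@Hco a).
  have [h1 h2 h3] := first_crossing (@Hc a) lt pM (ltW HM).
  by split=> //; right.
have gt : lam < H a (p ord0 a) by rewrite lt_def E.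
have [M Mp HM] := level_reached gt.
have [h1 h2 h3] := last_crossing (@Hc a) gt Mp HM.
by split=> //; left.
Qed.

Lemma near_row (v : 'rV[R]_n.+1) (P : set 'rV[R]_n.+1) : (\forall w \near v, P w) ->
  exists2 k : R, 0 < k & forall w : 'rV[R]_n.+1,
    (forall a, `|w ord0 a - v ord0 a| < k) -> P w.
Proof.
move=> /nbhs_ballP[k /= k0 kP]; exists k => // w wk; apply: kP.
rewrite /ball /= /mx_ball; split=> // i j; rewrite ord1 /ball /= distrC; exact: wk.
Qed.

Lemma finite_margin (d : 'I_n.+1 -> R) (e0 : R) : 0 < e0 -> (forall a, 0 < d a) ->
  exists e, [/\ 0 < e, e <= e0 & forall a, e <= d a].
Proof.
move=> e00 d0; have : \forall e \near (0 : R)^'+, [/\ 0 < e, e <= e0 & forall a, e <= d a].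
  near=> e; split; first by near: e; exact: nbhs_right_gt.
    by near: e; exact: nbhs_right_le.
  near: e; apply: (@filter_forall _ _ (fun a e => e <= d a)) => a.
  exact: nbhs_right_le.
by move=> /filter_ex.
Unshelve. all: by end_near. Qed.

(** [s] ends the maximal interval to the right of [ph] on which [H <= lam]. If [F0 s > lam], there
    are [v] near [s] with [F0 v > lam + e0] and [q >= p] of levels above [lam] such that every
    [q' <= q] of levels below [lam + e] satisfies [q' <= v]. By monotonicity [U q] would be at least
    [lam + e], too large for the supremum [lam]. *)
Lemma right_endpoint : exists s : 'rV[R]_n.+1, [/\ vle ph s,
  forall a (q : R), ph ord0 a <= q -> q <= s ord0 a -> H a q <= lam & F0 s <= lam].
Proof.
have /choice[f Hf] : forall a, exists s : R, [/\ ph ord0 a <= s,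
    forall q : R, ph ord0 a <= q -> q <= s -> H a q <= lam &
    forall k, 0 < k -> exists q : R, [/\ s < q, q < s + k & lam < H a q]].
  move=> a; have [hE _] := hat_profile a.
  have [M [pM HM]] := coercive_right (ph ord0 a) lam (@Hco a).
  by apply: (last_below (@Hc a) _ pM HM); rewrite hE.
pose s : 'rV[R]_n.+1 := \row_a f a.
have sE a : s ord0 a = f a by rewrite mxE.
exists s; split.
- by move=> a; rewrite sE; have [] := Hf a.
- by move=> a q; rewrite sE; have [_ h _] := Hf a; exact: h.
rewrite leNgt; apply/negP => Fs.
pose e0 := (F0 s - lam) / 2; have e00 : 0 < e0 by rewrite /e0; lra.
have [k k0 kP] : exists2 k : R, 0 < k & forall w : 'rV[R]_n.+1,
    (forall a, `|w ord0 a - s ord0 a| < k) -> lam + e0 < F0 w.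
  have Fe : lam + e0 < F0 s by rewrite /e0; lra.
  by apply: near_row; exact: (cvgr_gt (F0 s) (@F0c s) _ Fe).
(* If [p <= ph], both [q] and [v] are one point just right of [s], and any margin will do. If
   [ph < p], then [H > lam] just right of [ph] forces [s = ph]; [q] is [p], [v] is slightly right of
   [ph], and the margin is the gap of [H] above [lam] on [[v, p]]. *)
have /choice[g Hg] : forall a, exists qve : (R * R) * R,
    [/\ p ord0 a <= qve.1.1 /\ lam < H a qve.1.1, `|qve.1.2 - f a| < k, 0 < qve.2 &
      forall q' : R, q' <= qve.1.1 -> H a q' < lam + qve.2 -> q' <= qve.1.2].
  move=> a; have [hE cases] := hat_profile a; have [fa1 fa2 fa3] := Hf a.
  have [pp|pp] := leP (p ord0 a) (ph ord0 a).
    have [q [q1 q2 q3]] := fa3 k k0; exists (q, q, 1); split=> //=.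
    - by split=> //; apply: le_trans pp _; apply: le_trans fa1 _; exact: ltW.
    - by rewrite gtr0_norm ?subr_gt0 //; lra.
  case: cases => -[pp' hlt]; last by move: pp; rewrite ltNge pp'.
  have fE : f a = ph ord0 a.
    apply/eqP; rewrite eq_le fa1 andbT leNgt; apply/negP => pf.
    pose m := Num.min (f a) (p ord0 a).
    have m1 : ph ord0 a < m by rewrite /m lt_min pf.
    have m2 : m <= f a by rewrite /m ge_min lexx.
    have m3 : m <= p ord0 a by rewrite /m ge_min lexx orbT.
    by have := fa2 m (ltW m1) m2; rewrite leNgt hlt.
  pose v := ph ord0 a + k / 2.
  have [e ee eP] : exists2 e, 0 < e & forall q' : R, v <= q' -> q' <= p ord0 a -> lam + e <= H a q'.
    have [vp|pv] := leP v (p ord0 a); last by exists 1 => // q' h1 h2; lra.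
    have hw : {within `[v, p ord0 a], continuous (H a)} by apply: continuous_subspaceT; exact: Hc.
    have [q0] := EVT_min vp hw; rewrite in_itv /= => /andP[q0v q0p] qmin.
    exists (H a q0 - lam); first by rewrite subr_gt0; apply: hlt => //; move: q0v; rewrite /v; lra.
    by move=> q' h1 h2; rewrite addrC subrK; apply: qmin; rewrite in_itv /= h1.
  exists (p ord0 a, v, e); split=> //=.
  - by split=> //; exact: hlt.
  - rewrite fE /v (_ : _ - _ = k / 2); last by ring.
    by rewrite gtr0_norm; lra.
  - move=> q' h1 h2; rewrite leNgt; apply/negP => h3.
    by have := eP q' (ltW h3) h1; lra.
have [e [e1 e2 e3]] : exists e, [/\ 0 < e, e <= e0 & forall a, e <= (g a).2].
  by apply: finite_margin => // a; have [] := Hg a.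
pose q : 'rV[R]_n.+1 := \row_a (g a).1.1.
pose v : 'rV[R]_n.+1 := \row_a (g a).1.2.
have pq : vle p q by move=> a; rewrite mxE; have [[]] := Hg a.
have Hq : lam < Hmin H q by apply: Hmin_gt => a; rewrite mxE; have [[]] := Hg a.
have Uq : U q < lam + e.
  have := relax_ge pq; rewrite ge_min => /orP[h|h]; first lra.
  by move: Hq; rewrite ltNge h.
have [q' [q'q Fq' Hq']] := upper_relax_lt Uq.
have q'v : vle q' v.
  move=> a; rewrite mxE; have [_ _ _ ga] := Hg a; apply: ga.
    by have := q'q a; rewrite mxE.
  by have := Hmax_ge H q' a; have := e3 a; lra.
have := nonincreasing_vle q'v.
have : lam + e0 < F0 v by apply: kP => a; rewrite !mxE; have [] := Hg a.
lra.
Qed.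

(** In the second alternative the competitor enters the inner infimum: if [F0 r < lam], there is [v]
    near [r] with [F0 v] and all levels below [lam - e], such that every [q >= p] of levels above
    [lam - e] satisfies [v <= q]. Then [U q] is below [lam - e] for all these [q], and the supremum
    cannot reach [lam]. *)
Lemma left_endpoint : (exists a, forall q : R, q <= ph ord0 a -> lam <= H a q) \/
  exists r : 'rV[R]_n.+1, [/\ vle r ph,
    forall a (q : R), r ord0 a <= q -> q <= ph ord0 a -> lam <= H a q & lam <= F0 r].
Proof.
have [[a Ha]|nex] := pselect (exists a, forall q : R, q <= ph ord0 a -> lam <= H a q).
  by left; exists a.
right.
have /choice[f Hf] : forall a, exists r : R, [/\ r <= ph ord0 a,
    forall q : R, r <= q -> q <= ph ord0 a -> lam <= H a q &
    forall k, 0 < k -> exists q : R, [/\ r - k < q, q < r & H a q < lam]].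
  move=> a; have [hE _] := hat_profile a.
  have [M [pM HM]] : exists M, M <= ph ord0 a /\ H a M < lam.
    apply: contrapT => nM; apply: nex; exists a => q qp; rewrite leNgt; apply/negP => hq.
    by apply: nM; exists q.
  by apply: (last_above (@Hc a) _ pM HM); rewrite hE.
pose r : 'rV[R]_n.+1 := \row_a f a.
have rE a : r ord0 a = f a by rewrite mxE.
exists r; split.
- by move=> a; rewrite rE; have [] := Hf a.
- by move=> a q; rewrite rE; have [_ h _] := Hf a; exact: h.
rewrite leNgt; apply/negP => Fr.
pose e0 := (lam - F0 r) / 2; have e00 : 0 < e0 by rewrite /e0; lra.
have [k k0 kP] : exists2 k : R, 0 < k & forall w : 'rV[R]_n.+1,
    (forall a, `|w ord0 a - r ord0 a| < k) -> F0 w < lam - e0.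
  have Fe : F0 r < lam - e0 by rewrite /e0; lra.
  by apply: near_row; exact: (cvgr_lt (F0 r) (@F0c r) _ Fe).
(* If [ph <= p], a point [v] just left of [r] is below every [q >= p]. Otherwise [H < lam] just left
   of [ph] forces [r = ph]; [v] is taken in [[p, ph[] close to [ph], and the gap of [H] below [lam]
   on [[p, v]] excludes [q < v] at levels near [lam]. *)
have /choice[g Hg] : forall a, exists ve : R * R,
    [/\ `|ve.1 - f a| < k, 0 < ve.2, H a ve.1 < lam - ve.2 &
      forall q : R, p ord0 a <= q -> lam - ve.2 < H a q -> ve.1 <= q].
  move=> a; have [hE cases] := hat_profile a; have [fa1 fa2 fa3] := Hf a.
  have [pp|pp] := leP (ph ord0 a) (p ord0 a).
    have [v [v1 v2 v3]] := fa3 k k0; exists (v, (lam - H a v) / 2); split=> /=.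
    - by rewrite distrC gtr0_norm ?subr_gt0 //; lra.
    - by lra.
    - by lra.
    - by move=> q h1 _; lra.
  case: cases => -[pp' hlt]; first by move: pp; rewrite ltNge pp'.
  have fE : f a = ph ord0 a.
    apply/eqP; rewrite eq_le fa1 /= leNgt; apply/negP => pf.
    pose m := Num.max (f a) (p ord0 a).
    have m1 : m < ph ord0 a by rewrite /m gt_max pf.
    have m2 : f a <= m by rewrite /m le_max lexx.
    have m3 : p ord0 a <= m by rewrite /m le_max lexx orbT.
    by have := fa2 m m2 (ltW m1); rewrite leNgt hlt.
  pose v := Num.max (ph ord0 a - k / 2) (p ord0 a).
  have v1 : p ord0 a <= v by rewrite /v le_max lexx orbT.
  have v2 : v < ph ord0 a by rewrite /v gt_max pp andbT; lra.
  have v3 : ph ord0 a - k / 2 <= v by rewrite /v le_max lexx.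
  have hw : {within `[p ord0 a, v], continuous (H a)} by apply: continuous_subspaceT; exact: Hc.
  have [q0] := EVT_max v1 hw; rewrite in_itv /= => /andP[q0p q0v] qmax.
  have hq0 : H a q0 < lam by apply: hlt => //; exact: le_lt_trans v2.
  have hqv : H a v <= H a q0 by apply: qmax; rewrite in_itv /= v1 lexx.
  exists (v, (lam - H a q0) / 2); split=> /=.
  - by rewrite fE distrC gtr0_norm ?subr_gt0 //; lra.
  - by lra.
  - by lra.
  - move=> q h1 h2; rewrite leNgt; apply/negP => h3.
    have : H a q <= H a q0 by apply: qmax; rewrite in_itv /= h1 ltW.
    lra.
have [e [e1 e2 e3]] : exists e, [/\ 0 < e, e <= e0 & forall a, e <= (g a).2].
  by apply: finite_margin => // a; have [] := Hg a.
pose v : 'rV[R]_n.+1 := \row_a (g a).1.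
have le : lam - e < lam by lra.
have [q [pq Uq Hq]] := relax_gt le.
have vq : vle v q.
  move=> a; rewrite mxE; have [_ _ _ ga] := Hg a; apply: ga => //.
  by have := Hmin_le H q a; have := e3 a; lra.
have := upper_relax_le vq; rewrite le_max => /orP[h|h].
  have : F0 v < lam - e0 by apply: kP => a; rewrite !mxE; have [] := Hg a.
  lra.
have [a aE] := Hmax_attained H v; rewrite aE mxE in h.
by have [_ _ ga _] := Hg a; have := e3 a; lra.
Qed.

(** Either some coordinate of [q] lies between those of [ph] and [s], where [H <= lam], or [q]
    exceeds [s] in every coordinate and monotonicity reduces to [F0 s]. [flux_max_ge] argues
    likewise on the left. *)
Lemma flux_min_le q : vle ph q -> Num.min (F0 q) (Hmin H q) <= lam.
Proof.
move=> pq; have [s [ps Hs Fs]] := right_endpoint.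
rewrite ge_min; have [[a sa]|nex] := pselect (exists a, q ord0 a <= s ord0 a).
  by apply/orP; right; apply: le_trans (Hmin_le H q a) _; exact: Hs.
apply/orP; left; apply: le_trans Fs; apply: nonincreasing_vle => a.
by apply/ltW; rewrite ltNge; apply/negP => qs; apply: nex; exists a.
Qed.

Lemma flux_max_ge q : vle q ph -> lam <= Num.max (F0 q) (Hmax H q).
Proof.
move=> pq; rewrite le_max; have [[a Ha]|[r [rp Hr Fr]]] := left_endpoint.
  by apply/orP; right; apply: le_trans (Hmax_ge H q a); exact: Ha.
have [[a sa]|nex] := pselect (exists a, r ord0 a <= q ord0 a).
  by apply/orP; right; apply: le_trans (Hmax_ge H q a); exact: Hr.
apply/orP; left; apply: le_trans Fr _; apply: nonincreasing_vle => a.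
by apply/ltW; rewrite ltNge; apply/negP => qs; apply: nex; exists a.
Qed.

(** For the lower bound, [ph] is its own competitor in the supremum, [flux_max_ge] controlling [U]
    there. For the upper bound the dichotomy of [flux_min_le] recurs, with [s] as competitor in the
    infimum defining [U q]. *)
Lemma relax_hat : relax H F0 ph = lam.
Proof.
apply/eqP; rewrite eq_le; apply/andP; split; last first.
  apply: le_trans (relax_ge (vle_refl ph)); rewrite le_min; apply/andP; split.
    by apply: upper_relax_ge => q; exact: flux_max_ge.
  by apply: Hmin_ge => a; have [-> _] := hat_profile a.
apply: relax_le => q pq; have [s [ps Hs Fs]] := right_endpoint.
rewrite ge_min; have [[a sa]|nex] := pselect (exists a, q ord0 a <= s ord0 a).
  by apply/orP; right; apply: le_trans (Hmin_le H q a) _; exact: Hs.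
apply/orP; left; have sq : vle s q.
  by move=> a; apply/ltW; rewrite ltNge; apply/negP => qs; apply: nex; exists a.
apply: le_trans (upper_relax_le sq) _; rewrite ge_max Fs /=.
by have [a ->] := Hmax_attained H s; exact: Hs.
Qed.

(** Between [ph] and [p] the Hamiltonian stays on one side of [lam], so the extremum is attained at
    the end [ph]. *)
Lemma godunov_hat a : godunov (H a) (ph ord0 a) (p ord0 a) = lam.
Proof.
have [hE cases] := hat_profile a; rewrite /godunov.
set x := ph ord0 a in hE cases *; set y := p ord0 a in cases *.
have [xy|yx] := leP x y.
  have ge (q : R) : x <= q -> q <= y -> lam <= H a q.
    rewrite le_eqVlt => /orP[/eqP <-|xq qy]; first by rewrite hE.
    case: cases => -[xy' hq]; first exact/ltW/hq.
    by have := lt_le_trans xq qy; rewrite ltNge xy'.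
  apply/eqP; rewrite eq_le; apply/andP; split.
    rewrite -hE; apply: ge_inf; last by exists x => //=; rewrite in_itv /= lexx.
    by exists lam => _ /= [q + <-]; rewrite in_itv /= => /andP[]; exact: ge.
  apply: lb_le_inf; first by exists (H a x), x => //=; rewrite in_itv /= lexx.
  by move=> _ /= [q + <-]; rewrite in_itv /= => /andP[]; exact: ge.
have le (q : R) : y <= q -> q <= x -> H a q <= lam.
  move=> yq; rewrite le_eqVlt => /orP[/eqP ->|qx]; first by rewrite hE.
  by case: cases => -[xy' hq]; [move: yx; rewrite ltNge xy'|exact/ltW/hq].
apply/eqP; rewrite eq_le; apply/andP; split.
  apply: sup_le_ub; first by exists (H a x), x => //=; rewrite in_itv /= lexx ltW.
  by move=> _ /= [q + <-]; rewrite in_itv /= => /andP[]; exact: le.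
rewrite -[leLHS]hE; apply: ub_le_sup; last by exists x => //=; rewrite in_itv /= lexx ltW.
by exists lam => _ /= [q + <-]; rewrite in_itv /= => /andP[]; exact: le.
Qed.

End Relaxation.
(** * The Riemann problem *)

Lemma riemann_datumN (R : realType) (n : nat) (p : 'rV[R]_n.+1) (z : junction R n) :
  riemann_datum (- p) z = - riemann_datum p z.
Proof.
by have [a [x [x0 ->]]] := brP z; rewrite !riemann_br // mxE mulNr.
Qed.

Lemma usc_env_ge (R : realType) (n : nat) (u : R -> junction R n -> R) (t c : R) z :
  0 <= t -> (usc_env u t z <= c%:E)%E -> u t z <= c.
Proof.
move=> t0 /limf_esup_leP uc; apply/ler_addgt0Pr => e e0.
have : \forall w \near (t, z), 0 <= w.1 -> u w.1 w.2 <= c + e by exact: uc.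
by move=> /nbhs_singleton; apply.
Qed.

Section RiemannComparison.
Context (R : realType) (n : nat) (H : 'I_n.+1 -> R -> R) (F : 'rV[R]_n.+1 -> R).
Context (p ph : 'rV[R]_n.+1) (lam : R) (u : R -> junction R n -> R).
Context (Hc : forall a, continuous (H a)).
Context (prof : forall a, wave_profile lam (H a) (p ord0 a) (ph ord0 a)).
Context (usub : weak_sub H F u).
Context (uinit : forall z, (usc_env u 0 z <= (riemann_datum p z)%:E)%E).
Context (ubd : forall T : R, 0 < T -> exists M : R, forall (t : R) z,
  0 <= t -> t < T -> u t z <= riemann_datum p z + M).

(** A supremum branch is one application of [branch_bound] on [[ph, p]]. On an infimum branch each
    single slope of [[p, ph]] gives an affine upper bound, admissible because [H <= lam] there, and
    the wave is the infimum of these bounds. *)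
Lemma le_riemann_wave t z : origin_bounded u lam -> 0 < t -> u t z <= riemann_wave H p ph t z.
Proof.
move=> ob t0; have [a [x [+ ->]]] := brP z.
rewrite le_eqVlt => /orP[/eqP <-|x0].
  by rewrite br0 (riemann_wave_origin Hc prof (ltW t0)); exact: ob.1.
rewrite (riemann_wave_br Hc prof) ?(ltW x0) // gtr0_norm //.
have [hE _] := prof a.
case: (wave_cases (prof a)) => [[pq hlt]|[pq [hlt ->]]].
  rewrite /wave pq; apply: (branch_bound usub uinit ubd Hc ob) => //.
    exact: lt_le_min.
  by rewrite hE.
have [q [q1 q2 ->]] := hopf_attained (opp_cont (@Hc a)) pq t x.
have qlam : H a (- q) <= lam.
  move: q1; rewrite le_eqVlt => /orP[/eqP <-|q1]; first by rewrite opprK hE.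
  by have := hlt q q1 q2; rewrite opprK hE; lra.
have pq' : p ord0 a <= - q by lra.
have qmin r : - q <= r -> r <= - q -> H a (- q) <= H a r.
  by move=> r1 r2; have -> : r = - q by apply/eqP; rewrite eq_le r1 r2.
have := branch_bound usub uinit ubd Hc ob (lexx (- q)) pq' qmin qlam t0 x0.
have [q' [h1 h2 ->]] := hopf_attained (@Hc a) (lexx (- q)) t x.
have -> : q' = - q by apply/eqP; rewrite eq_le h1 h2.
by move=> /le_trans; apply; lra.
Qed.

Lemma profile_extend a q : ph ord0 a <= q -> q <= Num.max (p ord0 a) (ph ord0 a) ->
  lam <= H a q.
Proof.
have [hE cases] := prof a; rewrite le_eqVlt => /orP[/eqP <-|pq]; first by rewrite hE.
case: cases => -[pp hlt] qm; last by move: qm; rewrite (max_idPr pp) leNgt pq.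
by apply/ltW/hlt => //; rewrite -(max_idPl pp).
Qed.

(** Barriers must also dominate the datum, hence the right end [max(p, ph)], up to which [H >= lam]
    persists by [profile_extend]. *)
Lemma le_wave_junction (r : 'rV[R]_n.+1) t z : vle r ph ->
  (forall a q, r ord0 a <= q -> q <= ph ord0 a -> lam <= H a q) -> lam <= F r ->
  0 < t -> u t z <= riemann_wave H p ph t z.
Proof.
move=> rp Hr Fr; apply: le_riemann_wave.
apply: (@origin_bound_junction _ _ _ _ p _ usub uinit ubd Hc
  (fun a => Num.max (p ord0 a) (ph ord0 a)) lam _ r) => //.
- by move=> a; rewrite le_max lexx.
- by move=> a; rewrite le_max (rp a) orbT.
- move=> a q rq qm; have [qp|/ltW pq] := leP q (ph ord0 a); first exact: Hr.
  exact: profile_extend.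
Qed.

Lemma le_wave_coercive a t z : weak_continuity u ->
  (forall q, q <= ph ord0 a -> lam <= H a q) ->
  0 < t -> u t z <= riemann_wave H p ph t z.
Proof.
move=> wc Ha; apply: le_riemann_wave.
apply: (@origin_bound_coercive _ _ _ _ p _ usub uinit ubd Hc
  (fun a => Num.max (p ord0 a) (ph ord0 a)) lam _ a) => //.
- by move=> b; rewrite le_max lexx.
- move=> q qm; have [qp|/ltW pq] := leP q (ph ord0 a); first exact: Ha.
  exact: profile_extend.
Qed.

End RiemannComparison.

Section RiemannProblem.
Context (R : realType) (n : nat) (H : 'I_n.+1 -> R -> R) (F0 : 'rV[R]_n.+1 -> R).
Context (p : 'rV[R]_n.+1).
Context (Hc : forall a, continuous (H a)) (Hco : forall a, coercive (H a)).
Context (F0c : continuous F0) (F0n : nonincreasing_each F0).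
Local Notation lam := (relax H F0 p).
Local Notation ph := (hat H (relax H F0) p).
Local Notation w := (riemann_wave H p ph).

Let prof a : wave_profile lam (H a) (p ord0 a) (ph ord0 a).
Proof. exact: hat_profile. Qed.

Let Hc' a : continuous (opp_ham H a).
Proof. exact: opp_cont. Qed.

Let prof' a : wave_profile (- lam) (opp_ham H a) ((- p) ord0 a) ((- ph) ord0 a).
Proof. by rewrite [(- p) _ _]mxE [(- ph) _ _]mxE; exact: wave_profile_dual. Qed.

Lemma riemann_wave_solution : riemann_solution H F0 p w.
Proof.
split; last by exact: (riemann_wave_distance Hc prof).
  split.
  - by apply: (riemann_wave_sub Hc prof) => q; exact: flux_min_le.
  - apply/weak_super_dual; rewrite -(riemann_wave_dual Hc prof).
    apply: (riemann_wave_sub Hc' prof') => q pq.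
    rewrite Hmin_opp /opp_flux -oppr_max lerN2; apply: (flux_max_ge Hc Hco F0c F0n) => a.
    by have := pq a; rewrite [(- ph) _ _]mxE [(- q) _ _]mxE; lra.
  - have wE y : usc_env w 0 y = (w 0 y)%:E.
      by apply: usc_env_continuous => //; exact: (riemann_wave_continuous Hc prof).
    have wE' y : usc_env (riemann_wave (opp_ham H) (- p) (- ph)) 0 y =
        (riemann_wave (opp_ham H) (- p) (- ph) 0 y)%:E.
      by apply: usc_env_continuous => //; exact: (riemann_wave_continuous Hc' prof').
    move=> z; split; first by rewrite wE (riemann_wave0 Hc prof).
    rewrite -leeN2 -usc_envN -(riemann_wave_dual Hc prof) wE'.
    by rewrite (riemann_wave0 Hc' prof') riemann_datumN.
exact: (riemann_wave_weak_continuity Hc prof).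
Qed.

Lemma riemann_solution_wave u : riemann_solution H F0 p u ->
  forall t z, 0 <= t -> u t z = w t z.
Proof.
move=> [[usub usup uinit] wc ubd] t z.
have usup' : weak_sub (opp_ham H) (opp_flux F0) (fun s y => - u s y).
  by apply/weak_super_dual.
have uinit1 y : (usc_env u 0 y <= (riemann_datum p y)%:E)%E by have [] := uinit y.
have uinit2 y : (usc_env (fun s y => (- u s y)%R) 0 y <= (riemann_datum (- p)%R y)%:E)%E.
  by rewrite usc_envN riemann_datumN EFinN leeN2; have [] := uinit y.
have ubd1 (T : R) : 0 < T -> exists M : R, forall (t : R) y,
    0 <= t -> t < T -> u t y <= riemann_datum p y + M.
  move=> T0; have [M HM] := ubd T T0; exists M => s y s0 sT.
  by have := HM s y s0 sT; rewrite ler_norml => /andP[]; lra.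
have ubd2 (T : R) : 0 < T -> exists M : R, forall (t : R) y,
    0 <= t -> t < T -> - u t y <= riemann_datum (- p) y + M.
  move=> T0; have [M HM] := ubd T T0; exists M => s y s0 sT.
  by have := HM s y s0 sT; rewrite riemann_datumN ler_norml => /andP[]; lra.
rewrite le_eqVlt => /orP[/eqP <-|t0].
  rewrite (riemann_wave0 Hc prof); apply/eqP; rewrite eq_le usc_env_ge //=.
  by rewrite -lerN2 -riemann_datumN (usc_env_ge _ (uinit2 z)).
apply/eqP; rewrite eq_le; apply/andP; split.
  have [[a Ha]|[r [rp Hr Fr]]] := left_endpoint Hc Hco F0c F0n p.
    exact: (le_wave_coercive Hc prof usub uinit1 ubd1 _ wc Ha t0).
  exact: (le_wave_junction Hc prof usub uinit1 ubd1 _ rp Hr Fr t0).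
(* For [- u] the row [- s] takes the place of [r]; as it always exists, a single case remains. *)
have [s [ps Hs Fs]] := right_endpoint Hc Hco F0c F0n p.
rewrite -lerN2 -[leRHS]/((fun s y => - riemann_wave H p ph s y) t z).
rewrite -(riemann_wave_dual Hc prof).
apply: (le_wave_junction Hc' prof' usup' uinit2 ubd2 (r := - s)) => //.
- by move=> a; rewrite [(- s) _ _]mxE [(- ph) _ _]mxE lerN2.
- move=> a q; rewrite [(- s) _ _]mxE [(- ph) _ _]mxE /opp_ham lerN2 => q1 q2.
  by apply: Hs; lra.
- by rewrite /opp_flux opprK lerN2.
Qed.

End RiemannProblem.

Theorem theorem7p2 (R : realType) (n : nat) (H : 'I_n.+1 -> R -> R)
    (F0 : 'rV[R]_n.+1 -> R) (p : 'rV[R]_n.+1)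
    (Hcont : forall a, continuous (H a))
    (Hcoer : forall a, coercive (H a))
    (F0cont : continuous F0)
    (F0noninc : nonincreasing_each F0) :
  let F := relax H F0 in
  let phat := hat H F p in
  [/\ exists u, riemann_solution H F0 p u,
      forall u v, riemann_solution H F0 p u -> riemann_solution H F0 p v ->
        forall t x, 0 <= t -> u t x = v t x &
      forall u, riemann_solution H F0 p u ->
        [/\ forall t : R, 0 < t ->
              is_derive t (1 : R) (u ^~ (origin R n)) (- F p),
            forall t : R, 0 < t -> forall a : 'I_n.+1,
              has_hderiv (fun x => u t (branch a x)) (halfline0 R)
                (phat ord0 a),
            F phat = F p,
            germ H F (F phat, phat) &
            forall a : 'I_n.+1,
              [/\ F p = F phat,
                  F phat = godunov (H a) (phat ord0 a) (p ord0 a) &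
                  godunov (H a) (phat ord0 a) (p ord0 a) =
                    H a (phat ord0 a)]]].
Proof.
cbv zeta; have prof a := hat_profile Hcont Hcoer F0noninc p a.
have uE u := @riemann_solution_wave R n H F0 p Hcont Hcoer F0cont F0noninc u.
have relaxE := relax_hat Hcont Hcoer F0cont F0noninc p.
split.
- by exists (riemann_wave H p (hat H (relax H F0) p)); exact: riemann_wave_solution.
- by move=> u v /uE uw /uE vw t x t0; rewrite uw // vw.
move=> u /uE uw; split.
(* For [|s - t| < t] the time [s] is positive, so the linear formula holds on this whole
   neighbourhood and the remainder vanishes. *)
- move=> t t0; apply/is_derive1P => e e0; exists t => // s st.
  have s0 : 0 < s by move: st; rewrite ltr_norml => /andP[]; lra.
  rewrite !uw ?(ltW s0) ?(ltW t0) // !(riemann_wave_origin Hcont prof) ?(ltW s0) ?(ltW t0) //.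
  set l := relax H F0 p.
  have -> : - l * s - - l * t - - l * (s - t) = 0 by ring.
  by rewrite normr0 mulr_ge0 // ltW.
- move=> t t0 a.
  have -> : (fun x => u t (branch a x)) =
      (fun x => riemann_wave H p (hat H (relax H F0) p) t (branch a x)).
    by apply/funext => x; rewrite uw // ltW.
  exact: (riemann_wave_hderiv Hcont prof).
- exact: relaxE.
- split=> //= a; rewrite relaxE; by have [-> _] := prof a.
- move=> a; have [HE _] := prof a; have GE := godunov_hat Hcont Hcoer F0noninc p a.
  by rewrite relaxE GE HE.
Qed.
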